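(* Let $X$ be a proper geodesic Gromov hyperbolic space equipped with a proper, isometric and non-elementary action of a group $G$. Then $$\mathrm{Hdim}(\Lambda^{c}G)=\mathrm{Hdim}(\Lambda^{u}G)=\mathrm{Hdim}(\Lambda^{m}G)=\frac{\omega_G}{\epsilon},$$ where Hausdorff dimension is taken with respect to a visual metric on $\partial X$ with parameter $\epsilon$.
   Context: Visual metric: for a $\delta$-hyperbolic proper geodesic space $X$ with basepoint $o$ there is $\epsilon_0>0$ such that for $\epsilon\in(0,\epsilon_0)$ there is a metric $\rho_\epsilon$ on $\partial X$ with $\rho_\epsilon(\xi,\eta)\asymp e^{-\epsilon d(o,[\xi,\eta])}$, implicit constants depending only on $\delta$. $\omega_G=\limsup_n \frac1n\log\#\{g: d(o,go)\le n\}$. $\Lambda G$ is the set of accumulation points of $Go$ in $\partial X$; non-elementary means $|\Lambda G|\ge3$. $\xi\in\Lambda G$ is conical if there are $g_n\in G$, $R>0$ with $g_no\to\xi$ and all $g_no$ within $R$ of a geodesic ray $[o,\xi)$; it is uniformly conical if moreover $\sup_n d(g_no,g_{n+1}o)<\infty$. $\xi\in\Lambda G$ is a Myrberg point if for every pair of distinct $a,b\in\Lambda G$ there exist $g_n\in G$ with $g_no\to a$ and $g_n\xi\to b$. $\Lambda^cG,\Lambda^uG,\Lambda^mG$ denote the conical, uniformly conical and Myrberg limit sets. *)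

(* Defs.v *)
From Stdlib Require Import Reals Lra ClassicalEpsilon.
From Coquelicot Require Import Coquelicot.
Open Scope R_scope.

Section Defs.

Definition is_metric {T : Type} (d : T -> T -> R) : Prop :=
  (forall x y, 0 <= d x y) /\
  (forall x y, d x y = 0 <-> x = y) /\
  (forall x y, d x y = d y x) /\
  (forall x y z, d x z <= d x y + d y z).

Definition seq_conv {T : Type} (d : T -> T -> R) (u : nat -> T) (l : T) : Prop :=
  forall e, 0 < e -> exists N, forall n, (N <= n)%nat -> d (u n) l < e.

Definition proper_space {T : Type} (d : T -> T -> R) : Prop :=
  forall (x : T) (r : R) (u : nat -> T), (forall n, d x (u n) <= r) ->
    exists (phi : nat -> nat) (l : T),
      (forall n, (phi n < phi (S n))%nat) /\ d x l <= r /\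
      seq_conv d (fun n => u (phi n)) l.

Definition geodesic_space {T : Type} (d : T -> T -> R) : Prop :=
  forall x y, exists g : R -> T,
    g 0 = x /\ g (d x y) = y /\
    forall s t, 0 <= s <= d x y -> 0 <= t <= d x y -> d (g s) (g t) = Rabs (s - t).

Definition gromov_product {T : Type} (d : T -> T -> R) (w x y : T) : R :=
  (d w x + d w y - d x y) / 2.

Definition delta_hyperbolic {T : Type} (d : T -> T -> R) (delta : R) : Prop :=
  forall w x y z,
    Rmin (gromov_product d w x y) (gromov_product d w y z) - delta
      <= gromov_product d w x z.

Definition gromov_hyperbolic {T : Type} (d : T -> T -> R) : Prop :=
  exists delta, 0 <= delta /\ delta_hyperbolic d delta.

Variables (X : Type) (d : X -> X -> R) (o : X).

Definition seq_equiv (x y : nat -> X) : Prop :=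
  forall K, exists M, forall i j, (M <= i)%nat -> (M <= j)%nat ->
    K <= gromov_product d o (x i) (y j).

Definition conv_infty (x : nat -> X) : Prop := seq_equiv x x.

Definition is_bpoint (S : (nat -> X) -> Prop) : Prop :=
  exists x, conv_infty x /\ forall y, S y <-> (conv_infty y /\ seq_equiv x y).

Definition bpoint : Type := { S : (nat -> X) -> Prop | is_bpoint S }.

Definition conv_to_bd (u : nat -> X) (xi : bpoint) : Prop := proj1_sig xi u.

Definition bd_gp_ge (P Q : (nat -> X) -> Prop) (K : R) : Prop :=
  exists x y, P x /\ Q y /\
    exists M, forall i j, (M <= i)%nat -> (M <= j)%nat ->
      K <= gromov_product d o (x i) (y j).

Definition bd_conv (P : nat -> ((nat -> X) -> Prop)) (b : bpoint) : Prop :=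
  forall K, exists N, forall n, (N <= n)%nat -> bd_gp_ge (P n) (proj1_sig b) K.

Definition geod_ray (g : R -> X) (xi : bpoint) : Prop :=
  g 0 = o /\ (forall s t, 0 <= s -> 0 <= t -> d (g s) (g t) = Rabs (s - t)) /\
  conv_to_bd (fun n => g (INR n)) xi.

Definition biinf_geod (g : R -> X) (xi eta : bpoint) : Prop :=
  (forall s t, d (g s) (g t) = Rabs (s - t)) /\
  conv_to_bd (fun n => g (- INR n)) xi /\
  conv_to_bd (fun n => g (INR n)) eta.

Definition dist_to_geod (g : R -> X) : R :=
  real (Glb_Rbar (fun r => exists t, r = d o (g t))).

Definition visual_metric (rho : bpoint -> bpoint -> R) (eps : R) : Prop :=
  is_metric rho /\
  exists C, 1 <= C /\
    forall xi eta g, xi <> eta -> biinf_geod g xi eta ->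
      / C * exp (- eps * dist_to_geod g) <= rho xi eta /\
      rho xi eta <= C * exp (- eps * dist_to_geod g).

Variables (G : Type) (mul : G -> G -> G) (inv : G -> G) (e : G) (act : G -> X -> X).

Definition is_group : Prop :=
  (forall a b c, mul a (mul b c) = mul (mul a b) c) /\
  (forall a, mul e a = a /\ mul a e = a) /\
  (forall a, mul (inv a) a = e /\ mul a (inv a) = e).

Definition isometric_action : Prop :=
  (forall x, act e x = x) /\
  (forall a b x, act (mul a b) x = act a (act b x)) /\
  (forall a x y, d (act a x) (act a y) = d x y).

Definition finite_set {T : Type} (P : T -> Prop) : Prop :=
  exists l : list T, forall t, P t -> List.In t l.

Definition proper_action : Prop :=
  forall x r, finite_set (fun g => d x (act g x) <= r).

Definition has_card {T : Type} (P : T -> Prop) (k : nat) : Prop :=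
  exists l : list T, List.NoDup l /\ (forall t, List.In t l <-> P t) /\ length l = k.

Definition card {T : Type} (P : T -> Prop) : nat :=
  epsilon (inhabits 0%nat) (fun k => has_card P k).

Definition critical_exponent : Rbar :=
  LimSup_seq (fun n => ln (INR (card (fun g => d o (act g o) <= INR n))) / INR n).

Definition act_bd (g : G) (xi : bpoint) : (nat -> X) -> Prop :=
  fun y => conv_infty y /\
    exists x, proj1_sig xi x /\ seq_equiv y (fun n => act g (x n)).

Definition limit_set (xi : bpoint) : Prop :=
  exists gs : nat -> G, conv_to_bd (fun n => act (gs n) o) xi.

Definition non_elementary : Prop :=
  exists a b c, limit_set a /\ limit_set b /\ limit_set c /\
    a <> b /\ b <> c /\ a <> c.

Definition conical_limit_set (xi : bpoint) : Prop :=
  limit_set xi /\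
  exists (gs : nat -> G) (Rr : R) (g : R -> X),
    0 < Rr /\ conv_to_bd (fun n => act (gs n) o) xi /\ geod_ray g xi /\
    forall n, exists t, 0 <= t /\ d (act (gs n) o) (g t) <= Rr.

Definition uniformly_conical_limit_set (xi : bpoint) : Prop :=
  limit_set xi /\
  exists (gs : nat -> G) (Rr : R) (g : R -> X),
    0 < Rr /\ conv_to_bd (fun n => act (gs n) o) xi /\ geod_ray g xi /\
    (forall n, exists t, 0 <= t /\ d (act (gs n) o) (g t) <= Rr) /\
    exists B, forall n, d (act (gs n) o) (act (gs (S n)) o) <= B.

Definition myrberg_limit_set (xi : bpoint) : Prop :=
  limit_set xi /\
  forall a b, limit_set a -> limit_set b -> a <> b ->
    exists gs : nat -> G,
      conv_to_bd (fun n => act (gs n) o) a /\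
      bd_conv (fun n => act_bd (gs n) xi) b.

End Defs.

Section Hausdorff.
Variables (T : Type) (rho : T -> T -> R).

Definition diam (U : T -> Prop) : Rbar :=
  Rbar_lub (fun v => exists x y, U x /\ U y /\ v = Finite (rho x y)).

(* diam(U)^s, with the convention 0^s = 0 (s > 0) and diam(empty) = 0 *)
Definition diam_pow (s : R) (U : T -> Prop) : R :=
  match diam U with
  | Finite r => if Rlt_dec 0 r then Rpower r s else 0
  | _ => 0
  end.

Definition haus_content (s eta : R) (A : T -> Prop) : Rbar :=
  Rbar_glb (fun v => exists U : nat -> T -> Prop,
    (forall x, A x -> exists i, U i x) /\
    (forall i x y, U i x -> U i y -> rho x y <= eta) /\
    v = Lim_seq (fun N => sum_f_R0 (fun i => diam_pow s (U i)) N)).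

Definition haus_measure (s : R) (A : T -> Prop) : Rbar :=
  Rbar_lub (fun v => exists eta, 0 < eta /\ v = haus_content s eta A).

Definition hausdorff_dim (A : T -> Prop) : Rbar :=
  Rbar_glb (fun v => exists s, 0 < s /\ v = Finite s /\ haus_measure s A = Finite 0).

End Hausdorff.

(* Main.v *)
(* Upper bound: a conical point lies in shadows of orbit points g o with d(o, g o) arbitrarily large, and
   the shadow of g o has diameter about exp(-eps d(o, g o)); the Poincare series converges above omega_G.
   Myrberg points are conical.

   Lower bound: for s < omega_G some annulus of the orbit has at least e^{sl} elements of length about l.
   Multiplying each on both sides by elements from a fixed finite set, given by the extension lemma, makes
   all of them leave o in one direction and arrive from a transverse one, so that infinite products of
   them trace uniform quasi-geodesics.  Their endpoints form a Cantor set of uniformly conical points of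
   dimension at least s/eps.  Inserting every long element of G once, at sparse levels, keeps this bound
   and makes all the endpoints Myrberg points. *)

Require Import Defs.
From Stdlib Require Import Reals Lra Lia List ZArith Classical ClassicalEpsilon ClassicalChoice.
From Stdlib Require Import FunctionalExtensionality PropExtensionality ProofIrrelevance Cantor.
From Coquelicot Require Import Coquelicot.
Open Scope R_scope.

(** * Hausdorff measure and mass distribution *)

(** Boundary points are equivalence classes of sequences, and the visual metric is constrained only
    along bi-infinite geodesics. Such geodesics are constructed from properness of the space, and
    the metric becomes an estimate by Gromov products; after that the geometry is a matter of
    four-point inequalities, mostly among orbit points. Non-elementarity provides three limit points
    and nothing else, in particular no loxodromic element. What the extension lemma needs is that no
    boundary point is fixed by all of [G], and excluding such a point takes the finiteness of balls
    in [G]. For the lower bound no measure is built: a cover of small content would give cylinders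
    of a tree with total mass below 1, and such cylinders miss a branch. The letters available at
    one level must have nearly equal lengths and well separated endpoints, since otherwise one
    branch could follow another for a long time and the distance between their endpoints would not
    be controlled by the level at which they part. The critical exponent is not assumed finite,
    hence the statements in [Rbar]. *)

Lemma exp_mono (x y : R) : x <= y -> exp x <= exp y.
Proof. intros [H| ->]; [left; now apply exp_increasing|lra]. Qed.

Section HausdorffMeasure.

Context {T : Type} (rho : T -> T -> R).

Lemma Rbar_lub_spec (E : Rbar -> Prop) : Rbar_is_lub E (Rbar_lub E).
Proof. unfold Rbar_lub; exact (proj2_sig (Rbar_ex_lub E)). Qed.

Lemma Rbar_glb_spec (E : Rbar -> Prop) : Rbar_is_glb E (Rbar_glb E).
Proof. unfold Rbar_glb; exact (proj2_sig (Rbar_ex_glb E)). Qed.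

Lemma diam_pow_nonneg (s : R) (U : T -> Prop) : 0 <= diam_pow T rho s U.
Proof.
  unfold diam_pow; destruct (diam T rho U) as [r| |]; try lra.
  destruct (Rlt_dec 0 r); [left; apply exp_pos | lra].
Qed.

Lemma diam_pow_le (s r : R) (U : T -> Prop) :
  0 < s -> 0 < r -> (forall x y, U x -> U y -> rho x y <= r) ->
  diam_pow T rho s U <= Rpower r s.
Proof.
  intros Hs Hr HU; unfold diam_pow.
  assert (Hle : Rbar_le (diam T rho U) r).
  { apply (proj2 (Rbar_lub_spec _)). intros v (x & y & Hx & Hy & ->). apply HU; assumption. }
  assert (Hpos : 0 < Rpower r s) by apply exp_pos.
  destruct (diam T rho U) as [q| |]; simpl in Hle; try lra.
  destruct (Rlt_dec 0 q); [|lra].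
  apply Rle_Rpower_l; lra.
Qed.

(** The diameter is an extended real, minus infinity for the empty set, and [diam_pow] is 0 whenever
    it is not positive. These cases are collected in [r = 0], where the cover sum gives no control
    and the mass distribution argument has to pay separately. *)
Lemma diam_pow_exact (s eta : R) (U : T -> Prop) :
  0 <= eta -> (forall x y, 0 <= rho x y) ->
  (forall x y, U x -> U y -> rho x y <= eta) ->
  exists r, 0 <= r <= eta /\ (forall x y, U x -> U y -> rho x y <= r) /\
    (r = 0 \/ diam_pow T rho s U = Rpower r s).
Proof.
  intros Heta Hpos HU.
  assert (Hle : Rbar_le (diam T rho U) eta).
  { apply (proj2 (Rbar_lub_spec _)). intros v (x & y & Hx & Hy & ->). apply HU; assumption. }
  assert (Hub : forall x y, U x -> U y -> Rbar_le (rho x y) (diam T rho U)).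
  { intros x y Hx Hy. apply (proj1 (Rbar_lub_spec _)). now exists x, y. }
  unfold diam_pow.
  destruct (diam T rho U) as [q| |]; simpl in Hle; try easy.
  - destruct (Rlt_dec 0 q).
    + exists q; split; [lra|split; [exact Hub|now right]].
    + exists 0; split; [lra|split; [|now left]].
      intros x y Hx Hy. specialize (Hub x y Hx Hy); simpl in Hub; lra.
  - exists 0; repeat split; try lra; try now left.
    intros x y Hx Hy. now specialize (Hub x y Hx Hy).
Qed.

(** Since the terms are nonnegative, a bound on all partial sums can replace the limit in
    [haus_content]; in this form the value 0 is a statement about covers alone. *)
Lemma haus_measure_zero_intro (s : R) (A : T -> Prop) :
  (forall eta eps, 0 < eta -> 0 < eps -> exists U : nat -> T -> Prop,
    (forall x, A x -> exists i, U i x) /\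
    (forall i x y, U i x -> U i y -> rho x y <= eta) /\
    (forall N, sum_f_R0 (fun i => diam_pow T rho s (U i)) N <= eps)) ->
  haus_measure T rho s A = Finite 0.
Proof.
  intros H.
  assert (Hc : forall eta, 0 < eta -> haus_content T rho s eta A = Finite 0).
  { intros eta Heta. apply Rbar_is_glb_unique; split.
    - intros v (U & _ & _ & ->).
      rewrite <- (Lim_seq_const 0). apply Lim_seq_le_loc.
      exists 0%nat; intros n _. apply cond_pos_sum; intros; apply diam_pow_nonneg.
    - intros b Hb.
      assert (Hle : forall eps, 0 < eps -> Rbar_le b eps).
      { intros eps He. destruct (H eta eps Heta He) as (U & H1 & H2 & H3).
        eapply Rbar_le_trans; [apply Hb; exists U; split; [exact H1|split; [exact H2|reflexivity]]|].
        rewrite <- (Lim_seq_const eps). apply Lim_seq_le_loc.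
        exists 0%nat; intros n _; apply H3. }
      destruct b as [b| |]; simpl in *; try easy.
      + apply Rnot_lt_le; intros Hlt. specialize (Hle (b/2) ltac:(lra)). lra.
      + now specialize (Hle 1 ltac:(lra)). }
  apply Rbar_is_lub_unique; split.
  - intros v (eta & He & ->). rewrite Hc; [simpl; lra|exact He].
  - intros b Hb. apply Hb. exists 1; split; [lra|]. now rewrite Hc; [|lra].
Qed.

Lemma haus_measure_zero_elim (s : R) (A : T -> Prop) :
  haus_measure T rho s A = Finite 0 ->
  forall eta eps, 0 < eta -> 0 < eps -> exists U : nat -> T -> Prop,
    (forall x, A x -> exists i, U i x) /\
    (forall i x y, U i x -> U i y -> rho x y <= eta) /\
    (forall N, sum_f_R0 (fun i => diam_pow T rho s (U i)) N <= eps).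
Proof.
  intros H eta eps Heta Heps. apply NNPP; intros Hno.
  assert (Hc : Rbar_le (haus_content T rho s eta A) 0).
  { rewrite <- H. apply (proj1 (Rbar_lub_spec _)). now exists eta. }
  assert (Hge : Rbar_le eps (haus_content T rho s eta A)).
  { apply (proj2 (Rbar_glb_spec _)). intros v (U & H1 & H2 & ->).
    apply Rbar_not_lt_le; intros Hlt. apply Hno. exists U; split; [exact H1|split; [exact H2|]].
    intros N. apply Rnot_lt_le; intros HN.
    apply (Rbar_lt_not_le _ _ Hlt). rewrite <- (Lim_seq_const eps). apply Lim_seq_le_loc.
    exists N; intros n Hn. left. eapply Rlt_le_trans; [exact HN|].
    destruct (Nat.eq_dec n N) as [->|]; [lra|].
    rewrite (tech2 _ N n) by lia.
    rewrite <- (Rplus_0_r (sum_f_R0 _ N)) at 1. apply Rplus_le_compat_l.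
    apply cond_pos_sum; intros; apply diam_pow_nonneg. }
  pose proof (Rbar_le_trans _ _ _ Hge Hc) as Hbad. simpl in Hbad; lra.
Qed.

Lemma hausdorff_dim_le (v : R) (A : T -> Prop) :
  0 <= v -> (forall s, v < s -> haus_measure T rho s A = Finite 0) ->
  Rbar_le (hausdorff_dim T rho A) v.
Proof.
  intros Hv H.
  assert (Hs : forall s, v < s -> Rbar_le (hausdorff_dim T rho A) s).
  { intros s Hs. apply (proj1 (Rbar_glb_spec _)). exists s; repeat split; [lra|now apply H]. }
  destruct (hausdorff_dim T rho A) as [h| |]; simpl in *; try easy.
  - apply Rnot_lt_le; intros Hlt. specialize (Hs ((v + h)/2) ltac:(lra)). lra.
  - now specialize (Hs (v + 1) ltac:(lra)).
Qed.

Lemma hausdorff_dim_ge (v : Rbar) (A : T -> Prop) :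
  (forall s, 0 < s -> Rbar_lt s v -> haus_measure T rho s A <> Finite 0) ->
  Rbar_le v (hausdorff_dim T rho A).
Proof.
  intros H. apply (proj2 (Rbar_glb_spec _)). intros w (s & Hs & -> & H0).
  apply Rbar_not_lt_le; intros Hlt. now apply (H s Hs Hlt).
Qed.

End HausdorffMeasure.

(** * Mass distribution on a finitely branching tree *)

Section MassDistribution.

Definition agree {E : Type} (c c' : nat -> E) (n : nat) : Prop :=
  forall k, (k < n)%nat -> c k = c' k.

Definition indicator (P : Prop) (w : R) : R :=
  if excluded_middle_informative P then w else 0.

Lemma ind_le (P Q : Prop) (w : R) : 0 <= w -> (P -> Q) -> indicator P w <= indicator Q w.
Proof.
  intros Hw HPQ; unfold indicator.
  destruct (excluded_middle_informative P), (excluded_middle_informative Q); tauto || lra.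
Qed.

Context {E : Type} (A : nat -> list E).
Context (A_NoDup : forall n, NoDup (A n)) (A_nonempty : forall n, A n <> nil).

(** Weight of a cylinder of level [n] under the product of the uniform probabilities on the [A k].
    The infinite product measure is never formed. *)
Fixpoint mass (n : nat) : R :=
  match n with O => 1 | S m => mass m / INR (length (A m)) end.

Lemma INR_length_pos {B : Type} (l : list B) : l <> nil -> 0 < INR (length l).
Proof. destruct l; [easy|]. intros _. apply lt_0_INR; simpl; lia. Qed.

Lemma mass_pos (n : nat) : 0 < mass n.
Proof.
  induction n; simpl; [lra|]. apply Rdiv_lt_0_compat; [exact IHn|]. now apply INR_length_pos.
Qed.

Context (cs : nat -> nat -> E) (ns : nat -> nat).

(* The cylinders still to be avoided weigh less than the current node, so some child inherits this. *)
Definition light (c : nat -> E) (m : nat) : Prop :=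
  forall N, sum_f_R0 (fun i => indicator (agree c (cs i) m) (mass (ns i))) N < mass m.

Definition upd (c : nat -> E) (m : nat) (x : E) (k : nat) : E :=
  if Nat.eq_dec k m then x else c k.

(** A cylinder that agrees with the path up to level [m] continues through one letter only,
    [cs i m], so it is charged to at most one child; [NoDup] keeps that child from being counted
    twice. *)
Lemma light_child_sum (c : nat -> E) (m N : nat) (l : list E) : NoDup l ->
  fold_right (fun x r => sum_f_R0 (fun i => indicator (agree (upd c m x) (cs i) (S m)) (mass (ns i))) N + r) 0 l
  <= sum_f_R0 (fun i => indicator (agree c (cs i) m /\ In (cs i m) l) (mass (ns i))) N.
Proof.
  induction l as [|x l IH]; intros Hl; simpl.
  - apply cond_pos_sum; intros i. unfold indicator.
    destruct (excluded_middle_informative _); [left; apply mass_pos|lra].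
  - inversion Hl as [|? ? Hx Hl']; subst. specialize (IH Hl').
    eapply Rle_trans; [apply Rplus_le_compat_l, IH|].
    rewrite <- plus_sum. apply sum_Rle; intros i _.
    assert (Hupd : agree (upd c m x) (cs i) (S m) -> agree c (cs i) m /\ cs i m = x).
    { intros H; split.
      - intros k Hk. rewrite <- (H k) by lia. unfold upd. destruct (Nat.eq_dec k m); [lia|easy].
      - rewrite <- (H m) by lia. unfold upd. now destruct (Nat.eq_dec m m). }
    pose proof (mass_pos (ns i)). unfold indicator.
    destruct (excluded_middle_informative (agree (upd c m x) (cs i) (S m))) as [H1|H1];
    destruct (excluded_middle_informative (agree c (cs i) m /\ In (cs i m) l)) as [H2|H2];
    destruct (excluded_middle_informative (agree c (cs i) m /\ (x = cs i m \/ In (cs i m) l))) as [H3|H3];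
    try lra; exfalso.
    + destruct (Hupd H1) as [_ <-]; tauto.
    + destruct (Hupd H1) as [_ <-]; tauto.
    + destruct (Hupd H1) as [Ha <-]; tauto.
    + tauto.
Qed.

Lemma fold_right_ge (f : E -> R) (w : R) (l : list E) : (forall x, In x l -> w <= f x) ->
  INR (length l) * w <= fold_right (fun x r => f x + r) 0 l.
Proof.
  induction l as [|x l IH]; intros H; [simpl; lra|].
  change (length (x :: l)) with (S (length l)). rewrite S_INR. simpl fold_right.
  specialize (IH (fun y Hy => H y (or_intror Hy))). pose proof (H x (or_introl eq_refl)). lra.
Qed.

(** Averaging: were no child light, each of the finitely many children would reach [mass (S m)] at
    some partial sum, hence all at a common [N], and adding up would give
    [length (A m) * mass (S m) = mass m] for the parent. *)
Lemma light_child (c : nat -> E) (m : nat) : light c m ->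
  exists x, In x (A m) /\ light (upd c m x) (S m).
Proof.
  intros Hc. apply NNPP; intros Hno.
  set (w x N := sum_f_R0 (fun i => indicator (agree (upd c m x) (cs i) (S m)) (mass (ns i))) N).
  assert (Hmono : forall x N N', (N <= N')%nat -> w x N <= w x N').
  { intros x N N' HN; induction HN; [lra|]. unfold w in *; simpl.
    assert (0 <= indicator (agree (upd c m x) (cs (S m0)) (S m)) (mass (ns (S m0)))).
    { unfold indicator; pose proof (mass_pos (ns (S m0))); destruct (excluded_middle_informative _); lra. }
    lra. }
  assert (HN : exists N, forall x, In x (A m) -> mass (S m) <= w x N).
  { assert (Hall : forall l, incl l (A m) -> exists N, forall x, In x l -> mass (S m) <= w x N).
    { induction l as [|y l IH]; intros Hl; [exists 0%nat; intros ? []|].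
      destruct IH as [N1 H1]; [intros z Hz; apply Hl; now right|].
      assert (Hy : exists N2, mass (S m) <= w y N2).
      { apply NNPP; intros Hy. apply Hno. exists y; split; [apply Hl; now left|].
        intros N. apply Rnot_le_lt; intros HN. apply Hy. now exists N. }
      destruct Hy as [N2 H2]. exists (Nat.max N1 N2). intros z [<-|Hz].
      - eapply Rle_trans; [exact H2|]. apply Hmono; lia.
      - eapply Rle_trans; [exact (H1 z Hz)|]. apply Hmono; lia. }
    apply Hall, incl_refl. }
  destruct HN as [N HN]. specialize (Hc N).
  pose proof (light_child_sum c m N (A m) (A_NoDup m)) as H1.
  pose proof (fold_right_ge (fun x => w x N) _ _ HN) as H2. simpl mass in H2.
  pose proof (INR_length_pos _ (A_nonempty m)).
  replace (INR (length (A m)) * (mass m / INR (length (A m)))) with (mass m) in H2 by (field; lra).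
  assert (H3 : sum_f_R0 (fun i => indicator (agree c (cs i) m /\ In (cs i m) (A m)) (mass (ns i))) N
    <= sum_f_R0 (fun i => indicator (agree c (cs i) m) (mass (ns i))) N).
  { apply sum_Rle; intros i _. apply ind_le; [left; apply mass_pos|tauto]. }
  unfold w in H2. lra.
Qed.

(** Descend through light children from the root, which is light because the cylinders weigh less
    than 1. A path inside cylinder [i] would have the term [mass (ns i)] in its sum at level [ns i],
    which is then not below [mass (ns i)]. *)
Lemma exists_branch_avoiding :
  (forall N, sum_f_R0 (fun i => mass (ns i)) N < 1) ->
  exists c, (forall n, In (c n) (A n)) /\ forall i, ~ agree c (cs i) (ns i).
Proof.
  intros Hsum.
  set (x0 := cs 0%nat 0%nat).
  set (step c m := upd c m (epsilon (inhabits x0) (fun x => In x (A m) /\ light (upd c m x) (S m)))).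
  (* The first [m] letters of [F m] are final; the rest is the filler [x0]. *)
  set (F := fix F m := match m with O => fun _ => x0 | S p => step (F p) p end).
  assert (HF : forall m, light (F m) m).
  { induction m.
    - intros N. simpl mass. eapply Rle_lt_trans; [|apply (Hsum N)].
      apply sum_Rle; intros i _. unfold indicator. pose proof (mass_pos (ns i)).
      destruct (excluded_middle_informative _); lra.
    - simpl. unfold step. apply (epsilon_spec (inhabits x0) _ (light_child _ _ IHm)). }
  assert (Hin : forall m, In (F (S m) m) (A m)).
  { intros m. simpl. unfold step at 1, upd at 1. destruct (Nat.eq_dec m m); [|easy].
    apply (epsilon_spec (inhabits x0) _ (light_child _ _ (HF m))). }
  assert (Hst : forall k m, (k < m)%nat -> F m k = F (S k) k).
  { intros k m Hk; induction Hk; [easy|]. rewrite <- IHHk. simpl. unfold step at 1, upd at 1.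
    destruct (Nat.eq_dec k m); [lia|easy]. }
  exists (fun k => F (S k) k). split; [exact Hin|].
  intros i Hag. specialize (HF (ns i) i).
  assert (Ht : indicator (agree (F (ns i)) (cs i) (ns i)) (mass (ns i)) = mass (ns i)).
  { unfold indicator. destruct (excluded_middle_informative _) as [|n]; [easy|]. exfalso; apply n.
    intros k Hk. rewrite Hst by exact Hk. now apply Hag. }
  assert (Hge : forall N (f : nat -> R), (forall j, 0 <= f j) -> f N <= sum_f_R0 f N).
  { intros N f Hf. destruct N; simpl; [lra|]. pose proof (cond_pos_sum f N Hf). lra. }
  specialize (Hge i (fun j => indicator (agree (F (ns i)) (cs j) (ns i)) (mass (ns j)))).
  simpl in Hge. rewrite Ht in Hge.
  assert (mass (ns i) <= sum_f_R0 (fun j => indicator (agree (F (ns i)) (cs j) (ns i)) (mass (ns j))) i).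
  { apply Hge. intros j; unfold indicator; pose proof (mass_pos (ns j)).
    destruct (excluded_middle_informative _); lra. }
  lra.
Qed.

End MassDistribution.

Lemma first_crossing (r : nat -> R) (x : R) (N : nat) :
  x < r 0%nat -> r N <= x -> exists n, x < r n /\ r (S n) <= x.
Proof.
  intros H0. induction N as [|N IH]; intros HN; [lra|].
  destruct (Rlt_le_dec x (r N)) as [H|H]; [now exists N|now apply IH].
Qed.

Lemma sum_half_pow_le (N : nat) : sum_f_R0 (fun i => / 4 * (/ 2) ^ i) N <= / 2.
Proof.
  assert (Heq : sum_f_R0 (fun i => / 4 * (/ 2) ^ i) N = / 4 * sum_f_R0 (fun i => (/ 2) ^ i) N).
  { rewrite scal_sum. apply sum_eq; intros; ring. }
  rewrite Heq, (tech3 (/ 2) N) by lra.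
  assert (0 < (/ 2) ^ S N) by (apply pow_lt; lra). lra.
Qed.

(** Let [q] be the diameter of a covering set. At a level [n] with [q < r n], separation confines
    all branches with endpoint in the set to one cylinder of level [n]; if moreover [r (S n) <= q],
    its mass is at most [M * q ^ t], which is why the mass at [n] is compared with the radius at
    [S n]. A cover of small content thus yields cylinders of total mass below 1, and a branch
    avoiding them has an uncovered endpoint. *)
Lemma mass_distribution {T E : Type} (rho : T -> T -> R) (A : nat -> list E)
  (Phi : (nat -> E) -> T) (S0 : T -> Prop) (r : nat -> R) (t M : R) :
  (forall n, NoDup (A n)) -> (forall n, A n <> nil) -> 0 < t -> 0 < M ->
  (forall x y, 0 <= rho x y) -> (forall n, 0 < r n) ->
  (forall eta, 0 < eta -> exists N, forall n, (N <= n)%nat -> r n < eta) ->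
  (forall c c', (forall n, In (c n) (A n)) -> (forall n, In (c' n) (A n)) ->
    forall n, rho (Phi c) (Phi c') < r n -> agree c c' n) ->
  (forall n, mass A n <= M * Rpower (r (S n)) t) ->
  (forall c, (forall n, In (c n) (A n)) -> S0 (Phi c)) ->
  haus_measure T rho t S0 <> Finite 0.
Proof.
  intros HND Hne Ht HM Hpos Hr Hr0 Hsep Hmass HS H0.
  pose proof (Hr 0%nat) as Hr00.
  (* Diameters at most [r 0 / 2] stay below [r 0], so a crossing exists. Content at most [1 / (4 M)]
     costs mass [1 / 4], and the errors [1 / 4] times [(1 / 2) ^ i] sum to at most [1 / 2]. *)
  destruct (haus_measure_zero_elim rho t S0 H0 (r 0%nat / 2) (/ (4 * M)) ltac:(lra)
    ltac:(apply Rinv_0_lt_compat; lra)) as (U & Hcov & HU & Hsum).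
  set (branch := fun c : nat -> E => forall n, In (c n) (A n)).
  assert (Hsmall : forall dl, 0 < dl -> exists n, mass A n <= dl).
  { intros dl Hdl. destruct (Hr0 (Rpower (dl / M) (/ t)) (exp_pos _)) as [N HN].
    exists N. eapply Rle_trans; [apply Hmass|].
    assert (Hq : Rpower (r (S N)) t <= Rpower (Rpower (dl / M) (/ t)) t).
    { apply Rle_Rpower_l; [lra|]. split; [apply Hr|]. left; apply HN; lia. }
    rewrite Rpower_mult, Rinv_l, Rpower_1 in Hq; [|apply Rdiv_lt_0_compat; lra|lra].
    replace dl with (M * (dl / M)) by (field; lra). apply Rmult_le_compat_l; lra. }
  assert (Hx0 : exists x0 : nat -> E, True).
  { assert (Hx : forall n, exists x, In x (A n)).
    { intros n. specialize (Hne n). destruct (A n) as [|x l]; [easy|]. exists x; now left. }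
    exists (fun n => proj1_sig (constructive_indefinite_description _ (Hx n))). easy. }
  destruct Hx0 as [x0 _].
  assert (Hpick : forall i, exists cn : (nat -> E) * nat,
    mass A (snd cn) <= M * diam_pow T rho t (U i) + / 4 * (/ 2) ^ i /\
    forall c', branch c' -> U i (Phi c') -> agree c' (fst cn) (snd cn)).
  { intros i.
    assert (Hd : 0 < / 4 * (/ 2) ^ i) by (apply Rmult_lt_0_compat; [lra|apply pow_lt; lra]).
    pose proof (diam_pow_nonneg rho t (U i)) as Hdp.
    assert (Hdp' : 0 <= M * diam_pow T rho t (U i)) by (apply Rmult_le_pos; lra).
    destruct (diam_pow_exact rho t (r 0%nat / 2) (U i) ltac:(lra) Hpos (HU i)) as (q & Hq & Hqu & Hcase).
    assert (Hn : exists n, q < r n /\ mass A n <= M * diam_pow T rho t (U i) + / 4 * (/ 2) ^ i).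
    (* A set of diameter 0 contributes nothing to the content; its cylinder is taken so deep that
       the error term alone pays for it. *)
    { destruct (Req_dec q 0) as [Hq0|Hq0].
      - destruct (Hsmall _ Hd) as [n Hn]. exists n; split; [rewrite Hq0; apply Hr|lra].
      - destruct Hcase as [|Hcase]; [easy|].
        destruct (Hr0 q ltac:(lra)) as [N HN].
        destruct (first_crossing r q N ltac:(lra)) as (n & Hn1 & Hn2).
        { left; apply HN; lia. }
        exists n; split; [exact Hn1|]. rewrite Hcase.
        assert (Rpower (r (S n)) t <= Rpower q t).
        { apply Rle_Rpower_l; [lra|]. split; [apply Hr|exact Hn2]. }
        specialize (Hmass n). pose proof (Rmult_le_compat_l M _ _ ltac:(lra) H). lra. }
    destruct Hn as (n & Hn & Hmn).
    destruct (classic (exists c, branch c /\ U i (Phi c))) as [(c & Hc & HUc)|Hno].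
    - exists (c, n); split; [exact Hmn|]. intros c' Hc' HUc'. simpl.
      apply Hsep; try assumption. eapply Rle_lt_trans; [now apply Hqu|exact Hn].
    - exists (x0, n); split; [exact Hmn|]. intros c' Hc' HUc'. exfalso; apply Hno. now exists c'. }
  set (pick i := proj1_sig (constructive_indefinite_description _ (Hpick i))).
  assert (Hp : forall i, mass A (snd (pick i)) <= M * diam_pow T rho t (U i) + / 4 * (/ 2) ^ i /\
    forall c', branch c' -> U i (Phi c') -> agree c' (fst (pick i)) (snd (pick i))).
  { intros i. exact (proj2_sig (constructive_indefinite_description _ (Hpick i))). }
  destruct (exists_branch_avoiding A HND Hne (fun i => fst (pick i)) (fun i => snd (pick i)))
    as (c & Hc & Hav).
  { intros N.
    eapply Rle_lt_trans; [apply sum_Rle; intros i _; apply (proj1 (Hp i))|].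
    rewrite plus_sum.
    pose proof (sum_half_pow_le N).
    assert (Heq : sum_f_R0 (fun i => M * diam_pow T rho t (U i)) N
      = M * sum_f_R0 (fun i => diam_pow T rho t (U i)) N).
    { rewrite scal_sum. apply sum_eq; intros; ring. }
    rewrite Heq. pose proof (Rmult_le_compat_l M _ _ ltac:(lra) (Hsum N)) as Hm.
    replace (M * / (4 * M)) with (/ 4) in Hm by (field; lra). lra. }
  destruct (Hcov (Phi c) (HS c Hc)) as [i Hi].
  exact (Hav i (proj2 (Hp i) c Hc Hi)).
Qed.

(** * Gromov products and sequences at infinity *)

Class metric {X : Type} (d : X -> X -> R) : Prop := metric_axioms : is_metric d.

Class hyperbolic {X : Type} (d : X -> X -> R) (delta : R) : Prop := {
  hyperbolic_nonneg : 0 <= delta;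
  hyperbolic_four_point : delta_hyperbolic d delta }.

Section GromovProduct.

Context {X : Type} {d : X -> X -> R} {delta : R} {Hd : metric d} {Hh : hyperbolic d delta}.

Local Notation gp := (gromov_product d).

Lemma d_pos (x y : X) : 0 <= d x y.
Proof. apply Hd. Qed.

Lemma d_sym (x y : X) : d x y = d y x.
Proof. apply Hd. Qed.

Lemma d_refl (x : X) : d x x = 0.
Proof. now apply Hd. Qed.

Lemma d_tri (x y z : X) : d x z <= d x y + d y z.
Proof. apply Hd. Qed.

Lemma delta_nonneg : 0 <= delta.
Proof. apply hyperbolic_nonneg. Qed.

Lemma gp_sym (w x y : X) : gp w x y = gp w y x.
Proof. unfold gromov_product. rewrite (d_sym x y). lra. Qed.

Lemma gp_nonneg (w x y : X) : 0 <= gp w x y.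
Proof. unfold gromov_product. pose proof (d_tri x w y). rewrite (d_sym x w) in *. lra. Qed.

Lemma gp_le_l (w x y : X) : gp w x y <= d w x.
Proof. unfold gromov_product. pose proof (d_tri w x y). lra. Qed.

Lemma gp_le_r (w x y : X) : gp w x y <= d w y.
Proof. rewrite gp_sym. apply gp_le_l. Qed.

Lemma gp_self (w x : X) : gp w x x = d w x.
Proof. unfold gromov_product. rewrite d_refl. lra. Qed.

Lemma gp_complement (w x y : X) : gp w x y + gp x w y = d w x.
Proof. unfold gromov_product. rewrite (d_sym x w). lra. Qed.

Lemma gp_base (w v x y : X) : gp w x y <= gp v x y + d w v.
Proof. unfold gromov_product. pose proof (d_tri w v x). pose proof (d_tri w v y). lra. Qed.

Lemma gp_move (w x y z : X) : gp w x y <= gp w x z + d y z.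
Proof. unfold gromov_product. pose proof (d_tri x y z). pose proof (d_tri w z y).
  rewrite (d_sym z y) in *. lra. Qed.

Lemma gp_hyp (w x y z : X) (k : R) : k <= gp w x y -> k <= gp w y z -> k - delta <= gp w x z.
Proof.
  intros H1 H2. pose proof (hyperbolic_four_point w x y z).
  assert (k <= Rmin (gp w x y) (gp w y z)) by now apply Rmin_glb. lra.
Qed.

(** If the products of [x, y] and of [y, z] both exceeded [l + delta], that of [x, z] would exceed
    [l]. In use, [y] lies in the direction of [x] as seen from [w] and inherits its transversality
    to [z], at the cost of one [delta]. *)
Lemma gp_hyp_lt (w x y z : X) (k l : R) :
  gp w x z <= l -> k <= gp w x y -> l + delta < k -> gp w y z <= l + delta.
Proof.
  intros H1 H2 H3. apply Rnot_lt_le; intros H.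
  pose proof (gp_hyp w x y z (Rmin k (gp w y z))) as H4.
  pose proof (Rmin_l k (gp w y z)). pose proof (Rmin_r k (gp w y z)).
  assert (l + delta < Rmin k (gp w y z)) by now apply Rmin_glb_lt. lra.
Qed.

(** [p] is the point of the side from [x] to [y] where the triangle with apex [o] branches. The
    products at [o] of [x, p] and of [p, y] both equal half of [d o p + gp o x y], and the
    four-point inequality bounds this by [gp o x y + delta]. *)
Lemma geodesic_point_near (o x y p : X) :
  d x p = gp x o y -> d p y = gp y o x -> d o p <= gp o x y + 2 * delta.
Proof.
  intros H1 H2. pose proof (gp_hyp o x p y ((d o p + gp o x y) / 2)) as H.
  unfold gromov_product in *. rewrite (d_sym y x), (d_sym x o), (d_sym y o) in *.
  lra.
Qed.

Context {o : X}.
Local Notation seqv := (seq_equiv X d o).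
Local Notation conv := (conv_infty X d o).

Lemma seq_equiv_sym (x y : nat -> X) : seqv x y -> seqv y x.
Proof.
  intros H K. destruct (H K) as [M HM]. exists M; intros i j Hi Hj. rewrite gp_sym. now apply HM.
Qed.

Lemma seq_equiv_trans (x y z : nat -> X) : seqv x y -> seqv y z -> seqv x z.
Proof.
  intros H1 H2 K. destruct (H1 (K + delta)) as [M1 HM1], (H2 (K + delta)) as [M2 HM2].
  exists (Nat.max M1 M2); intros i j Hi Hj.
  pose proof (gp_hyp o (x i) (y (Nat.max M1 M2)) (z j) (K + delta)).
  specialize (HM1 i (Nat.max M1 M2) ltac:(lia) ltac:(lia)).
  specialize (HM2 (Nat.max M1 M2) j ltac:(lia) ltac:(lia)). lra.
Qed.

Lemma seq_equiv_conv_l (x y : nat -> X) : seqv x y -> conv x.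
Proof. intros H. apply (seq_equiv_trans x y x); [exact H|now apply seq_equiv_sym]. Qed.

Lemma seq_equiv_conv_r (x y : nat -> X) : seqv x y -> conv y.
Proof. intros H. now apply (seq_equiv_conv_l y x), seq_equiv_sym. Qed.

Lemma conv_far (x : nat -> X) : conv x -> forall K, exists M, forall i, (M <= i)%nat -> K <= d o (x i).
Proof.
  intros H K. destruct (H K) as [M HM]. exists M; intros i Hi.
  rewrite <- gp_self. now apply HM.
Qed.

Lemma seq_equiv_of_diag (x y : nat -> X) :
  conv x -> (forall K, exists M, forall i, (M <= i)%nat -> K <= gp o (x i) (y i)) -> seqv x y.
Proof.
  intros Hx H.
  assert (Hxy : forall K, exists M, forall i j, (M <= i)%nat -> (M <= j)%nat -> K <= gp o (x i) (y j)).
  { intros K. destruct (Hx (K + delta)) as [M1 H1], (H (K + delta)) as [M2 H2].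
    exists (Nat.max M1 M2); intros i j Hi Hj.
    specialize (H1 i j ltac:(lia) ltac:(lia)). specialize (H2 j ltac:(lia)).
    pose proof (gp_hyp o (x i) (x j) (y j) (K + delta) H1 H2). lra. }
  exact Hxy.
Qed.

(** Non-equivalence gives small products only along some late indices. As both sequences converge,
    one small product spreads to every late pair at a cost of [2 delta]. *)
Lemma not_equiv_bounded (x y : nat -> X) : conv x -> conv y -> ~ seqv x y ->
  exists K M, forall i j, (M <= i)%nat -> (M <= j)%nat -> gp o (x i) (y j) <= K.
Proof.
  intros Hx Hy Hn. pose proof delta_nonneg as Hdl.
  assert (H : exists K, forall M, exists i j, (M <= i)%nat /\ (M <= j)%nat /\ gp o (x i) (y j) < K).
  { apply NNPP; intros H. apply Hn. intros K. apply NNPP; intros HK. apply H. exists K. intros M.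
    apply NNPP; intros HM. apply HK. exists M. intros i j Hi Hj. apply Rnot_lt_le; intros Hlt.
    apply HM. now exists i, j. }
  destruct H as [K HK].
  destruct (Hx (K + 3 * delta + 1)) as [M1 H1], (Hy (K + 3 * delta + 1)) as [M2 H2].
  exists (K + 2 * delta), (Nat.max M1 M2). intros i j Hi Hj. apply Rnot_lt_le; intros Hlt.
  destruct (HK (Nat.max M1 M2)) as (i' & j' & Hi' & Hj' & Hij').
  specialize (H1 i' i ltac:(lia) ltac:(lia)). specialize (H2 j j' ltac:(lia) ltac:(lia)).
  set (k := Rmin (gp o (x i) (y j)) (K + 3 * delta + 1)).
  assert (Hk1 : k <= gp o (x i) (y j)) by apply Rmin_l.
  assert (Hk2 : k <= K + 3 * delta + 1) by apply Rmin_r.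
  assert (Hk : K + 2 * delta < k) by (apply Rmin_glb_lt; lra).
  pose proof (gp_hyp o (x i') (x i) (y j) k ltac:(lra) ltac:(lra)) as Ha.
  pose proof (gp_hyp o (x i') (y j) (y j') (k - delta) Ha ltac:(lra)). lra.
Qed.

Lemma bounded_not_equiv (x y : nat -> X) (K : R) (M : nat) :
  (forall i j, (M <= i)%nat -> (M <= j)%nat -> gp o (x i) (y j) <= K) -> ~ seqv x y.
Proof.
  intros H He. destruct (He (K + 1)) as [M' HM'].
  specialize (H (Nat.max M M') (Nat.max M M') ltac:(lia) ltac:(lia)).
  specialize (HM' (Nat.max M M') (Nat.max M M') ltac:(lia) ltac:(lia)). lra.
Qed.

Lemma subseq_ge (phi : nat -> nat) : (forall n, (phi n < phi (S n))%nat) -> forall n, (n <= phi n)%nat.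
Proof. intros H n; induction n; [lia|]. specialize (H n). lia. Qed.

Lemma subseq_mono (phi : nat -> nat) : (forall n, (phi n < phi (S n))%nat) ->
  forall m n, (m < n)%nat -> (phi m < phi n)%nat.
Proof. intros H m n Hmn; induction Hmn; [apply H|]. specialize (H m0). lia. Qed.

Lemma conv_subseq (x : nat -> X) (phi : nat -> nat) :
  conv x -> (forall n, (n <= phi n)%nat) -> seqv x (fun n => x (phi n)).
Proof.
  intros Hx Hphi K. destruct (Hx K) as [M HM]. exists M; intros i j Hi Hj.
  apply HM; [exact Hi|]. specialize (Hphi j). lia.
Qed.

Lemma seq_equiv_isometry (x y : nat -> X) (f : X -> X) :
  (forall p q, d (f p) (f q) = d p q) -> seqv x y -> seqv (fun n => f (x n)) (fun n => f (y n)).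
Proof.
  intros Hf H K. destruct (H (K + d o (f o))) as [M HM]. exists M; intros i j Hi Hj.
  specialize (HM i j Hi Hj).
  pose proof (gp_base (f o) o (f (x i)) (f (y j))) as Hb.
  assert (Heq : gp (f o) (f (x i)) (f (y j)) = gp o (x i) (y j)).
  { unfold gromov_product. now rewrite !Hf. }
  rewrite (d_sym (f o) o) in Hb. lra.
Qed.

End GromovProduct.

(** * Limits of geodesics *)

Section GeodesicLimits.

Context {X : Type} {d : X -> X -> R} {delta : R} {Hd : metric d} {Hh : hyperbolic d delta}.
Context (Hproper : proper_space d) (Hgeod : geodesic_space d).

Local Notation gp := (gromov_product d).

Lemma seq_conv_subseq (u : nat -> X) (l : X) (phi : nat -> nat) :
  (forall n, (n <= phi n)%nat) -> seq_conv d u l -> seq_conv d (fun n => u (phi n)) l.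
Proof.
  intros Hphi Hu e He. destruct (Hu e He) as [N HN]. exists N; intros n Hn.
  apply HN. specialize (Hphi n); lia.
Qed.

Lemma seq_conv_dist (u v : nat -> X) (l m : X) (c : R) :
  seq_conv d u l -> seq_conv d v m ->
  (exists N, forall n, (N <= n)%nat -> d (u n) (v n) = c) -> d l m = c.
Proof.
  intros Hu Hv [N HN]. apply Rle_antisym; apply Rnot_lt_le; intros Hlt.
  - destruct (Hu ((d l m - c) / 2) ltac:(lra)) as [N1 H1], (Hv ((d l m - c) / 2) ltac:(lra)) as [N2 H2].
    set (n := Nat.max N (Nat.max N1 N2)).
    specialize (HN n ltac:(lia)). specialize (H1 n ltac:(lia)). specialize (H2 n ltac:(lia)).
    pose proof (d_tri l (u n) m). pose proof (d_tri (u n) (v n) m). rewrite (d_sym l (u n)) in *. lra.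
  - destruct (Hu ((c - d l m) / 2) ltac:(lra)) as [N1 H1], (Hv ((c - d l m) / 2) ltac:(lra)) as [N2 H2].
    set (n := Nat.max N (Nat.max N1 N2)).
    specialize (HN n ltac:(lia)). specialize (H1 n ltac:(lia)). specialize (H2 n ltac:(lia)).
    pose proof (d_tri (u n) l (v n)). pose proof (d_tri l m (v n)). rewrite (d_sym m (v n)) in *. lra.
Qed.

Lemma diagonal_extraction (o : X) (u : nat -> nat -> X) :
  (forall k, exists r, forall n, d o (u k n) <= r) ->
  exists (phi : nat -> nat) (l : nat -> X), (forall n, (phi n < phi (S n))%nat) /\
    forall k, seq_conv d (fun n => u k (phi n)) (l k).
Proof.
  intros Hb.
  set (good := fun (Phi : nat -> nat) k (psi : nat -> nat) => (forall n, (psi n < psi (S n))%nat) /\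
    exists l, seq_conv d (fun n => u k (Phi (psi n))) l).
  assert (Hex : forall Phi k, exists psi, good Phi k psi).
  { intros Phi k. destruct (Hb k) as [r Hr].
    destruct (Hproper o r (fun n => u k (Phi n))) as (psi & l & H1 & _ & H3).
    { intros n; apply Hr. }
    exists psi; split; [exact H1|now exists l]. }
  set (ext Phi k := proj1_sig (constructive_indefinite_description _ (Hex Phi k))).
  assert (Hext : forall Phi k, good Phi k (ext Phi k)).
  { intros Phi k. exact (proj2_sig (constructive_indefinite_description _ (Hex Phi k))). }
  set (F := fix F k := match k with
    | O => ext (fun n => n) 0%nat
    | S k' => fun n => F k' (ext (F k') (S k') n) end).
  assert (Hmono : forall k n, (F k n < F k (S n))%nat).
  { induction k; intros n; simpl; [apply Hext|]. apply subseq_mono; [exact IHk|apply Hext]. }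
  assert (Hlim : forall k, exists l, seq_conv d (fun n => u k (F k n)) l).
  { intros [|k]; [exact (proj2 (Hext (fun n => n) 0%nat))|exact (proj2 (Hext (F k) (S k)))]. }
  assert (Hsub : forall k j, exists th, (forall n, (n <= th n)%nat) /\ forall n, F (j + k)%nat n = F k (th n)).
  { intros k; induction j as [|j (th & H1 & H2)]; [now exists (fun n => n)|].
    exists (fun n => th (ext (F (j + k)%nat) (S (j + k)) n)); split.
    - intros n. pose proof (H1 (ext (F (j + k)%nat) (S (j + k)) n)).
      pose proof (subseq_ge _ (proj1 (Hext (F (j + k)%nat) (S (j + k)))) n). lia.
    - intros n. simpl. apply H2. }
  exists (fun n => F n n).
  exists (fun k => proj1_sig (constructive_indefinite_description _ (Hlim k))). split.
  - intros n. simpl. apply subseq_mono; [apply Hmono|].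
    pose proof (subseq_ge _ (proj1 (Hext (F n) (S n))) (S n)). lia.
  - intros k. destruct (constructive_indefinite_description _ (Hlim k)) as [l Hl]; simpl.
    intros e He. destruct (Hl e He) as [N HN]. exists (Nat.max N k). intros n Hn.
    destruct (Hsub k (n - k)%nat) as (th & H1 & H2).
    replace (n - k + k)%nat with n in H2 by lia. rewrite H2. apply HN. specialize (H1 n). lia.
Qed.

Lemma diagonal_extraction_Z (o : X) (u : Z -> nat -> X) :
  (forall k, exists r, forall n, d o (u k n) <= r) ->
  exists (phi : nat -> nat) (l : Z -> X), (forall n, (phi n < phi (S n))%nat) /\
    forall k, seq_conv d (fun n => u k (phi n)) (l k).
Proof.
  intros Hb.
  destruct (diagonal_extraction o (fun k => u (Z.of_nat k))) as (phi & l & H1 & H2).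
  { intros k; apply Hb. }
  destruct (diagonal_extraction o (fun k n => u (- Z.of_nat k)%Z (phi n))) as (psi & m & H3 & H4).
  { intros k. destruct (Hb (- Z.of_nat k)%Z) as [r Hr]. now exists r. }
  exists (fun n => phi (psi n)).
  exists (fun k => if Z_le_gt_dec 0 k then l (Z.to_nat k) else m (Z.to_nat (- k))). split.
  - intros n. now apply subseq_mono.
  - intros k. destruct (Z_le_gt_dec 0 k) as [Hk|Hk].
    + specialize (H2 (Z.to_nat k)). rewrite Z2Nat.id in H2 by lia.
      apply (seq_conv_subseq (fun n => u k (phi n))); [now apply subseq_ge|exact H2].
    + specialize (H4 (Z.to_nat (- k))). rewrite Z2Nat.id in H4 by lia.
      now rewrite Z.opp_involutive in H4.
Qed.

(** Segments joining consecutive points are glued. Each piece bounds distances from above by the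
    parameter difference, and since the outer points [p j] and [p (k + 1)] are at full distance, no
    inequality can be strict. The predicate [lo] is all of [Z] for a line and the half-line [0 <= j]
    for a ray. *)
Lemma geodesic_interpolation (lo : Z -> Prop) (p : Z -> X) :
  (forall j, lo j -> lo (j + 1)%Z) -> (forall j k, (j <= k)%Z -> lo j -> lo k -> d (p j) (p k) = IZR (k - j)) ->
  exists g : R -> X, (forall k, lo k -> g (IZR k) = p k) /\
    forall s t, lo (Int_part s) -> lo (Int_part t) -> d (g s) (g t) = Rabs (s - t).
Proof.
  intros Hlo Hp.
  destruct (choice (fun k (g : R -> X) => lo k -> g 0 = p k /\ g 1 = p (k + 1)%Z /\
     forall s t, 0 <= s <= 1 -> 0 <= t <= 1 -> d (g s) (g t) = Rabs (s - t))) as [seg Hseg].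
  { intros k. destruct (Hgeod (p k) (p (k + 1)%Z)) as (g & H0 & H1 & H2). exists g. intros Hk.
    assert (Hk1 : d (p k) (p (k + 1)%Z) = 1).
    { rewrite Hp; [|lia|exact Hk|now apply Hlo]. f_equal; lia. }
    rewrite Hk1 in *. auto. }
  set (g := fun t => seg (Int_part t) (frac_part t)).
  assert (Hfr : forall t, 0 <= frac_part t <= 1) by (intros t; pose proof (base_fp t); lra).
  assert (Hg : forall s t, s <= t -> lo (Int_part s) -> lo (Int_part t) -> d (g s) (g t) = t - s).
  { intros s t Hst Hs Ht. unfold g.
    destruct (Hseg _ Hs) as (A0 & A1 & A2), (Hseg _ Ht) as (B0 & B1 & B2).
    pose proof (Hfr s) as Fs. pose proof (Hfr t) as Ft.
    assert (Es : s = IZR (Int_part s) + frac_part s) by (unfold frac_part; lra).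
    assert (Et : t = IZR (Int_part t) + frac_part t) by (unfold frac_part; lra).
    assert (Hjk : (Int_part s <= Int_part t)%Z).
    { apply Z.lt_succ_r, lt_IZR. unfold Z.succ. rewrite plus_IZR.
      pose proof (base_fp s). pose proof (base_fp t). lra. }
    destruct (Z.eq_dec (Int_part s) (Int_part t)) as [He|He].
    - rewrite <- He in *. rewrite A2 by assumption. rewrite Rabs_left1; lra.
    - set (j := Int_part s) in *. set (k := Int_part t) in *.
      set (a := frac_part s) in *. set (b := frac_part t) in *.
      assert (D1 : d (p (j + 1)%Z) (p k) = IZR k - IZR j - 1).
      { rewrite Hp; [|lia|now apply Hlo|exact Ht]. rewrite minus_IZR, plus_IZR. lra. }
      assert (D2 : d (p j) (p (k + 1)%Z) = IZR k + 1 - IZR j).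
      { rewrite Hp; [|lia|exact Hs|now apply Hlo]. rewrite minus_IZR, plus_IZR. lra. }
      pose proof (A2 a 1 Fs ltac:(lra)) as P1. rewrite A1, Rabs_left1 in P1 by lra.
      pose proof (A2 0 a ltac:(lra) Fs) as P2. rewrite A0, Rabs_left1 in P2 by lra.
      pose proof (B2 b 1 Ft ltac:(lra)) as P3. rewrite B1, Rabs_left1 in P3 by lra.
      pose proof (B2 0 b ltac:(lra) Ft) as P4. rewrite B0, Rabs_left1 in P4 by lra.
      pose proof (d_tri (seg j a) (p (j + 1)%Z) (seg k b)).
      pose proof (d_tri (p (j + 1)%Z) (p k) (seg k b)).
      pose proof (d_tri (p j) (seg j a) (p (k + 1)%Z)).
      pose proof (d_tri (seg j a) (seg k b) (p (k + 1)%Z)). lra. }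
  exists g; split.
  - intros k Hk. unfold g.
    assert (Hi : Int_part (IZR k) = k).
    { symmetry. apply Int_part_spec. lra. }
    unfold frac_part. rewrite Hi, Rminus_diag. now apply Hseg.
  - intros s t Hs Ht. destruct (Rle_dec s t) as [Hst|Hst].
    + rewrite Hg, Rabs_left1 by (assumption || lra). lra.
    + rewrite d_sym, Hg, Rabs_pos_eq by (assumption || lra). lra.
Qed.

Context {o : X}.
Local Notation seqv := (seq_equiv X d o).
Local Notation conv := (conv_infty X d o).

(** One late [n] for each [k] suffices because [y] itself converges; the approximating segments
    supply it along a subsequence. *)
Lemma limit_points_equiv (y p : nat -> X) (C : R) : conv y ->
  (forall k M, exists n, (M <= n)%nat /\ INR k - C <= gp o (p k) (y n)) -> seqv y p.
Proof.
  intros Hy Hp. apply seq_equiv_sym. intros K.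
  destruct (Hy (K + delta)) as [M HM]. destruct (INR_unbounded (K + delta + C)) as [N HN].
  exists (Nat.max M N). intros i j Hi Hj.
  destruct (Hp i M) as (n & Hn & Hk). specialize (HM n j Hn ltac:(lia)).
  assert (INR N <= INR i) by (apply le_INR; lia).
  assert (Hk2 : K + delta <= gp o (p i) (y n)) by lra.
  pose proof (gp_hyp o (p i) (y n) (y j) (K + delta) Hk2 HM). lra.
Qed.

(** Keeps a parameter inside the domain [[0, D]] of a segment, where alone the geodesic is
    controlled; at a fixed integer offset it becomes the identity once the segments are long
    enough. *)
Definition clamp (D t : R) : R := Rmax 0 (Rmin D t).

Lemma clamp_bounds (D t : R) : 0 <= D -> 0 <= clamp D t <= D.
Proof.
  intros HD. unfold clamp. split; [apply Rmax_l|]. apply Rmax_lub; [exact HD|apply Rmin_l].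
Qed.

Lemma clamp_id (D t : R) : 0 <= t <= D -> clamp D t = t.
Proof. intros H. unfold clamp. rewrite Rmin_right, Rmax_right; lra. Qed.

Lemma clamp_lipschitz (D s t : R) : Rabs (clamp D s - clamp D t) <= Rabs (s - t).
Proof.
  unfold clamp, Rmax, Rmin, Rabs.
  repeat destruct (Rle_dec _ _); repeat destruct (Rcase_abs _); lra.
Qed.

(* Geodesics [x n, y n] based at points of a bounded set subconverge; [t0 n] is the parameter of the
   base point, and integer parameters suffice by [geodesic_interpolation]. *)
Lemma geodesic_limit (x y : nat -> X) (t0 : nat -> R) (gam : nat -> R -> X) (C : R) :
  (forall n, 0 <= t0 n <= d (x n) (y n)) ->
  (forall n s t, 0 <= s <= d (x n) (y n) -> 0 <= t <= d (x n) (y n) ->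
    d (gam n s) (gam n t) = Rabs (s - t)) ->
  (forall n, d o (gam n (t0 n)) <= C) ->
  exists phi (p : Z -> X), (forall n, (phi n < phi (S n))%nat) /\
    forall k, seq_conv d (fun n => gam (phi n) (clamp (d (x (phi n)) (y (phi n))) (t0 (phi n) + IZR k))) (p k).
Proof.
  intros Ht Hg HC.
  apply (diagonal_extraction_Z o (fun k n => gam n (clamp (d (x n) (y n)) (t0 n + IZR k)))).
  intros k. exists (C + Rabs (IZR k)). intros n.
  pose proof (d_tri o (gam n (t0 n)) (gam n (clamp (d (x n) (y n)) (t0 n + IZR k)))) as H1.
  rewrite Hg in H1; [|apply Ht|apply clamp_bounds, d_pos].
  pose proof (clamp_lipschitz (d (x n) (y n)) (t0 n) (t0 n + IZR k)) as H2.
  rewrite (clamp_id _ (t0 n)) in H2 by apply Ht.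
  replace (t0 n - (t0 n + IZR k)) with (- IZR k) in H2 by lra. rewrite Rabs_Ropp in H2.
  specialize (HC n). lra.
Qed.

Lemma ray_exists (x : nat -> X) : conv x -> exists g : R -> X, g 0 = o /\
  (forall s t, 0 <= s -> 0 <= t -> d (g s) (g t) = Rabs (s - t)) /\ seqv x (fun n => g (INR n)).
Proof.
  intros Hx.
  destruct (choice (fun n (g : R -> X) => g 0 = o /\ g (d o (x n)) = x n /\
     forall s t, 0 <= s <= d o (x n) -> 0 <= t <= d o (x n) -> d (g s) (g t) = Rabs (s - t)))
    as [gam Hgam].
  { intros n. apply Hgeod. }
  destruct (geodesic_limit (fun _ => o) x (fun _ => 0) gam 0) as (phi & p & Hphi & Hp).
  { intros n; pose proof (d_pos o (x n)); lra. }
  { intros n; apply Hgam. }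
  { intros n; rewrite (proj1 (Hgam n)), d_refl; lra. }
  assert (Hfar : forall K, exists N, forall n, (N <= n)%nat -> K <= d o (x (phi n))).
  { intros K. destruct (conv_far x Hx K) as [N HN]. exists N; intros n Hn. apply HN.
    pose proof (subseq_ge _ Hphi n). lia. }
  destruct (geodesic_interpolation (fun j => (0 <= j)%Z) p) as (g & Hg1 & Hg2).
  { intros j; lia. }
  { intros j k Hjk Hj Hk. eapply seq_conv_dist; [apply Hp|apply Hp|].
    destruct (Hfar (IZR k)) as [N HN]. exists N. intros n Hn. specialize (HN n Hn).
    apply IZR_le in Hjk, Hj, Hk.
    rewrite (proj2 (proj2 (Hgam _))) by (apply clamp_bounds, d_pos).
    rewrite !clamp_id by lra. rewrite minus_IZR, Rabs_left1; lra. }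
  assert (Hpos : forall s, 0 <= s -> (0 <= Int_part s)%Z).
  { intros s Hs. apply Z.lt_succ_r, lt_IZR. unfold Z.succ. rewrite plus_IZR.
    pose proof (base_Int_part s). lra. }
  exists g; split; [|split].
  - change 0 with (IZR 0). rewrite Hg1 by lia.
    assert (H0 : d o (p 0%Z) = 0).
    { eapply (seq_conv_dist (fun _ => o)); [|apply (Hp 0%Z)|].
      - intros e He. exists 0%nat; intros n _. now rewrite d_refl.
      - exists 0%nat; intros n _. rewrite clamp_id by (pose proof (d_pos o (x (phi n))); lra).
        rewrite Rplus_0_r, (proj1 (Hgam _)). apply d_refl. }
    symmetry. now apply Hd.
  - intros s t Hs Ht. apply Hg2; now apply Hpos.
  - apply (limit_points_equiv x _ 1 Hx). intros k M.
    rewrite INR_IZR_INZ, Hg1 by lia.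
    destruct (Hfar (IZR (Z.of_nat k))) as [N1 H1], (Hp (Z.of_nat k) 1 ltac:(lra)) as [N2 H2].
    set (n := Nat.max M (Nat.max N1 N2)). specialize (H1 n ltac:(lia)). specialize (H2 n ltac:(lia)).
    exists (phi n); split; [pose proof (subseq_ge _ Hphi n); lia|].
    destruct (Hgam (phi n)) as (G0 & G1 & G2).
    assert (Hk : 0 <= IZR (Z.of_nat k)) by (apply IZR_le; lia).
    rewrite clamp_id in H2 by lra. rewrite Rplus_0_l in H2.
    rewrite (gp_sym o (p _)).
    pose proof (gp_move o (x (phi n)) (gam (phi n) (IZR (Z.of_nat k))) (p (Z.of_nat k))) as Hm.
    assert (Hv : gp o (x (phi n)) (gam (phi n) (IZR (Z.of_nat k))) = IZR (Z.of_nat k)).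
    { unfold gromov_product.
      pose proof (G2 0 (IZR (Z.of_nat k)) ltac:(lra) ltac:(lra)) as D1.
      pose proof (G2 (d o (x (phi n))) (IZR (Z.of_nat k)) ltac:(lra) ltac:(lra)) as D2.
      rewrite G0, Rabs_left1 in D1 by lra. rewrite G1, Rabs_pos_eq in D2 by lra. lra. }
    lra.
Qed.

(** Bounded products make the segment from [x n] to [y n] pass within [K + 2 * delta] of [o] at its
    branch point, with parameter [t0 n]. Recentred there, the segments subconverge, and both ends
    recede because [t0 n] is [d o (x n)] minus a product that is at most [K], and likewise on the
    other side. *)
Lemma biinfinite_exists (x y : nat -> X) : conv x -> conv y -> ~ seqv x y ->
  exists g : R -> X, (forall s t, d (g s) (g t) = Rabs (s - t)) /\
    seqv x (fun n => g (- INR n)) /\ seqv y (fun n => g (INR n)).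
Proof.
  intros Hx0 Hy0 Hne.
  destruct (not_equiv_bounded x y Hx0 Hy0 Hne) as (K & M0 & HK).
  (* The shift makes the bound [K] valid for all indices. *)
  set (x' := fun n => x (n + M0)%nat). set (y' := fun n => y (n + M0)%nat).
  assert (Hxx : seqv x x') by (apply (conv_subseq x (fun n => n + M0)%nat); [exact Hx0|intros; lia]).
  assert (Hyy : seqv y y') by (apply (conv_subseq y (fun n => n + M0)%nat); [exact Hy0|intros; lia]).
  assert (Hx : conv x') by exact (seq_equiv_conv_r _ _ Hxx).
  assert (Hy : conv y') by exact (seq_equiv_conv_r _ _ Hyy).
  assert (HK' : forall n, gp o (x' n) (y' n) <= K) by (intros n; apply HK; lia).
  clearbody x' y'. clear HK.
  destruct (choice (fun n (g : R -> X) => g 0 = x' n /\ g (d (x' n) (y' n)) = y' n /\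
     forall s t, 0 <= s <= d (x' n) (y' n) -> 0 <= t <= d (x' n) (y' n) -> d (g s) (g t) = Rabs (s - t)))
    as [gam Hgam].
  { intros n. apply Hgeod. }
  set (t0 := fun n => gp (x' n) o (y' n)).
  assert (Ht0 : forall n, 0 <= t0 n <= d (x' n) (y' n)).
  { intros n; split; [apply gp_nonneg|apply gp_le_r]. }
  assert (Ht1 : forall n, d (x' n) (y' n) - t0 n = gp (y' n) o (x' n)).
  { intros n. unfold t0. pose proof (gp_complement (x' n) (y' n) o) as H.
    rewrite (gp_sym _ _ o), (gp_sym _ _ o) in H. lra. }
  assert (Hm : forall n, d o (gam n (t0 n)) <= K + 2 * delta).
  { intros n. destruct (Hgam n) as (G0 & G1 & G2). specialize (Ht0 n). specialize (Ht1 n).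
    assert (d o (gam n (t0 n)) <= gp o (x' n) (y' n) + 2 * delta).
    { apply geodesic_point_near.
      - rewrite <- G0 at 1. rewrite G2, Rabs_left1 by lra. unfold t0; lra.
      - rewrite <- G1 at 1. rewrite G2, Rabs_left1 by lra. lra. }
    specialize (HK' n). lra. }
  destruct (geodesic_limit x' y' t0 gam (K + 2 * delta) Ht0 (fun n => proj2 (proj2 (Hgam n))) Hm)
    as (phi & p & Hphi & Hp).
  assert (Hfar : forall L, exists N, forall n, (N <= n)%nat ->
    L <= t0 (phi n) /\ L <= d (x' (phi n)) (y' (phi n)) - t0 (phi n)).
  { intros L. destruct (conv_far x' Hx (L + K)) as [N1 H1], (conv_far y' Hy (L + K)) as [N2 H2].
    exists (Nat.max N1 N2). intros n Hn. pose proof (subseq_ge _ Hphi n).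
    specialize (H1 (phi n) ltac:(lia)). specialize (H2 (phi n) ltac:(lia)). specialize (HK' (phi n)).
    pose proof (gp_complement o (x' (phi n)) (y' (phi n))).
    pose proof (gp_complement o (y' (phi n)) (x' (phi n))) as H3.
    rewrite (gp_sym o (y' _)) in H3. rewrite Ht1. unfold t0. lra. }
  destruct (geodesic_interpolation (fun _ => True) p) as (g & Hg1 & Hg2).
  { easy. }
  { intros j k Hjk _ _. eapply seq_conv_dist; [apply Hp|apply Hp|].
    destruct (Hfar (Rabs (IZR j) + Rabs (IZR k))) as [N HN]. exists N. intros n Hn.
    destruct (HN n Hn) as [H1 H2]. apply IZR_le in Hjk.
    assert (Hj' : Rabs (IZR j) >= IZR j /\ Rabs (IZR j) >= - IZR j) by (unfold Rabs; destruct (Rcase_abs _); lra).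
    assert (Hk' : Rabs (IZR k) >= IZR k /\ Rabs (IZR k) >= - IZR k) by (unfold Rabs; destruct (Rcase_abs _); lra).
    pose proof (Rabs_pos (IZR j)). pose proof (Rabs_pos (IZR k)).
    rewrite (proj2 (proj2 (Hgam _))) by (apply clamp_bounds, d_pos).
    rewrite !clamp_id by lra. rewrite minus_IZR, Rabs_left1; lra. }
  pose proof (delta_nonneg) as Hdl.
  exists g; split; [|split].
  - intros s t. now apply Hg2.
  - apply (seq_equiv_trans _ _ _ Hxx). apply (limit_points_equiv x' _ (1 + (K + 2 * delta)) Hx). intros k M.
    rewrite INR_IZR_INZ, <- opp_IZR, Hg1 by easy.
    destruct (Hfar (IZR (Z.of_nat k))) as [N1 H1], (Hp (- Z.of_nat k)%Z 1 ltac:(lra)) as [N2 H2].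
    set (n := Nat.max M (Nat.max N1 N2)). specialize (H1 n ltac:(lia)). specialize (H2 n ltac:(lia)).
    exists (phi n); split; [pose proof (subseq_ge _ Hphi n); lia|].
    destruct (Hgam (phi n)) as (G0 & G1 & G2).
    assert (Hk : 0 <= IZR (Z.of_nat k)) by (apply IZR_le; lia).
    rewrite clamp_id in H2 by (rewrite opp_IZR; lra). rewrite opp_IZR in H2.
    set (q := gam (phi n) (t0 (phi n) + - IZR (Z.of_nat k))) in *.
    rewrite (gp_sym o (p _)). pose proof (gp_move o (x' (phi n)) q (p (- Z.of_nat k)%Z)) as Hmv.
    assert (Hv : gp (gam (phi n) (t0 (phi n))) (x' (phi n)) q = IZR (Z.of_nat k)).
    { unfold gromov_product, q. rewrite <- G0.
      rewrite !G2 by lra. rewrite !(Rabs_pos_eq (t0 (phi n) - _)) by lra.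
      rewrite (Rabs_left1 (0 - _)); lra. }
    pose proof (gp_base (gam (phi n) (t0 (phi n))) o (x' (phi n)) q) as Hb.
    rewrite (d_sym _ o) in Hb. specialize (Hm (phi n)). lra.
  - apply (seq_equiv_trans _ _ _ Hyy). apply (limit_points_equiv y' _ (1 + (K + 2 * delta)) Hy). intros k M.
    rewrite INR_IZR_INZ, Hg1 by easy.
    destruct (Hfar (IZR (Z.of_nat k))) as [N1 H1], (Hp (Z.of_nat k)%Z 1 ltac:(lra)) as [N2 H2].
    set (n := Nat.max M (Nat.max N1 N2)). specialize (H1 n ltac:(lia)). specialize (H2 n ltac:(lia)).
    exists (phi n); split; [pose proof (subseq_ge _ Hphi n); lia|].
    destruct (Hgam (phi n)) as (G0 & G1 & G2).
    assert (Hk : 0 <= IZR (Z.of_nat k)) by (apply IZR_le; lia).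
    rewrite clamp_id in H2 by lra.
    set (q := gam (phi n) (t0 (phi n) + IZR (Z.of_nat k))) in *.
    rewrite (gp_sym o (p _)). pose proof (gp_move o (y' (phi n)) q (p (Z.of_nat k)%Z)) as Hmv.
    assert (Hv : gp (gam (phi n) (t0 (phi n))) (y' (phi n)) q = IZR (Z.of_nat k)).
    { unfold gromov_product, q. rewrite <- G1 at 1 2.
      pose proof (Ht0 (phi n)).
      rewrite !G2 by lra. rewrite !(Rabs_left1 (t0 (phi n) - _)) by lra.
      rewrite (Rabs_pos_eq); lra. }
    pose proof (gp_base (gam (phi n) (t0 (phi n))) o (y' (phi n)) q) as Hb.
    rewrite (d_sym _ o) in Hb. specialize (Hm (phi n)). lra.
Qed.

End GeodesicLimits.

(** * Boundary points and visual metrics *)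

Section Boundary.

Context {X : Type} {d : X -> X -> R} {delta : R} {Hd : metric d} {Hh : hyperbolic d delta}.
Context {o : X}.

Local Notation gp := (gromov_product d).
Local Notation seqv := (seq_equiv X d o).
Local Notation conv := (conv_infty X d o).
Local Notation bd := (bpoint X d o).
Local Notation "x ~> xi" := (conv_to_bd X d o x xi) (at level 70).

Definition bpoint_of (x : nat -> X) (Hx : conv x) : bd :=
  exist _ (fun y => conv y /\ seqv x y)
    (ex_intro _ x (conj Hx (fun y => iff_refl (conv y /\ seqv x y)))).

Lemma bpoint_of_conv (x : nat -> X) (Hx : conv x) : x ~> bpoint_of x Hx.
Proof. split; exact Hx. Qed.

Lemma to_bd_conv (x : nat -> X) (xi : bd) : x ~> xi -> conv x.
Proof. unfold conv_to_bd. destruct xi as [S (z & Hz & HS)]; simpl. now intros H%HS. Qed.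

Lemma to_bd_inhabited (xi : bd) : exists x, x ~> xi.
Proof.
  unfold conv_to_bd. destruct xi as [S (z & Hz & HS)]; simpl. exists z. apply HS; split; exact Hz.
Qed.

Lemma to_bd_equiv (x y : nat -> X) (xi : bd) : x ~> xi -> y ~> xi -> seqv x y.
Proof.
  unfold conv_to_bd. destruct xi as [S (z & Hz & HS)]; simpl. intros [_ Hx]%HS [_ Hy]%HS.
  apply (seq_equiv_trans x z y); [now apply seq_equiv_sym|exact Hy].
Qed.

Lemma equiv_to_bd (x y : nat -> X) (xi : bd) : x ~> xi -> seqv x y -> y ~> xi.
Proof.
  intros Hx Hxy. pose proof (seq_equiv_conv_r _ _ Hxy) as Hy. revert Hx.
  unfold conv_to_bd. destruct xi as [S (z & Hz & HS)]; simpl. intros [_ Hx]%HS.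
  apply HS; split; [exact Hy|now apply (seq_equiv_trans z x y)].
Qed.

Lemma bpoint_eq (x y : nat -> X) (xi eta : bd) : x ~> xi -> y ~> eta -> seqv x y -> xi = eta.
Proof.
  intros Hx Hy Hxy.
  assert (HS : proj1_sig xi = proj1_sig eta).
  { apply functional_extensionality; intros z. apply propositional_extensionality. split; intros Hz.
    - apply (equiv_to_bd y z eta Hy).
      apply (seq_equiv_trans y x z); [now apply seq_equiv_sym|now apply (to_bd_equiv x z xi)].
    - apply (equiv_to_bd x z xi Hx).
      apply (seq_equiv_trans x y z); [exact Hxy|now apply (to_bd_equiv y z eta)]. }
  destruct xi as [S HS1], eta as [S' HS2]; simpl in HS; subst S'. f_equal. apply proof_irrelevance.
Qed.

Lemma bpoint_separated (x y : nat -> X) (xi eta : bd) : x ~> xi -> y ~> eta -> xi <> eta ->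
  exists K M, forall i j, (M <= i)%nat -> (M <= j)%nat -> gp o (x i) (y j) <= K.
Proof.
  intros Hx Hy Hne. apply not_equiv_bounded; [eapply to_bd_conv, Hx|eapply to_bd_conv, Hy|].
  intros He. now apply Hne, (bpoint_eq x y).
Qed.

Lemma to_bd_subseq (x : nat -> X) (xi : bd) (phi : nat -> nat) :
  x ~> xi -> (forall n, (n <= phi n)%nat) -> (fun n => x (phi n)) ~> xi.
Proof.
  intros Hx Hphi. apply (equiv_to_bd x _ xi Hx), conv_subseq; [eapply to_bd_conv, Hx|exact Hphi].
Qed.

Lemma dist_to_geod_le (g : R -> X) (t : R) : dist_to_geod X d o g <= d o (g t).
Proof.
  unfold dist_to_geod. destruct (Glb_Rbar_correct (fun r => exists t, r = d o (g t))) as [H1 H2].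
  pose proof (H1 _ (ex_intro _ t eq_refl)) as H.
  assert (H0 : Rbar_le 0 (Glb_Rbar (fun r => exists t, r = d o (g t)))).
  { apply H2. intros r [s ->]. apply d_pos. }
  destruct (Glb_Rbar _) as [q| |]; simpl in *; easy.
Qed.

Lemma dist_to_geod_approx (g : R -> X) : exists t, d o (g t) < dist_to_geod X d o g + 1.
Proof.
  unfold dist_to_geod. destruct (Glb_Rbar_correct (fun r => exists t, r = d o (g t))) as [H1 H2].
  pose proof (H1 _ (ex_intro _ 0 eq_refl)) as H.
  assert (H0 : Rbar_le 0 (Glb_Rbar (fun r => exists t, r = d o (g t)))).
  { apply H2. intros r [s ->]. apply d_pos. }
  destruct (Glb_Rbar (fun r => exists t, r = d o (g t))) as [q| |] eqn:E; simpl in *; try easy.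
  apply NNPP; intros Hno.
  assert (Hb : Rbar_le (q + 1) q).
  { apply H2. intros r [s ->]. simpl. apply Rnot_lt_le; intros Hlt. apply Hno. now exists s. }
  simpl in Hb; lra.
Qed.

(** Far out on [g], the points [a] and [b] have product at most [D + 1] at [o] because a point at
    distance below [D + 1] lies between them, and at least [D - 2 * delta] because the branch point
    of the triangle lies on [g]. Replacing [a] and [b] by [x i] and [y j] costs the remaining
    multiples of [delta]. *)
Lemma geodesic_gp (g : R -> X) (x y : nat -> X) :
  (forall s t, d (g s) (g t) = Rabs (s - t)) ->
  seqv x (fun n => g (- INR n)) -> seqv y (fun n => g (INR n)) ->
  exists M, forall i j, (M <= i)%nat -> (M <= j)%nat ->
    dist_to_geod X d o g - (4 * delta + 1) <= gp o (x i) (y j) <=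
    dist_to_geod X d o g + (4 * delta + 1).
Proof.
  intros Hg Hx Hy. set (D := dist_to_geod X d o g). pose proof delta_nonneg as Hdl.
  destruct (dist_to_geod_approx g) as [t Ht]. fold D in Ht.
  destruct (Hx (D + 4 * delta + 2)) as [M1 H1], (Hy (D + 4 * delta + 2)) as [M2 H2].
  destruct (INR_unbounded (Rabs t)) as [M3 H3].
  set (n := Nat.max M3 (Nat.max M1 M2)). exists n. intros i j Hi Hj.
  specialize (H1 i n ltac:(lia) ltac:(lia)). specialize (H2 j n ltac:(lia) ltac:(lia)). cbv beta in *.
  assert (Hn : INR M3 <= INR n) by (apply le_INR; lia).
  assert (Htn : - INR n <= t <= INR n).
  { pose proof (Rabs_pos t). unfold Rabs in *; destruct (Rcase_abs t); lra. }
  set (a := g (- INR n)) in *. set (b := g (INR n)) in *.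
  assert (Hab : d a b = 2 * INR n) by (unfold a, b; rewrite Hg, Rabs_left1; lra).
  assert (Hup : gp o a b <= D + 1).
  { pose proof (d_tri o (g t) a) as T1. pose proof (d_tri o (g t) b) as T2.
    unfold a, b in T1, T2. rewrite Hg, Rabs_pos_eq in T1 by lra. rewrite Hg, Rabs_left1 in T2 by lra.
    fold a b in T1, T2. unfold gromov_product. lra. }
  assert (Hlow : D <= gp o a b + 2 * delta).
  { pose proof (gp_nonneg a o b). pose proof (gp_le_r a o b) as Hle. rewrite Hab in Hle.
    pose proof (dist_to_geod_le g (gp a o b - INR n)) as Hq. fold D in Hq.
    pose proof (gp_complement a b o) as Hc. rewrite (gp_sym a b o), (gp_sym b a o), Hab in Hc.
    assert (Hnear : d o (g (gp a o b - INR n)) <= gp o a b + 2 * delta).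
    { apply geodesic_point_near.
      - unfold a at 1. rewrite Hg, Rabs_left1; lra.
      - rewrite d_sym. unfold b at 1. rewrite Hg, Rabs_pos_eq; lra. }
    lra. }
  rewrite (gp_sym o (y j) b) in H2. split.
  - pose proof (gp_hyp o (x i) a b (D - 2 * delta)) as Ha.
    pose proof (gp_hyp o (x i) b (y j) (D - 3 * delta)) as Hb. lra.
  - apply Rnot_lt_le; intros Hlt.
    set (k := Rmin (gp o (x i) (y j)) (D + 4 * delta + 2)).
    assert (Hk1 : k <= gp o (x i) (y j)) by apply Rmin_l.
    assert (Hk2 : k <= D + 4 * delta + 2) by apply Rmin_r.
    assert (Hk : D + 4 * delta + 1 < k) by (apply Rmin_glb_lt; lra).
    rewrite (gp_sym o (x i) a) in H1. rewrite (gp_sym o b (y j)) in H2.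
    pose proof (gp_hyp o a (x i) (y j) k) as Ha.
    pose proof (gp_hyp o a (y j) b (k - delta)) as Hb. lra.
Qed.

Context (Hproper : proper_space d) (Hgeod : geodesic_space d).
Context (rho : bd -> bd -> R) (eps : R) (Heps : 0 < eps) (Hrho : visual_metric X d o rho eps).

(** [visual_metric] speaks only of geodesics between distinct points; here it becomes an estimate by
    Gromov products of representing sequences, the form used from now on. For [xi = eta] the upper
    bound is trivial and the premise of the lower one cannot hold. *)
Lemma visual_estimate : exists C, 1 <= C /\ forall (xi eta : bd) (x y : nat -> X) (K : R) (M : nat),
  x ~> xi -> y ~> eta ->
  ((forall i j, (M <= i)%nat -> (M <= j)%nat -> K <= gp o (x i) (y j)) ->
     rho xi eta <= C * exp (- eps * K)) /\
  ((forall i j, (M <= i)%nat -> (M <= j)%nat -> gp o (x i) (y j) <= K) ->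
     / C * exp (- eps * K) <= rho xi eta).
Proof.
  destruct Hrho as [Hm (C & HC & Hvis)]. pose proof delta_nonneg as Hdl.
  set (c := 4 * delta + 1).
  assert (He : 1 <= exp (eps * c)).
  { rewrite <- exp_0. apply exp_mono. apply Rmult_le_pos; unfold c; lra. }
  exists (C * exp (eps * c)). split.
  { rewrite <- (Rmult_1_l 1). apply Rmult_le_compat; lra. }
  intros xi eta x y K M Hx Hy.
  assert (Hinv : / (C * exp (eps * c)) = / C * exp (- eps * c)).
  { rewrite Rinv_mult, <- exp_Ropp. do 2 f_equal. lra. }
  rewrite Hinv.
  destruct (classic (xi = eta)) as [->|Hne].
  { split; intros HK.
    - assert (H0 : rho eta eta = 0) by now apply Hm. rewrite H0.
      pose proof (exp_pos (- eps * K)). pose proof (exp_pos (eps * c)).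
      repeat apply Rmult_le_pos; lra.
    - exfalso. apply (bounded_not_equiv x y K M HK). now apply (to_bd_equiv x y eta). }
  destruct (biinfinite_exists (o := o) Hproper Hgeod x y) as (g & Hg & Hgx & Hgy).
  { eapply to_bd_conv, Hx. }
  { eapply to_bd_conv, Hy. }
  { intros He'. now apply Hne, (bpoint_eq x y). }
  destruct (Hvis xi eta g Hne) as [Hlo Hup].
  { split; [exact Hg|split; [now apply (equiv_to_bd x)|now apply (equiv_to_bd y)]]. }
  destruct (geodesic_gp g x y Hg Hgx Hgy) as [M' HM'].
  specialize (HM' (Nat.max M M') (Nat.max M M') ltac:(lia) ltac:(lia)). fold c in HM'.
  set (D := dist_to_geod X d o g) in *. split; intros HK;
    specialize (HK (Nat.max M M') (Nat.max M M') ltac:(lia) ltac:(lia)).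
  - eapply Rle_trans; [exact Hup|]. rewrite Rmult_assoc, <- exp_plus.
    apply Rmult_le_compat_l; [lra|]. apply exp_mono.
    assert (eps * (K - c) <= eps * D) by (apply Rmult_le_compat_l; lra). lra.
  - eapply Rle_trans; [|exact Hlo]. rewrite Rmult_assoc, <- exp_plus.
    apply Rmult_le_compat_l; [left; apply Rinv_0_lt_compat; lra|]. apply exp_mono.
    assert (eps * D <= eps * (K + c)) by (apply Rmult_le_compat_l; lra). lra.
Qed.

End Boundary.

(** * Chains and isometric actions *)

(** A discrete local quasi-geodesic: only consecutive triples and steps are constrained. The bound
    [N] lets finite words and infinite products be treated alike. *)
Definition chain {X : Type} (d : X -> X -> R) (tau D : R) (x : nat -> X) (N : nat) : Prop :=
  (forall i, (S (S i) <= N)%nat -> gromov_product d (x (S i)) (x i) (x (S (S i))) <= tau) /\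
  (forall i, (S i <= N)%nat -> D <= d (x i) (x (S i))).

Section Chains.

Context {X : Type} {d : X -> X -> R} {delta : R} {Hd : metric d} {Hh : hyperbolic d delta}.

Local Notation gp := (gromov_product d).

(** From [x (S n)], the points [x m] and [x n] are seen in the same direction, because their product
    at [x n] with [x (S n)] leaves most of a long step. The next turn for [x m] is compared with the
    one for [x n], where the bound is the original [tau]: the loss of one [delta] does not
    accumulate. *)
Lemma chain_last_gp (tau D : R) (x : nat -> X) (N : nat) :
  0 <= tau -> 2 * tau + 2 * delta < D -> chain d tau D x N ->
  forall m n, (m < n)%nat -> (S n <= N)%nat -> gp (x n) (x m) (x (S n)) <= tau + delta.
Proof.
  intros Ht HD [H1 H2] m n Hmn. pose proof delta_nonneg as Hdl.
  induction Hmn as [|n Hmn IH]; intros HN.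
  - specialize (H1 m HN). lra.
  - specialize (IH ltac:(lia)).
    pose proof (gp_complement (x n) (x (S n)) (x m)) as Hc.
    rewrite (gp_sym (x n)) in Hc. specialize (H2 n ltac:(lia)).
    apply (gp_hyp_lt (x (S n)) (x n) (x m) (x (S (S n))) (D - tau - delta)); [now apply H1| |]; lra.
Qed.

Lemma chain_rev (tau D : R) (x : nat -> X) (N : nat) :
  chain d tau D x N -> chain d tau D (fun i => x (N - i)%nat) N.
Proof.
  intros [H1 H2]. split; intros i Hi.
  - rewrite gp_sym. replace (N - i)%nat with (S (S (N - S (S i)))) by lia.
    replace (N - S i)%nat with (S (N - S (S i))) by lia. apply H1; lia.
  - rewrite d_sym. replace (N - i)%nat with (S (N - S i)) by lia. apply H2; lia.
Qed.

Lemma chain_first_gp (tau D : R) (x : nat -> X) (N : nat) :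
  0 <= tau -> 2 * tau + 2 * delta < D -> chain d tau D x N ->
  forall k n, (S k < n)%nat -> (n <= N)%nat -> gp (x (S k)) (x n) (x k) <= tau + delta.
Proof.
  intros Ht HD Hc k n Hk Hn.
  pose proof (chain_last_gp tau D _ N Ht HD (chain_rev _ _ _ _ Hc) (N - n) (N - S k)) as H.
  cbv beta in H. replace (N - (N - n))%nat with n in H by lia.
  replace (N - (N - S k))%nat with (S k) in H by lia.
  replace (N - S (N - S k))%nat with k in H by lia. apply H; lia.
Qed.

(** The forward and backward estimates meet at [x k]: from there [x n] is seen in the direction of
    [x (S k)], so the bound for [x (S k)] passes to [x n] with one more [delta]. *)
Lemma chain_gp (tau D : R) (x : nat -> X) (N : nat) :
  0 <= tau -> 2 * tau + 3 * delta < D -> chain d tau D x N ->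
  forall m k n, (m <= k)%nat -> (k <= n)%nat -> (n <= N)%nat -> gp (x k) (x m) (x n) <= tau + 2 * delta.
Proof.
  intros Ht HD Hc m k n Hmk Hkn HN. pose proof delta_nonneg as Hdl.
  destruct (Nat.eq_dec m k) as [->|Hm].
  { pose proof (gp_le_l (x k) (x k) (x n)) as H. rewrite d_refl in H. lra. }
  destruct (Nat.eq_dec k n) as [->|Hk].
  { pose proof (gp_le_r (x n) (x m) (x n)) as H. rewrite d_refl in H. lra. }
  assert (H1 : gp (x k) (x m) (x (S k)) <= tau + delta).
  { apply (chain_last_gp tau D x N); try assumption; lia || lra. }
  destruct (Nat.eq_dec (S k) n) as [<-|Hk']; [lra|].
  assert (H2 : gp (x (S k)) (x n) (x k) <= tau + delta).
  { apply (chain_first_gp tau D x N); try assumption; lia || lra. }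
  pose proof (gp_complement (x k) (x (S k)) (x n)) as Hcp.
  rewrite (gp_sym (x (S k)) (x k)) in Hcp. pose proof (proj2 Hc k ltac:(lia)).
  rewrite gp_sym in H1. rewrite (gp_sym (x k) (x m)).
  pose proof (gp_hyp_lt (x k) (x (S k)) (x n) (x m) (D - tau - delta) (tau + delta)) as Hf. lra.
Qed.

Lemma chain_dist (tau D : R) (x : nat -> X) (N : nat) :
  0 <= tau -> 2 * tau + 3 * delta < D -> chain d tau D x N ->
  forall m k n, (m <= k)%nat -> (k <= n)%nat -> (n <= N)%nat ->
    d (x m) (x k) + d (x k) (x n) - 2 * (tau + 2 * delta) <= d (x m) (x n).
Proof.
  intros Ht HD Hc m k n H1 H2 H3. pose proof (chain_gp tau D x N Ht HD Hc m k n H1 H2 H3) as H.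
  unfold gromov_product in H. rewrite (d_sym (x k) (x m)) in H. lra.
Qed.

(** Each step gains at least [D - 2 * (tau + delta)], which is at least 1. *)
Lemma chain_growth (tau D : R) (x : nat -> X) (N : nat) :
  0 <= tau -> 2 * tau + 4 * delta + 1 <= D -> chain d tau D x N ->
  forall m n, (m <= n)%nat -> (n <= N)%nat -> INR (n - m) <= d (x m) (x n).
Proof.
  intros Ht HD Hc m n Hmn. pose proof delta_nonneg as Hdl.
  induction Hmn as [|n Hmn IH]; intros HN.
  - rewrite Nat.sub_diag. apply d_pos.
  - replace (S n - m)%nat with (S (n - m)) by lia. rewrite S_INR. specialize (IH ltac:(lia)).
    destruct (Nat.eq_dec m n) as [->|Hne].
    + rewrite Nat.sub_diag. pose proof (proj2 Hc n HN). simpl. lra.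
    + assert (Hl : gp (x n) (x m) (x (S n)) <= tau + delta).
      { apply (chain_last_gp tau D x N); try assumption; lia || lra. }
      pose proof (proj2 Hc n HN). unfold gromov_product in Hl. rewrite (d_sym (x n) (x m)) in Hl. lra.
Qed.

End Chains.

Fixpoint partial_prod {G : Type} (mul : G -> G -> G) (e : G) (c : nat -> G) (n : nat) : G :=
  match n with O => e | S m => mul (partial_prod mul e c m) (c m) end.

Class proper_isometric_action {X : Type} (d : X -> X -> R) {G : Type}
  (mul : G -> G -> G) (inv : G -> G) (e : G) (act : G -> X -> X) : Prop := {
  action_group : is_group G mul inv e;
  action_isometric : isometric_action X d G mul e act;
  action_proper : proper_action X d G act }.

Section Action.

Context {X : Type} {d : X -> X -> R} {delta : R} {Hd : metric d} {Hh : hyperbolic d delta}.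
Context {G : Type} {mul : G -> G -> G} {inv : G -> G} {e : G} {act : G -> X -> X}.
Context {HG : proper_isometric_action d mul inv e act} {o : X}.

Local Notation gp := (gromov_product d).
Local Notation seqv := (seq_equiv X d o).
Local Notation conv := (conv_infty X d o).
Local Notation len g := (d o (act g o)).
Local Notation pprod := (partial_prod mul e).

Lemma act_e (x : X) : act e x = x.
Proof. apply action_isometric. Qed.

Lemma act_mul (a b : G) (x : X) : act (mul a b) x = act a (act b x).
Proof. apply action_isometric. Qed.

Lemma act_isom (a : G) (x y : X) : d (act a x) (act a y) = d x y.
Proof. apply action_isometric. Qed.

Lemma mul_assoc (a b c : G) : mul a (mul b c) = mul (mul a b) c.
Proof. apply action_group. Qed.

Lemma mul_e_l (a : G) : mul e a = a.
Proof. apply action_group. Qed.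

Lemma mul_e_r (a : G) : mul a e = a.
Proof. apply action_group. Qed.

Lemma mul_inv_l (a : G) : mul (inv a) a = e.
Proof. apply action_group. Qed.

Lemma mul_inv_r (a : G) : mul a (inv a) = e.
Proof. apply action_group. Qed.

Lemma mul_inv_cancel_l (a b : G) : mul (inv a) (mul a b) = b.
Proof. now rewrite mul_assoc, mul_inv_l, mul_e_l. Qed.

Lemma mul_cancel_inv_l (a b : G) : mul a (mul (inv a) b) = b.
Proof. now rewrite mul_assoc, mul_inv_r, mul_e_l. Qed.

Lemma act_inv_l (a : G) (x : X) : act (inv a) (act a x) = x.
Proof. now rewrite <- act_mul, mul_inv_l, act_e. Qed.

Lemma act_inv_r (a : G) (x : X) : act a (act (inv a) x) = x.
Proof. now rewrite <- act_mul, mul_inv_r, act_e. Qed.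

Lemma d_act_l (a : G) (x y : X) : d (act a x) y = d x (act (inv a) y).
Proof. now rewrite <- (act_inv_r a y) at 1; rewrite act_isom. Qed.

Lemma len_inv (a : G) : len (inv a) = len a.
Proof. now rewrite <- d_act_l, d_sym. Qed.

Lemma len_mul (a b : G) : len (mul a b) <= len a + len b.
Proof. rewrite act_mul. pose proof (d_tri o (act a o) (act a (act b o))) as H. now rewrite act_isom in H. Qed.

Lemma gp_act (a : G) (w x y : X) : gp (act a w) (act a x) (act a y) = gp w x y.
Proof. unfold gromov_product. now rewrite !act_isom. Qed.

(** Translation by [a] turns the left side into the product at [act a o] of [o] and [act a x]. This
    trades statements on the direction of [inv a] for statements on that of [a]. *)
Lemma gp_inv_complement (a : G) (x : X) : gp o (act (inv a) o) x = len a - gp o (act a o) (act a x).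
Proof.
  rewrite <- (gp_act a), act_inv_r. pose proof (gp_complement o (act a o) (act a x)). lra.
Qed.

Lemma ball_finite (r : R) : exists l, forall g, len g <= r -> In g l.
Proof. exact (action_proper o r). Qed.

Lemma seq_equiv_act (a : G) (x y : nat -> X) :
  seqv x y -> seqv (fun n => act a (x n)) (fun n => act a (y n)).
Proof. apply seq_equiv_isometry. apply act_isom. Qed.

Lemma prod_chain (c : nat -> G) (tau D : R) (N : nat) :
  (forall i, (S (S i) <= N)%nat -> gp o (act (inv (c i)) o) (act (c (S i)) o) <= tau) ->
  (forall i, (S i <= N)%nat -> D <= len (c i)) ->
  chain d tau D (fun n => act (pprod c n) o) N.
Proof.
  intros H1 H2; split; intros i Hi.
  - specialize (H1 i Hi). rewrite <- (gp_act (mul (pprod c i) (c i))) in H1.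
    cbn [partial_prod]. rewrite !act_mul in *. now rewrite act_inv_r in H1.
  - simpl. rewrite act_mul, act_isom. now apply H2.
Qed.

Lemma infinite_pigeonhole {T : Type} (f : nat -> T) (l : list T) (N0 : nat) :
  (forall n, (N0 <= n)%nat -> In (f n) l) ->
  exists a, forall N, exists n, (N <= n)%nat /\ f n = a.
Proof.
  revert N0; induction l as [|a l IH]; intros N0 H.
  - destruct (H N0 (le_n _)).
  - destruct (classic (forall N, exists n, (N <= n)%nat /\ f n = a)) as [Ha|Ha]; [now exists a|].
    apply not_all_ex_not in Ha. destruct Ha as [N Ha].
    apply (IH (Nat.max N N0)). intros n Hn. destruct (H n ltac:(lia)) as [He|]; [|easy].
    exfalso; apply Ha. exists n; split; [lia|easy].
Qed.

(** * Consequences of a boundary point fixed by the whole group *)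

Section FixedPoint.

Context (b : nat -> X) (Hb : conv b) (Hfix : forall g, seqv b (fun n => act g (b n))).

Lemma fix_gp (g : G) (p : X) (kappa : R) (J0 : nat) :
  (forall j, (J0 <= j)%nat -> gp o p (b j) <= kappa) ->
  exists J, forall j, (J <= j)%nat -> gp o p (act g (b j)) <= kappa + delta.
Proof.
  intros H. destruct (Hfix g (kappa + delta + 1)) as [J HJ]. exists (Nat.max J J0). intros j Hj.
  rewrite gp_sym. specialize (H (Nat.max J J0) ltac:(lia)).
  apply (gp_hyp_lt o (b (Nat.max J J0)) _ p (kappa + delta + 1)); [now rewrite gp_sym|apply HJ; lia|lra].
Qed.

(** [g] preserves the class of [b], so [act g o] is transverse to [act g (b j)] as well, and the
    complement of that small product is the large product of [act (inv g) o] with [b j]. *)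
Lemma fix_inverse (g : G) (kappa : R) (J0 : nat) :
  (forall j, (J0 <= j)%nat -> gp o (act g o) (b j) <= kappa) ->
  exists J, forall j, (J <= j)%nat -> len g - (kappa + delta) <= gp o (act (inv g) o) (b j).
Proof.
  intros H. destruct (fix_gp g _ _ _ H) as [J HJ]. exists J. intros j Hj.
  rewrite gp_inv_complement. specialize (HJ j Hj). lra.
Qed.

(** [p] lies close to a ray towards [b], and [act h p] close to a ray from [act h o] to the same
    boundary point. Their distances to [o] differ by at most [len h], so they are close to each
    other by a bound that does not involve [p]. *)
Lemma fix_displacement (h : G) (p : X) (c : R) (J0 : nat) :
  (forall j, (J0 <= j)%nat -> d o p - c <= gp o p (b j)) ->
  d p (act h p) <= 3 * len h + 2 * c + 4 * delta.
Proof.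
  intros H. destruct (Hfix h (d o p - c - len h)) as [J HJ].
  set (j := Nat.max J J0). specialize (H j ltac:(lia)). specialize (HJ j j ltac:(lia) ltac:(lia)).
  cbv beta in HJ.
  assert (H1 : d o p - c - len h <= gp o (act h p) (act h (b j))).
  { pose proof (gp_base (act h o) o (act h p) (act h (b j))) as H1. rewrite gp_act in H1.
    rewrite (d_sym (act h o) o) in H1. lra. }
  pose proof (d_pos o (act h o)).
  pose proof (gp_hyp o p (b j) (act h (b j)) (d o p - c - len h)) as H2.
  rewrite (gp_sym o (act h p)) in H1.
  pose proof (gp_hyp o p (act h (b j)) (act h p) (d o p - c - len h - delta)) as H3.
  pose proof delta_nonneg as Hdl.
  pose proof (d_tri o (act h o) (act h p)) as H4. rewrite act_isom in H4.
  unfold gromov_product in *. lra.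
Qed.

(** The conjugates of [g] and of [w] by late [u n] take finitely many values, and two indices with
    the same pair of values differ by an element commuting with both. These elements still escape
    and stay transverse to [b], since the common factor [inv (u k0)] preserves the class of [b] and
    changes products by a bounded amount. *)
Lemma fix_commuting (u : nat -> G) (kappa : R) (N : nat) (g w : G) :
  conv (fun n => act (u n) o) ->
  (forall n j, (N <= n)%nat -> (N <= j)%nat -> gp o (act (u n) o) (b j) <= kappa) ->
  exists q : nat -> G,
    (forall l, mul g (q l) = mul (q l) g /\ mul w (q l) = mul (q l) w) /\
    (forall K, exists M, forall l, (M <= l)%nat -> K <= len (q l)) /\
    exists K M, forall l j, (M <= l)%nat -> (M <= j)%nat -> gp o (act (q l) o) (b j) <= K.
Proof.
  intros Hu HN.
  set (conj h n := mul (u n) (mul h (inv (u n)))).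
  assert (Hconj : forall h n, (N <= n)%nat -> len (conj h n) <= 3 * len h + 2 * (kappa + delta) + 4 * delta).
  { intros h n Hn. destruct (fix_inverse (u n) kappa N (fun j Hj => HN n j Hn Hj)) as [J HJ].
    pose proof (fix_displacement h (act (inv (u n)) o) (kappa + delta) J) as H. unfold conj.
    rewrite !act_mul, d_sym, d_act_l, d_sym. apply H. now rewrite len_inv. }
  destruct (ball_finite (3 * len g + 2 * (kappa + delta) + 4 * delta)) as [l1 Hl1].
  destruct (ball_finite (3 * len w + 2 * (kappa + delta) + 4 * delta)) as [l2 Hl2].
  destruct (infinite_pigeonhole (fun n => (conj g n, conj w n)) (list_prod l1 l2) N) as [a Ha].
  { intros n Hn. apply in_prod; [apply Hl1|apply Hl2]; now apply Hconj. }
  destruct (choice (fun l n => (l <= n)%nat /\ (conj g n, conj w n) = a) Ha) as [phi Hphi].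
  destruct (Hphi 0%nat) as [_ H0]. set (k0 := phi 0%nat) in *.
  assert (Hcomm : forall h n, conj h n = conj h k0 ->
    mul h (mul (inv (u k0)) (u n)) = mul (mul (inv (u k0)) (u n)) h).
  { intros h n He. unfold conj in He.
    assert (E1 : mul (inv (u k0)) (mul (mul (u n) (mul h (inv (u n)))) (u n)) = mul (inv (u k0)) (mul (mul (u k0) (mul h (inv (u k0)))) (u n))) by now rewrite He.
    rewrite <- !mul_assoc, mul_inv_l, mul_e_r, mul_inv_cancel_l in E1.
    rewrite <- E1, <- !mul_assoc. reflexivity. }
  exists (fun l => mul (inv (u k0)) (u (phi l))). repeat split.
  - apply Hcomm. destruct (Hphi l) as [_ Hl]. congruence.
  - apply Hcomm. destruct (Hphi l) as [_ Hl]. congruence.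
  - intros K. destruct (conv_far _ Hu (K + len (u k0))) as [M HM]. exists M. intros l Hl.
    specialize (HM (phi l) ltac:(destruct (Hphi l); lia)). cbv beta in HM.
    pose proof (len_mul (u k0) (mul (inv (u k0)) (u (phi l)))) as H.
    rewrite mul_cancel_inv_l in H. lra.
  - destruct (Hfix (u k0) (kappa + delta + 1)) as [J HJ].
    exists (kappa + delta + len (u k0)), (Nat.max N J). intros l j Hl Hj.
    rewrite act_mul, <- (gp_act (u k0)), act_inv_r.
    pose proof (gp_base (act (u k0) o) o (act (u (phi l)) o) (act (u k0) (b j))) as H.
    rewrite (d_sym _ o) in H.
    assert (H2 : gp o (act (u k0) (b j)) (act (u (phi l)) o) <= kappa + delta).
    { apply (gp_hyp_lt o (b j) _ _ (kappa + delta + 1)); [|apply HJ; lia|lra].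
      rewrite gp_sym. apply HN; [|lia]. destruct (Hphi l); lia. }
    rewrite gp_sym in H2. lra.
Qed.

Lemma prod_const_commute (g q : G) (n : nat) : mul g q = mul q g ->
  mul (pprod (fun _ => g) n) q = mul q (pprod (fun _ => g) n).
Proof.
  intros H. induction n as [|n IH]; simpl; [now rewrite mul_e_l, mul_e_r|].
  now rewrite <- mul_assoc, H, mul_assoc, IH, mul_assoc.
Qed.

(** The powers [p n] of [g] form a chain leaving [o] along [act g o], and their inverses point to
    [b], which [q l] avoids; hence the product of [p n] and [q l] moves [o] in the direction of [g].
    By commutation that point is also within [len (p n)] of [act (q l) o], so for long [q l] the
    latter lies in the direction of [g] too. *)
Lemma fix_common_direction (g : G) (q : nat -> G) (kappa K : R) (J0 M0 : nat) :
  0 <= kappa -> 4 * kappa + 10 * delta + 1 < len g ->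
  (forall j, (J0 <= j)%nat -> gp o (act g o) (b j) <= kappa) ->
  (forall l, mul g (q l) = mul (q l) g) ->
  (forall K, exists M, forall l, (M <= l)%nat -> K <= len (q l)) ->
  (forall l j, (M0 <= l)%nat -> (M0 <= j)%nat -> gp o (act (q l) o) (b j) <= K) ->
  exists M, forall l, (M <= l)%nat -> len g - (kappa + 4 * delta) <= gp o (act g o) (act (q l) o).
Proof.
  intros Hk Hlen Hg Hcomm Hfar HK. pose proof delta_nonneg as Hdl.
  set (p := pprod (fun _ => g)).
  assert (Hgg : gp o (act (inv g) o) (act g o) <= kappa + delta).
  { destruct (fix_inverse g kappa J0 Hg) as [J HJ].
    set (j := Nat.max J J0). specialize (HJ j ltac:(lia)). specialize (Hg j ltac:(lia)).
    rewrite gp_sym in Hg, HJ.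
    pose proof (gp_hyp_lt o (b j) (act (inv g) o) (act g o) (len g - (kappa + delta)) kappa). lra. }
  assert (Hch : forall N, chain d (kappa + delta) (len g) (fun n => act (p n) o) N).
  { intros N. apply prod_chain; intros; [exact Hgg|lra]. }
  assert (H1 : forall n, (1 <= n)%nat -> len g - (kappa + 3 * delta) <= gp o (act g o) (act (p n) o)).
  { intros n Hn.
    pose proof (chain_gp (kappa + delta) (len g) _ n ltac:(lra) ltac:(lra) (Hch n) 0 1 n
      ltac:(lia) Hn ltac:(lia)) as H.
    unfold p in H at 1 2. simpl in H. rewrite mul_e_l, act_e in H.
    pose proof (gp_complement o (act g o) (act (p n) o)). lra. }
  (* [len (p n)] has to exceed [len g + K] with room for the [delta] losses in [H3] and [H4]; [Rabs]
     guards against a negative [K]. *)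
  destruct (INR_unbounded (len g + (kappa + 3 * delta) + Rabs K + 10 * delta + 1)) as [n Hn].
  assert (Hn1 : (1 <= n)%nat).
  { destruct n; [|lia]. simpl in Hn. pose proof (Rabs_pos K). lra. }
  assert (Hpn : INR n <= len (p n)).
  { pose proof (chain_growth (kappa + delta) (len g) _ n ltac:(lra) ltac:(lra) (Hch n) 0 n
      ltac:(lia) ltac:(lia)) as H.
    rewrite Nat.sub_0_r in H. unfold p in H at 1. simpl in H. now rewrite act_e in H. }
  pose proof (H1 n Hn1) as H1n.
  assert (H2 : forall j, (J0 <= j)%nat -> gp o (act (p n) o) (b j) <= kappa + delta).
  { intros j Hj. apply (gp_hyp_lt o (act g o) _ _ (len g - (kappa + 3 * delta))); [now apply Hg|exact H1n|lra]. }
  destruct (fix_inverse (p n) (kappa + delta) J0 H2) as [J1 HJ1].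
  destruct (Hfar (len g + len (p n))) as [M1 HM1].
  pose proof (Rle_abs K) as HabsK.
  exists (Nat.max M0 M1). intros l Hl.
  set (j := Nat.max M0 J1). specialize (HJ1 j ltac:(lia)). specialize (HK l j ltac:(lia) ltac:(lia)).
  assert (H3 : gp o (act (inv (p n)) o) (act (q l) o) <= K + delta).
  { rewrite gp_sym in HK, HJ1.
    apply (gp_hyp_lt o (b j) _ _ (len (p n) - (kappa + delta + delta))); [exact HK|exact HJ1|lra]. }
  assert (H4 : len g + delta <= gp o (act (p n) o) (act (p n) (act (q l) o))).
  { rewrite gp_inv_complement in H3. lra. }
  assert (H5 : len g <= gp o (act (p n) (act (q l) o)) (act (q l) o)).
  { rewrite <- act_mul. unfold p. rewrite (prod_const_commute g (q l) n (Hcomm l)). fold p.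
    rewrite act_mul. specialize (HM1 l ltac:(lia)).
    pose proof (act_isom (q l) (act (p n) o) o) as Hi. rewrite (d_sym _ o) in Hi.
    pose proof (d_tri o (act (q l) (act (p n) o)) (act (q l) o)).
    unfold gromov_product. lra. }
  pose proof (gp_hyp o (act (p n) o) (act (p n) (act (q l) o)) (act (q l) o) (len g)) as H6.
  pose proof (gp_hyp o (act g o) (act (p n) o) (act (q l) o) (len g - (kappa + 3 * delta))) as H7. lra.
Qed.

End FixedPoint.

End Action.

(** * The extension lemma *)

(** Sequential compactness at infinity: the limit of the segments from [o] at parameter [k] is a
    point close to all late segments, so late terms have product at least [k - 1 - delta] with one
    another. *)
Lemma conv_subsequence_exists {X : Type} {d : X -> X -> R} {delta : R} {Hd : metric d}
  {Hh : hyperbolic d delta} {o : X} (x : nat -> X) :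
  proper_space d -> geodesic_space d ->
  (forall K, exists M, forall n, (M <= n)%nat -> K <= d o (x n)) ->
  exists phi, (forall n, (phi n < phi (S n))%nat) /\ conv_infty X d o (fun n => x (phi n)).
Proof.
  intros Hproper Hgeod Hfar.
  destruct (choice (fun n (g : R -> X) => g 0 = o /\ g (d o (x n)) = x n /\
     forall s t, 0 <= s <= d o (x n) -> 0 <= t <= d o (x n) -> d (g s) (g t) = Rabs (s - t)))
    as [gam Hgam].
  { intros n. apply Hgeod. }
  destruct (geodesic_limit Hproper (o := o) (fun _ => o) x (fun _ => 0) gam 0) as (phi & p & Hphi & Hp).
  { intros n; pose proof (d_pos o (x n)); lra. }
  { intros n; apply Hgam. }
  { intros n; rewrite (proj1 (Hgam n)), d_refl; lra. }
  exists phi; split; [exact Hphi|]. intros K.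
  destruct (INR_unbounded (Rabs K + 1 + delta)) as [k Hk].
  pose proof (Rle_abs K). pose proof (Rabs_pos K). pose proof delta_nonneg as Hdl.
  destruct (Hp (Z.of_nat k) 1 ltac:(lra)) as [N1 H1]. destruct (Hfar (INR k)) as [N2 H2].
  assert (Hclose : forall n, (Nat.max N1 N2 <= n)%nat ->
    INR k - 1 <= gromov_product d o (x (phi n)) (p (Z.of_nat k))).
  { intros n Hn. specialize (H1 n ltac:(lia)).
    specialize (H2 (phi n) ltac:(pose proof (subseq_ge _ Hphi n); lia)).
    rewrite <- INR_IZR_INZ, clamp_id, Rplus_0_l in H1 by lra.
    destruct (Hgam (phi n)) as (G0 & G1 & G2).
    assert (Hv : gromov_product d o (x (phi n)) (gam (phi n) (INR k)) = INR k).
    { unfold gromov_product.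
      pose proof (G2 0 (INR k) ltac:(lra) ltac:(lra)) as D1.
      pose proof (G2 (d o (x (phi n))) (INR k) ltac:(lra) ltac:(lra)) as D2.
      rewrite G0, Rabs_left1 in D1 by lra. rewrite G1, Rabs_pos_eq in D2 by lra. lra. }
    pose proof (gp_move o (x (phi n)) (gam (phi n) (INR k)) (p (Z.of_nat k))). lra. }
  exists (Nat.max N1 N2). intros i j Hi Hj.
  pose proof (Hclose i Hi) as Ci. pose proof (Hclose j Hj) as Cj. rewrite gp_sym in Cj.
  pose proof (gp_hyp o _ _ _ _ Ci Cj). lra.
Qed.

Lemma bool_bound (f : bool -> bool -> R) : exists C, forall i j, f i j <= C.
Proof.
  exists (Rmax (Rmax (f true true) (f true false)) (Rmax (f false true) (f false false))).
  intros [] []; [eapply Rle_trans; [|apply Rmax_l]; apply Rmax_l|eapply Rle_trans; [|apply Rmax_l]; apply Rmax_r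
    |eapply Rle_trans; [|apply Rmax_r]; apply Rmax_l|eapply Rle_trans; [|apply Rmax_r]; apply Rmax_r].
Qed.

Lemma bool_bound_nat (f : bool -> bool -> nat) : exists C, forall i j, (f i j <= C)%nat.
Proof.
  exists (f true true + f true false + f false true + f false false)%nat. intros [] []; lia.
Qed.

Section Extension.

Context {X : Type} {d : X -> X -> R} {delta : R} {Hd : metric d} {Hh : hyperbolic d delta}.
Context (Hproper : proper_space d) (Hgeod : geodesic_space d).
Context {G : Type} {mul : G -> G -> G} {inv : G -> G} {e : G} {act : G -> X -> X}.
Context {HG : proper_isometric_action d mul inv e act} {o : X}.
Context (Hne : non_elementary X d o G act).

Local Notation gp := (gromov_product d).
Local Notation seqv := (seq_equiv X d o).
Local Notation conv := (conv_infty X d o).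
Local Notation bd := (bpoint X d o).
Local Notation "x ~> xi" := (conv_to_bd X d o x xi) (at level 70).
Local Notation len g := (d o (act g o)).
Local Notation pprod := (partial_prod mul e).

Lemma two_other_limit_points (b : nat -> X) : conv b ->
  exists u w : nat -> G,
    conv (fun n => act (u n) o) /\ conv (fun n => act (w n) o) /\
    ~ seqv (fun n => act (u n) o) b /\ ~ seqv (fun n => act (w n) o) b /\
    ~ seqv (fun n => act (u n) o) (fun n => act (w n) o).
Proof.
  intros Hb. set (beta := bpoint_of b Hb).
  assert (Hbeta : b ~> beta) by apply bpoint_of_conv.
  assert (Hpair : forall xi eta : bd, limit_set X d o G act xi -> limit_set X d o G act eta ->
    xi <> eta -> xi <> beta -> eta <> beta -> exists u w : nat -> G,
      conv (fun n => act (u n) o) /\ conv (fun n => act (w n) o) /\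
      ~ seqv (fun n => act (u n) o) b /\ ~ seqv (fun n => act (w n) o) b /\
      ~ seqv (fun n => act (u n) o) (fun n => act (w n) o)).
  { intros xi eta [u Hu] [w Hw] H1 H2 H3. exists u, w.
    split; [now apply (to_bd_conv _ xi)|split; [now apply (to_bd_conv _ eta)|]].
    repeat split; intros He.
    - now apply H2, (bpoint_eq _ b xi beta Hu).
    - now apply H3, (bpoint_eq _ b eta beta Hw).
    - now apply H1, (bpoint_eq _ _ xi eta Hu Hw). }
  destruct Hne as (a1 & a2 & a3 & L1 & L2 & L3 & N12 & N23 & N13).
  destruct (classic (a1 = beta)) as [E1|E1]; [apply (Hpair a2 a3); congruence|].
  destruct (classic (a2 = beta)) as [E2|E2]; [apply (Hpair a1 a3); congruence|].
  now apply (Hpair a1 a2).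
Qed.

(* If G fixed the class of b, then b would be conical: the points u_n^-1 o stay near a ray to b, so the
   conjugates u_n h u_n^-1 range over a finite set, and two long elements g, w contracting away from b
   would both commute with infinitely many u_k^-1 u_l, hence share their other fixed point. *)
Lemma no_common_fixed_point (b : nat -> X) : conv b ->
  exists g, ~ seqv b (fun n => act g (b n)).
Proof.
  intros Hb. apply NNPP; intros Hno.
  assert (Hfix : forall g, seqv b (fun n => act g (b n))).
  { intros g. apply NNPP; intros Hg. apply Hno. now exists g. }
  pose proof delta_nonneg as Hdl.
  destruct (two_other_limit_points b Hb) as (u & w & Hu & Hw & Hub & Hwb & Huw).
  destruct (not_equiv_bounded _ _ Hu Hb Hub) as (K1 & M1 & B1).
  destruct (not_equiv_bounded _ _ Hw Hb Hwb) as (K2 & M2 & B2).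
  destruct (not_equiv_bounded _ _ Hu Hw Huw) as (K3 & M3 & B3).
  set (kappa := Rmax 0 (Rmax K1 (Rmax K2 K3))).
  assert (Hk : 0 <= kappa /\ K1 <= kappa /\ K2 <= kappa /\ K3 <= kappa).
  { unfold kappa. repeat split.
    - apply Rmax_l.
    - eapply Rle_trans; [|apply Rmax_r]. apply Rmax_l.
    - eapply Rle_trans; [|apply Rmax_r]. eapply Rle_trans; [|apply Rmax_r]. apply Rmax_l.
    - eapply Rle_trans; [|apply Rmax_r]. eapply Rle_trans; [|apply Rmax_r]. apply Rmax_r. }
  destruct Hk as (Hk0 & Hk1 & Hk2 & Hk3).
  destruct (conv_far _ Hu (4 * kappa + 10 * delta + 2)) as [N1 F1].
  destruct (conv_far _ Hw (4 * kappa + 10 * delta + 2)) as [N2 F2].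
  set (n := Nat.max (Nat.max M1 (Nat.max M2 M3)) (Nat.max N1 N2)).
  specialize (F1 n ltac:(lia)). specialize (F2 n ltac:(lia)).
  destruct (fix_commuting b Hfix u kappa M1 (u n) (w n) Hu) as (q & Hq & Hfar & K & M & HK).
  { intros i j Hi Hj. specialize (B1 i j Hi Hj). cbv beta in B1. lra. }
  destruct (fix_common_direction b Hfix (u n) q kappa K n M) as [L1 HL1]; try assumption.
  { lra. }
  { intros j Hj. specialize (B1 n j ltac:(lia) ltac:(lia)). cbv beta in B1. lra. }
  { intros l; apply Hq. }
  destruct (fix_common_direction b Hfix (w n) q kappa K n M) as [L2 HL2]; try assumption.
  { lra. }
  { intros j Hj. specialize (B2 n j ltac:(lia) ltac:(lia)). cbv beta in B2. lra. }
  { intros l; apply Hq. }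
  set (l := Nat.max L1 L2). specialize (HL1 l ltac:(lia)). specialize (HL2 l ltac:(lia)).
  rewrite gp_sym in HL2. specialize (B3 n n ltac:(lia) ltac:(lia)). cbv beta in *.
  pose proof (gp_hyp o (act (u n) o) (act (q l) o) (act (w n) o) (3 * kappa + 6 * delta + 2)) as H. lra.
Qed.

(** Otherwise [c] itself, taking [e], and all its translates would be equivalent to [b], and the
    class of [c] would be fixed by [G]. *)
Lemma moves_away (b c : nat -> X) : conv b -> conv c ->
  exists g, ~ seqv b (fun n => act g (c n)).
Proof.
  intros Hb Hc. apply NNPP; intros Hno.
  assert (Hall : forall g, seqv b (fun n => act g (c n))).
  { intros g. apply NNPP; intros Hg. apply Hno. now exists g. }
  destruct (no_common_fixed_point c Hc) as [g Hg]. apply Hg.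
  apply (seq_equiv_trans _ b); [|apply Hall]. apply seq_equiv_sym.
  intros K. destruct (Hall e K) as [M HM]. exists M. intros i j Hi Hj.
  specialize (HM i j Hi Hj). now rewrite act_e in HM.
Qed.

(* f i j starts in the direction of the i-th limit point and f^-1 in that of the j-th: a given direction
   rules out at most one value of each index. *)
Lemma extension : exists tau, 0 <= tau /\ forall D, exists K, forall x y : X, exists f : G,
  D <= len f <= K /\ gp o x (act f o) <= tau /\ gp o (act (inv f) o) y <= tau.
Proof.
  pose proof delta_nonneg as Hdl.
  (* Passing to a subsequence makes the inverses converge too; their two limits may coincide. *)
  assert (HU : exists U : bool -> nat -> G,
    (forall i, conv (fun n => act (U i n) o)) /\ (forall i, conv (fun n => act (inv (U i n)) o)) /\
    ~ seqv (fun n => act (U true n) o) (fun n => act (U false n) o)).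
  { assert (H1 : forall xi : bd, limit_set X d o G act xi -> exists u : nat -> G,
      (fun n => act (u n) o) ~> xi /\ conv (fun n => act (inv (u n)) o)).
    { intros xi [u Hu].
      destruct (conv_subsequence_exists (o := o) (fun n => act (inv (u n)) o) Hproper Hgeod) as (phi & Hphi & Hc).
      { intros K. destruct (conv_far _ (to_bd_conv _ _ Hu) K) as [M HM]. exists M. intros n Hn.
        rewrite len_inv. now apply HM. }
      exists (fun n => u (phi n)); split; [|exact Hc].
      apply (to_bd_subseq (fun n => act (u n) o) xi phi Hu). now apply subseq_ge. }
    destruct Hne as (a1 & a2 & _ & L1 & L2 & _ & N12 & _).
    destruct (H1 a1 L1) as (u1 & A1 & B1), (H1 a2 L2) as (u2 & A2 & B2).
    exists (fun i : bool => if i then u1 else u2). repeat split.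
    - intros []; [exact (to_bd_conv _ _ A1)|exact (to_bd_conv _ _ A2)].
    - intros []; assumption.
    - intros He. now apply N12, (bpoint_eq _ _ _ _ A1 A2). }
  destruct HU as (U & HU & HV & Hsep).
  destruct (not_equiv_bounded _ _ (HU true) (HU false) Hsep) as (kap & M0 & Hkap).
  assert (Hk : forall i j, exists (k : G) (c : R) (M : nat), forall n, (M <= n)%nat ->
    let f := mul (U i n) (mul k (inv (U j n))) in
    len (U i n) - c <= gp o (act (U i n) o) (act f o) /\
    len (U j n) - c <= gp o (act (U j n) o) (act (inv f) o)).
  { intros i j. destruct (moves_away _ _ (HV i) (HV j)) as [k Hk].
    destruct (not_equiv_bounded _ _ (HV i) (seq_equiv_act k _ _ (HV j)) Hk) as (c & M & Hc).
    exists k, (c + len k), M. intros n Hn f. specialize (Hc n n Hn Hn). cbv beta in Hc.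
    pose proof (d_pos o (act k o)). split.
    - rewrite gp_inv_complement in Hc. unfold f. rewrite !act_mul. lra.
    - assert (Hf : act (inv f) o = act (U j n) (act (inv k) (act (inv (U i n)) o))).
      { rewrite <- (act_inv_l f (act (U j n) _)). f_equal. unfold f.
        now rewrite !act_mul, act_inv_l, !act_inv_r. }
      rewrite Hf.
      pose proof (gp_inv_complement (o := o) (U j n) (act (inv k) (act (inv (U i n)) o))) as H1.
      rewrite <- (gp_act k), act_inv_r in H1.
      pose proof (gp_base (act k o) o (act k (act (inv (U j n)) o)) (act (inv (U i n)) o)) as H2.
      rewrite (d_sym _ o), (gp_sym o) in H2. lra. }
  destruct (choice (fun (ij : bool * bool) (kcM : G * R * nat) => forall n, (snd kcM <= n)%nat ->
    let f := mul (U (fst ij) n) (mul (fst (fst kcM)) (inv (U (snd ij) n))) in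
    len (U (fst ij) n) - snd (fst kcM) <= gp o (act (U (fst ij) n) o) (act f o) /\
    len (U (snd ij) n) - snd (fst kcM) <= gp o (act (U (snd ij) n) o) (act (inv f) o))) as [kcM HkcM].
  { intros [i j]. destruct (Hk i j) as (k & c & M & H). now exists (k, c, M). }
  clear Hk.
  destruct (bool_bound (fun i j => snd (fst (kcM (i, j))))) as [c Hc].
  destruct (bool_bound_nat (fun i j => snd (kcM (i, j)))) as [M HM].
  set (tau := Rmax 0 kap + 3 * delta).
  assert (Htau : 0 <= tau /\ kap + 3 * delta <= tau).
  { unfold tau. pose proof (Rmax_l 0 kap). pose proof (Rmax_r 0 kap). lra. }
  exists tau. split; [lra|]. intros D.
  assert (Hn : exists n, (M <= n)%nat /\ (M0 <= n)%nat /\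
    forall i, Rmax 0 D + tau + 1 + c <= len (U i n)).
  { destruct (conv_far _ (HU true) (Rmax 0 D + tau + 1 + c)) as [N1 H1].
    destruct (conv_far _ (HU false) (Rmax 0 D + tau + 1 + c)) as [N2 H2].
    exists (Nat.max (Nat.max M M0) (Nat.max N1 N2)). split; [lia|split; [lia|]].
    intros []; [apply H1|apply H2]; lia. }
  destruct Hn as (n & HMn & HM0n & Hlen).
  pose proof (Rmax_l 0 D) as HD0. pose proof (Rmax_r 0 D) as HD1.
  set (f := fun i j => mul (U i n) (mul (fst (fst (kcM (i, j)))) (inv (U j n)))).
  assert (Hf : forall i j, Rmax 0 D + tau + 1 <= gp o (act (U i n) o) (act (f i j) o) /\
    Rmax 0 D + tau + 1 <= gp o (act (U j n) o) (act (inv (f i j)) o)).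
  { intros i j. specialize (HkcM (i, j) n). simpl in HkcM. fold (f i j) in HkcM.
    specialize (Hc i j). specialize (HM i j). cbv beta in Hc, HM.
    pose proof (Hlen i). pose proof (Hlen j). destruct HkcM; [lia|]. lra. }
  specialize (Hkap n n HM0n HM0n). cbv beta in Hkap.
  destruct (bool_bound (fun i j => len (f i j))) as [K HK].
  exists K. intros x y.
  (* A direction [x] close to some [f true j1] and some [f false j2] would force [U true n] and
     [U false n] into one direction, which [Hkap] forbids. The index [i] found here serves all [j],
     so the two indices can be chosen independently. *)
  assert (Hi : exists i, forall j, gp o x (act (f i j) o) <= tau).
  { apply NNPP; intros Hi.
    assert (Hbad : forall i, exists j, tau < gp o x (act (f i j) o)).
    { intros i. apply NNPP; intros Hj. apply Hi. exists i. intros j. apply Rnot_lt_le; intros Hlt.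
      apply Hj. now exists j. }
    destruct (Hbad true) as [j1 H1], (Hbad false) as [j2 H2].
    destruct (Hf true j1) as [F1 _], (Hf false j2) as [F2 _].
    set (t := Rmin (Rmin (gp o x (act (f true j1) o)) (gp o x (act (f false j2) o))) (tau + 1)).
    assert (Ht : tau < t) by (repeat apply Rmin_glb_lt; lra).
    assert (Ht1 : t <= gp o x (act (f true j1) o)).
    { eapply Rle_trans; [apply Rmin_l|apply Rmin_l]. }
    assert (Ht2 : t <= gp o x (act (f false j2) o)).
    { eapply Rle_trans; [apply Rmin_l|apply Rmin_r]. }
    assert (Ht3 : t <= tau + 1) by apply Rmin_r.
    rewrite gp_sym in Ht1. rewrite gp_sym in F2.
    pose proof (gp_hyp o (act (U true n) o) (act (f true j1) o) x t) as G1.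
    pose proof (gp_hyp o (act (U true n) o) x (act (f false j2) o) (t - delta)) as G2.
    pose proof (gp_hyp o (act (U true n) o) (act (f false j2) o) (act (U false n) o) (t - 2 * delta)) as G3.
    lra. }
  assert (Hj : exists j, forall i, gp o (act (inv (f i j)) o) y <= tau).
  { apply NNPP; intros Hj.
    assert (Hbad : forall j, exists i, tau < gp o (act (inv (f i j)) o) y).
    { intros j. apply NNPP; intros Hi'. apply Hj. exists j. intros i. apply Rnot_lt_le; intros Hlt.
      apply Hi'. now exists i. }
    destruct (Hbad true) as [i1 H1], (Hbad false) as [i2 H2].
    destruct (Hf i1 true) as [_ F1], (Hf i2 false) as [_ F2].
    set (t := Rmin (Rmin (gp o (act (inv (f i1 true)) o) y) (gp o (act (inv (f i2 false)) o) y)) (tau + 1)).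
    assert (Ht : tau < t) by (repeat apply Rmin_glb_lt; lra).
    assert (Ht1 : t <= gp o (act (inv (f i1 true)) o) y).
    { eapply Rle_trans; [apply Rmin_l|apply Rmin_l]. }
    assert (Ht2 : t <= gp o (act (inv (f i2 false)) o) y).
    { eapply Rle_trans; [apply Rmin_l|apply Rmin_r]. }
    assert (Ht3 : t <= tau + 1) by apply Rmin_r.
    rewrite gp_sym in Ht2. rewrite gp_sym in F2.
    pose proof (gp_hyp o (act (U true n) o) (act (inv (f i1 true)) o) y t) as G1.
    pose proof (gp_hyp o (act (U true n) o) y (act (inv (f i2 false)) o) (t - delta)) as G2.
    pose proof (gp_hyp o (act (U true n) o) (act (inv (f i2 false)) o) (act (U false n) o) (t - 2 * delta)) as G3.
    lra. }
  destruct Hi as [i Hi], Hj as [j Hj]. exists (f i j). split; [split|easy].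
  - destruct (Hf i j) as [F _]. pose proof (gp_le_r o (act (U i n) o) (act (f i j) o)). lra.
  - exact (HK i j).
Qed.

(** The first two clauses make every sequence of [Good] elements a chain whose step length is the
    one required for linear growth. The third turns any long element into a [Good] one by factors of
    bounded length, with lengths additive up to [c]. *)
Definition wrapping (tau K c : R) (Good : G -> Prop) : Prop :=
  (forall g g', Good g -> Good g' -> gp o (act (inv g) o) (act g' o) <= tau) /\
  (forall g, Good g -> 2 * tau + 4 * delta + 1 <= len g) /\
  forall w, K <= len w -> exists r s, len r <= K /\ len s <= K /\ Good (mul r (mul w s)) /\
    len r + len w + len s - c <= len (mul r (mul w s)).

(* Good elements are those that leave o in the direction of h o and arrive from that of f0^-1 o, where
   these two directions are transverse. *)
Lemma wrapping_exists : exists tau K c Good, 0 <= tau /\ 0 <= K /\ wrapping tau K c Good.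
Proof.
  pose proof delta_nonneg as Hdl.
  destruct extension as (t0 & Ht0 & Hext).
  (* [tau] is the bound of [chain_gp] for turns [t0]. After the loss [tau] that defines [T], enough
     of [D] remains for two [delta] comparisons and for the step length
     [2 * tau + 4 * delta + 1]. *)
  set (tau := t0 + 2 * delta). set (D := 4 * tau + 10 * delta + 2).
  destruct (Hext D) as [K HK].
  (* [f0] is arbitrary; [h] leaves transversally to [act (inv f0) o], so that one good element can
     follow another. *)
  destruct (HK o o) as (f0 & Hf0 & _). destruct (HK (act (inv f0) o) o) as (h & Hh0 & Hfh & _).
  set (T := D - tau).
  (* [2 * Rmax D K] bounds the lengths of [h p] and [q f0] and makes [w] long enough for the chain;
     [4 * tau] is the loss at the two vertices enclosing [w]. *)
  exists tau, (2 * Rmax D K), (4 * tau),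
    (fun g => T <= gp o (act h o) (act g o) /\ T <= gp o (act (inv f0) o) (act (inv g) o)).
  pose proof (Rmax_l D K) as HmD. pose proof (Rmax_r D K) as HmK.
  split; [unfold tau; lra|]. split; [unfold D, tau in *; lra|]. split; [|split].
  - intros g g' [_ H1] [H2 _].
    assert (H3 : gp o (act (inv g) o) (act h o) <= t0 + delta).
    { apply (gp_hyp_lt o (act (inv f0) o) _ _ T); unfold T, D, tau in *; lra. }
    rewrite gp_sym in H3.
    assert (H4 : gp o (act g' o) (act (inv g) o) <= t0 + delta + delta).
    { apply (gp_hyp_lt o (act h o) _ _ T); unfold T, D, tau in *; lra. }
    rewrite gp_sym in H4. unfold tau. lra.
  - intros g [H _]. pose proof (gp_le_r o (act h o) (act g o)). unfold T, D, tau in *; lra.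
  - intros w Hw.
    assert (HwD : D <= len w) by (unfold D, tau in *; lra).
    (* The word is [h p w q f0]: [p] joins [h] to [w], and [q] joins [w] to [f0]. *)
    destruct (HK (act (inv h) o) (act w o)) as (p & Hp & Hhp & Hpw).
    destruct (HK (act (inv w) o) (act f0 o)) as (q & Hq & Hwq & Hqf).
    set (c := fun i => nth i (h :: p :: w :: q :: f0 :: nil) e).
    assert (Hch : chain d t0 D (fun n => act (pprod c n) o) 5).
    { apply prod_chain.
      - intros [|[|[|[|i]]]] Hi; simpl; assumption || lia.
      - intros [|[|[|[|[|i]]]]] Hi; unfold c; simpl; lra || lia. }
    assert (HD : 2 * t0 + 3 * delta < D) by (unfold D, tau; lra).
    pose proof (chain_gp t0 D _ 5 Ht0 HD Hch 0 1 5 ltac:(lia) ltac:(lia) ltac:(lia)) as C1.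
    pose proof (chain_gp t0 D _ 5 Ht0 HD Hch 0 4 5 ltac:(lia) ltac:(lia) ltac:(lia)) as C2.
    pose proof (chain_dist t0 D _ 5 Ht0 HD Hch 0 2 5 ltac:(lia) ltac:(lia) ltac:(lia)) as C3.
    pose proof (chain_dist t0 D _ 5 Ht0 HD Hch 2 3 5 ltac:(lia) ltac:(lia) ltac:(lia)) as C4.
    fold tau in C1, C2, C3, C4. unfold c in C1, C2, C3, C4. simpl in C1, C2, C3, C4.
    rewrite !(mul_e_l (e := e)), (act_e (e := e)) in *.
    set (g := mul (mul h p) (mul w (mul q f0))).
    assert (Eg : mul (mul (mul (mul h p) w) q) f0 = g) by (unfold g; now rewrite !mul_assoc).
    rewrite Eg in *.
    exists (mul h p), (mul q f0). fold g.
    pose proof (len_mul (o := o) h p). pose proof (len_mul (o := o) q f0).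
    split; [lra|split; [lra|split; [split|]]].
    + pose proof (gp_complement o (act h o) (act g o)). unfold T; lra.
    + pose proof (gp_complement (act g o) (act (mul (mul (mul h p) w) q) o) o) as H1.
      rewrite (gp_sym (act (mul (mul (mul h p) w) q) o)) in H1.
      assert (E1 : act (inv g) (act (mul (mul (mul h p) w) q) o) = act (inv f0) o).
      { rewrite <- Eg at 1. rewrite <- (act_inv_r f0 o) at 1.
        rewrite <- (act_mul _ f0). apply act_inv_l. }
      assert (E2 : d (act g o) (act (mul (mul (mul h p) w) q) o) = len f0).
      { rewrite <- Eg at 1. now rewrite (act_mul _ f0), act_isom, d_sym. }
      rewrite <- E1, <- (gp_act g), !act_inv_r.
      unfold T. lra.
    + assert (E1 : d (act (mul h p) o) (act (mul (mul h p) w) o) = len w).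
      { now rewrite (act_mul (mul h p) w), act_isom. }
      assert (E2 : d (act (mul (mul h p) w) o) (act g o) = len (mul q f0)).
      { unfold g. now rewrite (mul_assoc (mul h p)), (act_mul (mul (mul h p) w)), act_isom. }
      lra.
Qed.

End Extension.

(** * Conical and Myrberg points *)

Section LimitPoints.

Context {X : Type} {d : X -> X -> R} {delta : R} {Hd : metric d} {Hh : hyperbolic d delta}.
Context (Hproper : proper_space d) (Hgeod : geodesic_space d).
Context {G : Type} {mul : G -> G -> G} {inv : G -> G} {e : G} {act : G -> X -> X}.
Context {HG : proper_isometric_action d mul inv e act} {o : X}.

Local Notation gp := (gromov_product d).
Local Notation conv := (conv_infty X d o).
Local Notation bd := (bpoint X d o).
Local Notation "x ~> xi" := (conv_to_bd X d o x xi) (at level 70).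
Local Notation len g := (d o (act g o)).
Local Notation pprod := (partial_prod mul e).

Lemma geod_ray_exists (xi : bd) : exists g, geod_ray X d o g xi.
Proof.
  destruct (to_bd_inhabited xi) as [x Hx].
  destruct (ray_exists Hproper Hgeod x (to_bd_conv _ _ Hx)) as (g & H0 & H1 & H2).
  exists g; split; [exact H0|split; [exact H1|]]. now apply (equiv_to_bd x).
Qed.

(** [p] and the point of the ray at the same distance [t] from [o] are both seen in the direction of
    [xi]; equal distances turn their large product into a small distance. *)
Lemma near_ray (p : X) (x : nat -> X) (xi : bd) (g : R -> X) (c : R) (M : nat) :
  0 <= c -> geod_ray X d o g xi -> x ~> xi ->
  (forall j, (M <= j)%nat -> d o p - c <= gp o p (x j)) ->
  exists t, 0 <= t /\ d p (g t) <= 2 * c + 4 * delta.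
Proof.
  intros Hc (G0 & G1 & G2) Hx H. pose proof delta_nonneg as Hdl.
  set (t := d o p). pose proof (d_pos o p) as Ht. fold t in Ht.
  destruct (to_bd_equiv _ _ _ Hx G2 t) as [M1 H1]. destruct (INR_unbounded t) as [M2 H2].
  set (j := Nat.max M (Nat.max M1 M2)).
  specialize (H j ltac:(lia)). specialize (H1 j j ltac:(lia) ltac:(lia)). cbv beta in H1. fold t in H.
  assert (Hj : t <= INR j). { assert (INR M2 <= INR j) by (apply le_INR; lia). lra. }
  exists t; split; [exact Ht|].
  assert (Hray : gp o (g (INR j)) (g t) = t).
  { pose proof (G1 0 (INR j) ltac:(lra) ltac:(lra)) as D1. pose proof (G1 0 t ltac:(lra) ltac:(lra)) as D2.
    pose proof (G1 (INR j) t ltac:(lra) ltac:(lra)) as D3.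
    rewrite G0, Rabs_left1 in D1, D2 by lra. rewrite Rabs_pos_eq in D3 by lra.
    unfold gromov_product. lra. }
  assert (Ht2 : d o (g t) = t).
  { rewrite <- G0 at 1. rewrite G1, Rabs_left1; lra. }
  pose proof (gp_hyp o p (x j) (g (INR j)) (t - c)) as A1.
  pose proof (gp_hyp o p (g (INR j)) (g t) (t - c - delta)) as A2.
  assert (A3 : t - c - 2 * delta <= gp o p (g t)) by lra.
  unfold gromov_product in A3. rewrite Ht2 in A3. fold t in A3. lra.
Qed.

(* If g_n o -> a and g_n xi -> b with a <> b, then a geodesic from g_n o to g_n xi passes near o, so a
   ray from o to xi passes near g_n^-1 o. *)
Lemma myrberg_conical (xi : bd) : non_elementary X d o G act ->
  myrberg_limit_set X d o G act xi -> conical_limit_set X d o G act xi.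
Proof.
  intros (a & b & _ & La & Lb & _ & Hab & _) [Hlim HM]. split; [exact Hlim|].
  pose proof delta_nonneg as Hdl.
  destruct (HM a b La Lb Hab) as (gs & Ha & Hb).
  destruct (to_bd_inhabited b) as [y Hy].
  destruct (bpoint_separated _ _ _ _ Ha Hy Hab) as (K0 & M0 & HK0).
  set (K := Rmax 0 K0). pose proof (Rmax_l 0 K0) as HKa. pose proof (Rmax_r 0 K0) as HKb. fold K in HKa, HKb.
  destruct (Hb (K + 3 * delta + 1)) as [N HN].
  destruct (geod_ray_exists xi) as [g Hg].
  destruct (to_bd_inhabited xi) as [x Hx].
  assert (Hnear : forall n, (Nat.max N M0 <= n)%nat -> exists M, forall j, (M <= j)%nat ->
    d o (act (inv (gs n)) o) - (K + delta) <= gp o (act (inv (gs n)) o) (x j)).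
  { intros n Hn. destruct (HN n ltac:(lia)) as (z & y' & (Hz & x' & Hx' & Hzx) & Hy' & M1 & H1).
    pose proof (seq_equiv_trans _ _ _ Hzx (seq_equiv_act (gs n) _ _ (to_bd_equiv _ _ _ Hx' Hx))) as Hzx2.
    destruct (Hzx2 (K + 3 * delta + 1)) as [M2 H2].
    destruct (to_bd_equiv _ _ _ Hy' Hy (K + 3 * delta + 1)) as [M3 H3].
    exists (Nat.max M0 (Nat.max M1 (Nat.max M2 M3))). intros j Hj.
    specialize (H1 j j ltac:(lia) ltac:(lia)). specialize (H2 j j ltac:(lia) ltac:(lia)).
    specialize (H3 j j ltac:(lia) ltac:(lia)). specialize (HK0 n j ltac:(lia) ltac:(lia)). cbv beta in *.
    (* What remains is to bound the product of [act (gs n) o] and [act (gs n) (x j)]: the former is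
       transverse to [b], and the latter is close to [b] through [y], [y'] and [z]. *)
    rewrite gp_inv_complement, len_inv.
    rewrite gp_sym in H1, H3.
    pose proof (gp_hyp o (y j) (y' j) (z j) (K + 3 * delta + 1)) as A1.
    pose proof (gp_hyp o (y j) (z j) (act (gs n) (x j)) (K + 2 * delta + 1)) as A2.
    rewrite gp_sym in HK0.
    pose proof (gp_hyp_lt o (y j) (act (gs n) (x j)) (act (gs n) o) (K + delta + 1) K) as A3.
    rewrite (gp_sym o (act (gs n) o)). lra. }
  set (h := fun n => inv (gs (n + Nat.max N M0)%nat)).
  exists h, (2 * (K + delta) + 4 * delta + 1), g. split; [lra|]. split; [|split; [exact Hg|]].
  - apply (equiv_to_bd x _ xi Hx). apply seq_equiv_sym. intros L.
    destruct (to_bd_conv _ _ Hx (L + delta)) as [M1 H1].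
    destruct (conv_far _ (to_bd_conv _ _ Ha) (L + K + 2 * delta)) as [M2 H2].
    exists (Nat.max M1 M2). intros i j Hi Hj.
    destruct (Hnear (i + Nat.max N M0)%nat ltac:(lia)) as [M3 H3]. fold (h i) in H3.
    set (k := Nat.max M1 M3). specialize (H1 k j ltac:(lia) ltac:(lia)). specialize (H3 k ltac:(lia)).
    specialize (H2 (i + Nat.max N M0)%nat ltac:(lia)). cbv beta in H2. rewrite <- len_inv in H2. fold (h i) in H2.
    pose proof (gp_hyp o (act (h i) o) (x k) (x j) (L + delta)). lra.
  - intros n. destruct (Hnear (n + Nat.max N M0)%nat ltac:(lia)) as [M3 H3]. fold (h n) in H3.
    destruct (near_ray _ x xi g (K + delta) M3 ltac:(lra) Hg Hx H3) as (t & Ht & Hdt).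
    exists t; split; [exact Ht|]. lra.
Qed.

Context (tau K c0 : R) (Good : G -> Prop) (Htau : 0 <= tau)
  (Hwrap : wrapping (mul := mul) (inv := inv) (o := o) (d := d) (delta := delta) (act := act) tau K c0 Good).

(** * Infinite products of good elements *)

Section Branch.

Context (c : nat -> G) (Hc : forall n, Good (c n)).

Local Notation y := (fun n => act (pprod c n) o).

Lemma branch_chain (N : nat) : chain d tau (2 * tau + 4 * delta + 1) y N.
Proof. apply prod_chain; intros; now apply Hwrap. Qed.

Lemma branch_gp (m k n : nat) : (m <= k)%nat -> (k <= n)%nat -> gp (y k) (y m) (y n) <= tau + 2 * delta.
Proof.
  intros H1 H2. pose proof delta_nonneg as Hdl.
  apply (chain_gp tau (2 * tau + 4 * delta + 1) y n); try lra; try assumption; [apply branch_chain|lia].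
Qed.

Lemma branch_len (n : nat) : INR n <= d o (y n).
Proof.
  pose proof (chain_growth tau _ y n Htau (Rle_refl _) (branch_chain n) 0 n ltac:(lia) ltac:(lia)) as H.
  rewrite Nat.sub_0_r in H. simpl in H. now rewrite (act_e (e := e) (act := act)) in H.
Qed.

Lemma branch_toward (n m : nat) : (n <= m)%nat -> d o (y n) - (tau + 2 * delta) <= gp o (y n) (y m).
Proof.
  intros Hnm. pose proof (branch_gp 0 n m ltac:(lia) Hnm) as H. simpl in H.
  rewrite (act_e (e := e) (act := act)) in H. pose proof (gp_complement o (y n) (y m)) as H1. cbv beta in H1. lra.
Qed.

Lemma branch_conv : conv y.
Proof.
  intros L. destruct (INR_unbounded (L + tau + 2 * delta)) as [N HN].
  assert (H : forall i j, (N <= i)%nat -> (i <= j)%nat -> L <= gp o (y i) (y j)).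
  { intros i j Hi Hij. pose proof (branch_toward i j Hij). pose proof (branch_len i).
    assert (INR N <= INR i) by (apply le_INR; lia). lra. }
  exists N. intros i j Hi Hj. destruct (Nat.le_ge_cases i j); [now apply H|].
  rewrite gp_sym. now apply H.
Qed.

Lemma branch_limit_set (xi : bd) : y ~> xi -> limit_set X d o G act xi.
Proof. intros H. now exists (pprod c). Qed.

Lemma branch_uniformly_conical (xi : bd) (B : R) : y ~> xi -> (forall n, len (c n) <= B) ->
  uniformly_conical_limit_set X d o G act xi.
Proof.
  intros Hxi HB. split; [now apply branch_limit_set|]. pose proof delta_nonneg as Hdl.
  destruct (geod_ray_exists xi) as [g Hg].
  exists (pprod c), (2 * (tau + 2 * delta) + 4 * delta + 1), g.
  split; [lra|]. split; [exact Hxi|]. split; [exact Hg|]. split.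
  - intros n. destruct (near_ray (y n) y xi g (tau + 2 * delta) n ltac:(lra) Hg Hxi) as (t & Ht & Hdt).
    { intros j Hj. now apply branch_toward. }
    exists t; split; [exact Ht|]. lra.
  - exists B. intros n. simpl. rewrite act_mul, act_isom. apply HB.
Qed.

(** From [q], the point [z] is seen in the direction of [o], since [gp o q z] is small. As [p] lies
    opposite to [z] at [q], it also lies opposite to [o], and the way from [o] to [p] runs close to
    [q]. *)
Lemma behind_point (p q z : X) (c1 kappa : R) :
  gp q p z <= c1 -> gp o q z <= kappa -> kappa + c1 + delta < d o q ->
  d o q - c1 - delta <= gp o q p.
Proof.
  intros H1 H2 H3. pose proof (gp_complement o q z). pose proof (gp_complement o q p).
  rewrite gp_sym in H1. rewrite (gp_sym q o z) in *.
  pose proof (gp_hyp_lt q z o p (d o q - kappa) c1). lra.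
Qed.

(* The branch follows y_n r w s with w = u_k^-1 v_k; moving y_n r o to u_k o puts o behind u_k o and the
   endpoint behind v_k o, as seen from o. *)
Lemma branch_myrberg (xi : bd) : y ~> xi ->
  (forall w, K <= len w -> exists n r s, c n = mul r (mul w s) /\
     len r + len w + len s - c0 <= len (c n)) ->
  myrberg_limit_set X d o G act xi.
Proof.
  intros Hxi Hins. split; [now apply branch_limit_set|].
  intros a b [u Hu] [v Hv] Hab. pose proof delta_nonneg as Hdl.
  destruct (bpoint_separated _ _ _ _ Hu Hv Hab) as (kap & M0 & Hkap).
  (* Along [o], [y n], [P1], [P2], [y (S n)], [y m] the lengths add up with an error of
     [2 * (tau + 2 * delta)] at each of [y n] and [y (S n)], and of [c0] inside the letter; a
     product is half of such a defect. *)
  set (c1 := (4 * (tau + 2 * delta) + c0) / 2).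
  set (mv k g := exists n, forall m, (n <= m)%nat ->
     gp (act (u k) o) (act g o) (act (v k) o) <= c1 /\
     gp (act (v k) o) (act g (y m)) (act (u k) o) <= c1).
  (* The points [act (u k) o] and [act (v k) o] are at distance at least [len (u k) - 2 * kap], so
     from [M1] on the word [w] below is long enough to occur in the branch. *)
  destruct (conv_far _ (to_bd_conv _ _ Hu) (K + 2 * kap)) as [M1 H1].
  assert (Hmv : forall k, exists g, (Nat.max M0 M1 <= k)%nat -> mv k g).
  { intros k. destruct (le_dec (Nat.max M0 M1) k) as [Hk|Hk]; [|now exists e].
    specialize (Hkap k k ltac:(lia) ltac:(lia)). specialize (H1 k ltac:(lia)). cbv beta in Hkap, H1.
    set (w := mul (inv (u k)) (v k)).
    assert (Hw : len w = d (act (u k) o) (act (v k) o)).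
    { unfold w. now rewrite act_mul, <- (act_isom (u k)), act_inv_r. }
    assert (HKw : K <= len w).
    { rewrite Hw. unfold gromov_product in Hkap. pose proof (d_pos o (act (v k) o)). lra. }
    destruct (Hins w HKw) as (n & r & s & Hcn & Hlen).
    set (p := mul (pprod c n) r). exists (mul (u k) (inv p)). intros _. exists (S n). intros m Hm.
    set (P1 := act p o). set (P2 := act p (act w o)).
    assert (E1 : act (mul (u k) (inv p)) P1 = act (u k) o).
    { unfold P1. now rewrite act_mul, act_inv_l. }
    assert (E2 : act (mul (u k) (inv p)) P2 = act (v k) o).
    { unfold P2, w. now rewrite act_mul, act_inv_l, act_mul, act_inv_r. }
    rewrite <- E1, <- E2. rewrite !gp_act.
    pose proof (branch_gp 0 n m ltac:(lia) ltac:(lia)) as B1.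
    pose proof (branch_gp n (S n) m ltac:(lia) ltac:(lia)) as B2. cbv beta in B1, B2.
    change (pprod c 0) with e in B1. rewrite (act_e (e := e) (act := act)) in B1.
    assert (F1 : d (act (pprod c n) o) (act (pprod c (S n)) o) = len (c n)).
    { simpl. now rewrite act_mul, act_isom. }
    assert (F2 : d (act (pprod c n) o) P1 = len r).
    { unfold P1, p. now rewrite act_mul, act_isom. }
    assert (F3 : d P1 P2 = len w) by apply act_isom.
    assert (F4 : d P2 (act (pprod c (S n)) o) = len s).
    { unfold P2, p. simpl. rewrite Hcn, <- (act_mul _ w), <- !mul_assoc.
      now rewrite !mul_assoc, (act_mul _ s), act_isom. }
    unfold gromov_product in B1, B2. rewrite (d_sym (act (pprod c (S n)) o) (act (pprod c n) o)) in B2.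
    rewrite (d_sym (act (pprod c n) o) o) in B1.
    pose proof (d_tri o (act (pprod c n) o) P1) as T1.
    pose proof (d_tri P2 (act (pprod c (S n)) o) (act (pprod c m) o)) as T2.
    pose proof (d_tri o P2 (act (pprod c m) o)) as T3.
    pose proof (d_tri o P1 (act (pprod c m) o)) as T4.
    unfold gromov_product, c1. rewrite (d_sym P2 P1), (d_sym P1 o), (d_sym (act (pprod c m) o) P1).
    split; lra. }
  destruct (choice _ Hmv) as [gs Hgs]. clear Hmv.
  exists gs.
  assert (Hback : forall k, (Nat.max M0 M1 <= k)%nat -> kap + c1 + delta < len (u k) ->
    len (u k) - c1 - delta <= gp o (act (u k) o) (act (gs k) o)).
  { intros k Hk Hl. destruct (Hgs k Hk) as [n Hn]. specialize (Hkap k k ltac:(lia) ltac:(lia)).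
    apply (behind_point _ _ (act (v k) o) c1 kap); [now apply (Hn n)|exact Hkap|exact Hl]. }
  assert (Hfront : forall k, (Nat.max M0 M1 <= k)%nat -> kap + c1 + delta < len (v k) ->
    exists n, forall m, (n <= m)%nat ->
      len (v k) - c1 - delta <= gp o (act (v k) o) (act (gs k) (y m))).
  { intros k Hk Hl. destruct (Hgs k Hk) as [n Hn]. exists n. intros m Hm.
    specialize (Hkap k k ltac:(lia) ltac:(lia)). cbv beta in Hkap. rewrite gp_sym in Hkap.
    apply (behind_point _ _ (act (u k) o) c1 kap); [now apply Hn|exact Hkap|exact Hl]. }
  split.
  - apply (equiv_to_bd _ _ a Hu), seq_equiv_of_diag; [exact (to_bd_conv _ _ Hu)|].
    intros L. pose proof (Rle_abs L) as R1. pose proof (Rle_abs kap) as R2. pose proof (Rabs_pos L) as R3. pose proof (Rabs_pos kap) as R4.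
    destruct (conv_far _ (to_bd_conv _ _ Hu) (Rabs L + Rabs kap + c1 + delta + 1)) as [M2 H2].
    exists (Nat.max M2 (Nat.max M0 M1)). intros k Hk. specialize (H2 k ltac:(lia)). cbv beta in H2.
    specialize (Hback k ltac:(lia)). lra.
  - intros L. pose proof (Rle_abs L) as R1. pose proof (Rle_abs kap) as R2. pose proof (Rabs_pos L) as R3. pose proof (Rabs_pos kap) as R4.
    destruct (conv_far _ (to_bd_conv _ _ Hv) (Rabs L + Rabs kap + c1 + 2 * delta + 1)) as [M2 H2].
    destruct (to_bd_conv _ _ Hv (L + delta)) as [M3 H3].
    exists (Nat.max (Nat.max M2 M3) (Nat.max M0 M1)). intros k Hk.
    specialize (H2 k ltac:(lia)). cbv beta in H2.
    destruct (Hfront k ltac:(lia)) as [n Hn]; [lra|].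
    exists (fun m => act (gs k) (y m)), (fun i => act (v i) o). split; [|split; [exact Hv|]].
    + split; [apply (seq_equiv_act (gs k)), branch_conv|].
      exists y; split; [exact Hxi|]. apply (seq_equiv_act (gs k)), branch_conv.
    + exists (Nat.max n M3). intros i j Hi Hj. specialize (Hn i ltac:(lia)).
      specialize (H3 k j ltac:(lia) ltac:(lia)). cbv beta in H3. rewrite gp_sym in Hn.
      pose proof (gp_hyp o (act (gs k) (y i)) (act (v k) o) (act (v j) o) (L + delta)) as A. cbv beta in A. lra.
Qed.

End Branch.

Lemma prod_agree (c c' : nat -> G) (n : nat) : agree c c' n ->
  pprod c n = pprod c' n.
Proof.
  induction n as [|n IH]; intros H; [reflexivity|]. simpl.
  rewrite IH, (H n) by (lia || (intros k Hk; apply H; lia)). reflexivity.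
Qed.

(** Seen from the last common vertex [q], each branch passes near the end of its next letter. A
    product above [len (pprod c n) + l] at [o] would be at least [l] at [q], so the two letters
    would run together for length [l - W - tau - 4 * delta]; both being at most [l] long, their ends
    would be within [2 * (W + tau + 4 * delta)] of each other. *)
Lemma branches_diverge (c c' : nat -> G) (n : nat) (l W : R) :
  (forall n, Good (c n)) -> (forall n, Good (c' n)) -> agree c c' n ->
  l - W <= len (c n) <= l -> l - W <= len (c' n) <= l ->
  2 * (W + tau + 4 * delta) < d (act (c n) o) (act (c' n) o) ->
  forall i j, (S n <= i)%nat -> (S n <= j)%nat ->
    gp o (act (pprod c i) o) (act (pprod c' j) o) <= len (pprod c n) + l.
Proof.
  intros Hc Hc' Hag Hl Hl' Hsep i j Hi Hj. pose proof delta_nonneg as Hdl.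
  pose proof (prod_agree c c' n Hag) as Hp.
  pose proof (branch_gp c Hc n (S n) i ltac:(lia) Hi) as B1.
  pose proof (branch_gp c' Hc' n (S n) j ltac:(lia) Hj) as B2. cbv beta in B1, B2.
  rewrite <- Hp in B2.
  assert (F1 : d (act (pprod c n) o) (act (pprod c (S n)) o) = len (c n)).
  { simpl. now rewrite act_mul, act_isom. }
  assert (F2 : d (act (pprod c n) o) (act (pprod c' (S n)) o) = len (c' n)).
  { simpl. now rewrite <- Hp, act_mul, act_isom. }
  assert (F3 : d (act (pprod c (S n)) o) (act (pprod c' (S n)) o) = d (act (c n) o) (act (c' n) o)).
  { simpl. now rewrite <- Hp, !act_mul, act_isom. }
  set (q := act (pprod c n) o) in *.
  pose proof (gp_complement q (act (pprod c (S n)) o) (act (pprod c i) o)) as C1.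
  pose proof (gp_complement q (act (pprod c' (S n)) o) (act (pprod c' j) o)) as C2.
  pose proof (gp_base o q (act (pprod c i) o) (act (pprod c' j) o)) as C3.
  apply Rnot_lt_le; intros Hlt.
  rewrite (gp_sym q (act (pprod c' (S n)) o)) in C2.
  assert (A0 : l <= gp q (act (pprod c i) o) (act (pprod c' j) o)) by lra.
  pose proof (gp_hyp q (act (pprod c (S n)) o) (act (pprod c i) o) (act (pprod c' j) o) (l - W - tau - 2 * delta)) as A1.
  pose proof (gp_hyp q (act (pprod c (S n)) o) (act (pprod c' j) o) (act (pprod c' (S n)) o) (l - W - tau - 3 * delta)) as A2.
  assert (HW : 0 <= W) by lra.
  assert (A3 : l - W - tau - 4 * delta <= gp q (act (pprod c (S n)) o) (act (pprod c' (S n)) o)) by lra.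
  unfold gromov_product in A3. lra.
Qed.

End LimitPoints.

(** * Orbit growth *)

Section FiniteCounting.

Context {T : Type}.

Definition keep (P : T -> Prop) (l : list T) : list T :=
  filter (fun t => if excluded_middle_informative (P t) then true else false) l.

Lemma keep_In (P : T -> Prop) (l : list T) (t : T) : In t (keep P l) <-> In t l /\ P t.
Proof.
  unfold keep. rewrite filter_In. destruct (excluded_middle_informative (P t)); intuition congruence.
Qed.

Lemma keep_NoDup (P : T -> Prop) (l : list T) : NoDup l -> NoDup (keep P l).
Proof. apply NoDup_filter. Qed.

Lemma keep_split (P : T -> Prop) (l : list T) :
  length l = (length (keep P l) + length (keep (fun t => ~ P t) l))%nat.
Proof.
  unfold keep. induction l as [|a l IH]; simpl; [reflexivity|].
  destruct (excluded_middle_informative (P a)), (excluded_middle_informative (~ P a)); simpl; tauto || lia.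
Qed.

Lemma finite_has_card (P : T -> Prop) : finite_set P -> has_card P (card P).
Proof.
  intros [l Hl]. unfold card. apply epsilon_spec.
  set (l' := nodup (fun x y => excluded_middle_informative (x = y)) (keep P l)).
  exists (length l'), l'. split; [apply NoDup_nodup|split; [|reflexivity]].
  intros t. unfold l'. rewrite nodup_In, keep_In. split; [tauto|]. intros H; split; [now apply Hl|exact H].
Qed.

Lemma list_pigeonhole (f : T -> nat) (n : nat) (l : list T) : (forall t, In t l -> (f t <= n)%nat) ->
  exists k, (k <= n)%nat /\ (length l <= S n * length (keep (fun t => f t = k) l))%nat.
Proof.
  revert l. induction n as [|n IH]; intros l Hl.
  - exists 0%nat; split; [lia|]. rewrite (keep_split (fun t => f t = 0%nat) l).
    assert (E : keep (fun t => f t <> 0%nat) l = nil).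
    { destruct (keep (fun t => f t <> 0%nat) l) as [|a m] eqn:Ea; [reflexivity|]. exfalso.
      assert (Ha : In a (keep (fun t => f t <> 0%nat) l)) by (rewrite Ea; now left).
      apply keep_In in Ha. specialize (Hl a (proj1 Ha)). lia. }
    rewrite E. simpl. lia.
  - destruct (IH (keep (fun t => f t <> S n) l)) as (k & Hk & Hlen).
    { intros t Ht. apply keep_In in Ht. specialize (Hl t (proj1 Ht)). lia. }
    pose proof (keep_split (fun t => f t = S n) l) as Hs.
    assert (Hsub : (length (keep (fun t => f t = k) (keep (fun t => f t <> S n) l))
      <= length (keep (fun t => f t = k) l))%nat).
    { unfold keep. clear. induction l as [|a l IH]; simpl; [lia|].
      destruct (excluded_middle_informative (f a <> S n)); simpl;
        destruct (excluded_middle_informative (f a = k)); simpl; lia. }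
    destruct (Nat.le_gt_cases (length (keep (fun t => f t = k) l)) (length (keep (fun t => f t = S n) l))).
    + exists (S n); split; [lia|]. nia.
    + exists k; split; [lia|]. nia.
Qed.

(** Greedy choice: keep the head, discard its at most [V] relatives, repeat. *)
Lemma separated_sublist (Rel : T -> T -> Prop) (V : nat) (l : list T) :
  (forall a, Rel a a) -> (forall a b, Rel a b -> Rel b a) -> NoDup l ->
  (forall a, In a l -> exists lv, (length lv <= V)%nat /\ forall b, In b l -> Rel a b -> In b lv) ->
  exists l', NoDup l' /\ incl l' l /\ (forall a b, In a l' -> In b l' -> a <> b -> ~ Rel a b) /\
    (length l <= V * length l')%nat.
Proof.
  intros Hrefl Hsym.
  assert (H : forall n l, (length l <= n)%nat -> NoDup l ->
    (forall a, In a l -> exists lv, (length lv <= V)%nat /\ forall b, In b l -> Rel a b -> In b lv) ->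
    exists l', NoDup l' /\ incl l' l /\ (forall a b, In a l' -> In b l' -> a <> b -> ~ Rel a b) /\
      (length l <= V * length l')%nat).
  { clear l. induction n as [|n IH]; intros l Hn Hl HV.
    - destruct l; [|simpl in Hn; lia]. exists nil. repeat split; easy || constructor || simpl; lia.
    - destruct l as [|a l]; [exists nil; repeat split; easy || constructor || simpl; lia|].
      set (l2 := keep (fun b => ~ Rel a b) (a :: l)).
      pose proof (keep_split (Rel a) (a :: l)) as Hs. fold l2 in Hs.
      assert (H1 : (length (keep (Rel a) (a :: l)) <= V)%nat).
      { destruct (HV a (or_introl eq_refl)) as (lv & Hlv & Hin).
        eapply Nat.le_trans; [|exact Hlv]. apply NoDup_incl_length; [now apply keep_NoDup|].
        intros b Hb. apply keep_In in Hb. now apply Hin. }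
      assert (H2 : (1 <= length (keep (Rel a) (a :: l)))%nat).
      { assert (Ha : In a (keep (Rel a) (a :: l))) by (apply keep_In; split; [now left|apply Hrefl]).
        destruct (keep (Rel a) (a :: l)); [easy|simpl; lia]. }
      destruct (IH l2) as (l' & N' & I' & S' & L').
      { lia. }
      { now apply keep_NoDup. }
      { intros b Hb. apply keep_In in Hb. destruct (HV b (proj1 Hb)) as (lv & Hlv & Hin).
        exists lv; split; [exact Hlv|]. intros x Hx. apply keep_In in Hx. now apply Hin. }
      assert (Ha' : forall b, In b l' -> ~ Rel a b).
      { intros b Hb. apply I', keep_In in Hb. tauto. }
      exists (a :: l'). repeat split.
      + constructor; [|exact N']. intros Ha. exact (Ha' a Ha (Hrefl a)).
      + intros b [<-|Hb]; [now left|]. apply I', keep_In in Hb. tauto.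
      + intros x y [<-|Hx] [<-|Hy] Hxy; [easy|now apply Ha'| |now apply S'].
        intros Hr. now apply (Ha' x Hx), Hsym.
      + change (length (a :: l')) with (S (length l')). rewrite Nat.mul_succ_r. lia. }
  intros Hl. now apply (H (length l)).
Qed.

End FiniteCounting.

Lemma exp_ge_sqr (x : R) : 0 <= x -> x * x / 4 <= exp x.
Proof.
  intros Hx. replace x with (x / 2 + x / 2) at 3 by lra. rewrite exp_plus.
  pose proof (exp_ineq1_le (x / 2)). nra.
Qed.

Lemma exp_beats_linear (eta C : R) : 0 < eta -> 0 <= C ->
  exists N, forall n, (N <= n)%nat -> C * (INR n + 1) <= exp (eta * INR n).
Proof.
  intros He HC. destruct (INR_unbounded (8 * C / (eta * eta))) as [N HN].
  exists (S N). intros n Hn.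
  assert (H1 : 1 <= INR n) by (change 1 with (INR 1); apply le_INR; lia).
  assert (H2 : 8 * C / (eta * eta) <= INR n).
  { assert (INR N <= INR n) by (apply le_INR; lia). lra. }
  assert (H3 : 8 * C <= eta * eta * INR n).
  { apply (Rmult_le_compat_l (eta * eta)) in H2; [|nra].
    replace (eta * eta * (8 * C / (eta * eta))) with (8 * C) in H2 by (field; lra). exact H2. }
  eapply Rle_trans; [|apply exp_ge_sqr; nra]. nra.
Qed.

Section Growth.

Context {X : Type} {d : X -> X -> R} {delta : R} {Hd : metric d} {Hh : hyperbolic d delta}.
Context {G : Type} {mul : G -> G -> G} {inv : G -> G} {e : G} {act : G -> X -> X}.
Context {HG : proper_isometric_action d mul inv e act} {o : X}.

Local Notation len g := (d o (act g o)).
Local Notation count n := (card (fun g => len g <= INR n)).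

Lemma ball_card (n : nat) : has_card (fun g => len g <= INR n) (count n).
Proof. apply finite_has_card. exact (action_proper o (INR n)). Qed.

Lemma count_pos (n : nat) : (1 <= count n)%nat.
Proof.
  destruct (ball_card n) as (l & _ & Hl & <-).
  assert (In e l). { apply Hl. rewrite (act_e (e := e) (act := act)), d_refl. apply pos_INR. }
  destruct l; [easy|simpl; lia].
Qed.

Lemma critical_exponent_gt (s : R) (N : nat) : Rbar_lt s (critical_exponent X d o G act) ->
  exists n, (N <= n)%nat /\ (1 <= n)%nat /\ exp (s * INR n) <= INR (count n).
Proof.
  intros Hs. unfold critical_exponent in Hs.
  set (v := fun n => ln (INR (count n)) / INR n) in *.
  assert (H : exists n, (S N <= n)%nat /\ s < v n).
  { pose proof (proj2_sig (ex_LimSup_seq v)) as Hl. fold (LimSup_seq v) in Hl.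
    destruct (LimSup_seq v) as [q| |]; simpl in *; [|apply Hl|easy].
    destruct (proj1 (Hl (mkposreal (q - s) ltac:(lra))) (S N)) as (n & Hn & Hv). simpl in Hv.
    exists n; split; [exact Hn|lra]. }
  destruct H as (n & Hn & Hv). exists n. split; [lia|split; [lia|]].
  assert (Hn0 : 0 < INR n) by (apply lt_0_INR; lia).
  assert (Hc : 0 < INR (count n)) by (apply lt_0_INR; pose proof (count_pos n); lia).
  rewrite <- (exp_ln (INR (count n))) by exact Hc. apply exp_mono.
  unfold v in Hv. apply (Rmult_lt_compat_r (INR n)) in Hv; [|exact Hn0].
  unfold Rdiv in Hv. rewrite Rmult_assoc, Rinv_l, Rmult_1_r in Hv by lra. lra.
Qed.

Lemma critical_exponent_lt (s : R) : Rbar_lt (critical_exponent X d o G act) s ->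
  exists N, forall n, (N <= n)%nat -> INR (count n) <= exp (s * INR n).
Proof.
  intros Hs. unfold critical_exponent in Hs.
  set (v := fun n => ln (INR (count n)) / INR n) in *.
  assert (H : exists N, forall n, (N <= n)%nat -> v n < s).
  { pose proof (proj2_sig (ex_LimSup_seq v)) as Hl. fold (LimSup_seq v) in Hl.
    destruct (LimSup_seq v) as [q| |]; simpl in *; [|easy|apply Hl].
    destruct (proj2 (Hl (mkposreal (s - q) ltac:(lra)))) as (N & HN). simpl in HN.
    exists N. intros n Hn. specialize (HN n Hn). lra. }
  destruct H as (N & HN). exists (S N). intros n Hn. specialize (HN n ltac:(lia)).
  assert (Hn0 : 0 < INR n) by (apply lt_0_INR; lia).
  assert (Hc : 0 < INR (count n)) by (apply lt_0_INR; pose proof (count_pos n); lia).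
  rewrite <- (exp_ln (INR (count n))) by exact Hc. apply exp_mono.
  unfold v in HN. apply (Rmult_lt_compat_r (INR n)) in HN; [|exact Hn0].
  unfold Rdiv in HN. rewrite Rmult_assoc, Rinv_l, Rmult_1_r in HN by lra. lra.
Qed.

Context (tau K c0 : R) (Good : G -> Prop) (Htau : 0 <= tau)
  (Hwrap : wrapping (mul := mul) (inv := inv) (o := o) (d := d) (delta := delta) (act := act) tau K c0 Good).

Lemma wrap_function : exists wrap : G -> G, forall w, K <= len w ->
  Good (wrap w) /\ exists r s, len r <= K /\ len s <= K /\ wrap w = mul r (mul w s) /\
    len r + len w + len s - c0 <= len (wrap w).
Proof.
  apply (choice (fun w g => K <= len w -> Good g /\ exists r s, len r <= K /\ len s <= K /\
    g = mul r (mul w s) /\ len r + len w + len s - c0 <= len g)).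
  intros w. destruct (Rle_dec K (len w)) as [Hw|Hw]; [|now exists e].
  destruct Hwrap as (_ & _ & H). destruct (H w Hw) as (r & s & Hr & Hs & HG' & Hl).
  exists (mul r (mul w s)). intros _. split; [exact HG'|]. now exists r, s.
Qed.

(** A ball of radius [n] with at least [exp (s2 * INR n)] elements is cut into unit annuli, a
    well-filled one is wrapped, and a separated subset is taken. The number of annuli and the
    multiplicity [V] are absorbed by [s2 - s1]. Wrapping changes lengths by at most [2 K], so the
    annulus becomes a window of width [4 K + 1] below [l = k + 1 + 2 K]. The exponent stays strictly
    above [s0], which is the room that insertions use later. *)
Lemma good_alphabet (sep : R) (s0 : R) : 0 <= sep -> 0 < s0 -> Rbar_lt s0 (critical_exponent X d o G act) ->
  exists (B : list G) (l s : R), NoDup B /\ B <> nil /\ (forall g, In g B -> Good g) /\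
    (forall g, In g B -> l - (4 * K + 1) <= len g <= l) /\
    (forall g g', In g B -> In g' B -> g <> g' -> sep < d (act g o) (act g' o)) /\
    s0 < s /\ 0 < l /\ s * l <= ln (INR (length B)).
Proof.
  intros HS Hs0 Hs.
  assert (Hs12 : exists s1 s2, s0 < s1 /\ s1 < s2 /\ Rbar_lt s2 (critical_exponent X d o G act)).
  { destruct (critical_exponent X d o G act) as [w| |]; simpl in *; [|now exists (s0 + 1), (s0 + 2); lra || (split; [lra|split; [lra|]])|easy].
    exists ((2 * s0 + w) / 3), ((s0 + 2 * w) / 3). lra. }
  destruct Hs12 as (s1 & s2 & Hs1 & Hs2 & Hs3).
  destruct wrap_function as [wrap Hwr].
  destruct (ball_finite (o := o) K) as [LK HLK]. destruct (ball_finite (o := o) sep) as [LS HLS].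
  (* If [wrap b] is within [sep] of [wrap a], then [b] is determined by [a], its two factors and
     [mul (inv (wrap a)) (wrap b)], all from finite balls. The added 1 makes [V] positive. *)
  set (V := (1 + length LK * (length LS * length LK))%nat).
  set (V0 := length LK).
  (* The exponential factor pays for [l] exceeding [n]; [Rabs] appears because [0 <= K] is derived
     only after [B0] is known to be nonempty. *)
  destruct (exp_beats_linear (s2 - s1) (INR V0 + INR V * exp (s1 * (2 + 2 * Rabs K)))) as [N0 HN0].
  { lra. }
  { pose proof (pos_INR V0). pose proof (pos_INR V). pose proof (exp_pos (s1 * (2 + 2 * Rabs K))). nra. }
  destruct (critical_exponent_gt s2 N0 Hs3) as (n & Hn & Hn1 & Hcount).
  specialize (HN0 n Hn).
  destruct (ball_card n) as (Ln & HNDn & HLn & Hlenn).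
  pose proof (keep_split (fun g => K <= len g) Ln) as Hsplit.
  set (L1 := keep (fun g => K <= len g) Ln) in *.
  assert (Hshort : (length (keep (fun g => ~ (K <= len g)%R) Ln) <= V0)%nat).
  { apply NoDup_incl_length; [now apply keep_NoDup|]. intros g Hg. apply keep_In in Hg.
    apply HLK. lra. }
  assert (Hfl : exists fl : G -> nat, forall g, INR (fl g) <= len g < INR (fl g) + 1).
  { apply (choice (fun g k => INR k <= len g < INR k + 1)). intros g.
    destruct (nfloor_ex (len g) (d_pos _ _)) as [k Hk]. now exists k. }
  destruct Hfl as [fl Hfl].
  destruct (list_pigeonhole fl n L1) as (k & Hk & Hpig).
  { intros g Hg. apply keep_In in Hg. destruct Hg as [Hg _]. apply HLn in Hg. specialize (Hfl g).
    assert (Hlt : INR (fl g) < INR (S n)) by (rewrite S_INR; lra). apply INR_lt in Hlt. lia. }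
  set (L2 := keep (fun g => fl g = k) L1) in *.
  assert (HL2 : forall g, In g L2 -> K <= len g /\ INR k <= len g < INR k + 1).
  { intros g Hg. apply keep_In in Hg. destruct Hg as [Hg <-]. apply keep_In in Hg. split; [tauto|apply Hfl]. }
  assert (HND2 : NoDup L2) by now apply keep_NoDup, keep_NoDup.
  destruct (separated_sublist (fun a b => d (act (wrap a) o) (act (wrap b) o) <= sep) V L2)
    as (B0 & HND0 & Hincl & Hsep & HlenB).
  { intros a. rewrite d_refl. exact HS. }
  { intros a b H. now rewrite d_sym. }
  { exact HND2. }
  { intros a Ha.
    exists (map (fun p => mul (fst p) (mul (wrap a) (mul (fst (snd p)) (snd (snd p)))))
      (list_prod LK (list_prod LS LK))). split.
    { rewrite length_map, !length_prod. unfold V. lia. }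
    intros b Hb Hab. apply in_map_iff.
    destruct (Hwr b (proj1 (HL2 b Hb))) as (_ & r & s & Hr & Hs' & Hw & _).
    exists (inv r, (mul (inv (wrap a)) (wrap b), inv s)). simpl. split.
    - rewrite (mul_assoc (wrap a)), mul_cancel_inv_l, Hw. rewrite <- !mul_assoc, mul_inv_cancel_l.
      now rewrite mul_inv_r, mul_e_r.
    - apply in_prod; [apply HLK; now rewrite len_inv|]. apply in_prod; [|apply HLK; now rewrite len_inv].
      apply HLS. rewrite act_mul. now rewrite <- (act_isom (wrap a)), act_inv_r. }
  assert (HB0 : forall g, In g B0 -> K <= len g /\ INR k <= len g < INR k + 1).
  { intros g Hg. now apply HL2, Hincl. }
  assert (Hbig : exp (s1 * (INR n + 2 + 2 * Rabs K)) <= INR (length B0)).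
  { assert (H1 : INR (count n) <= INR V0 + (INR n + 1) * (INR V * INR (length B0))).
    { rewrite <- Hlenn. rewrite <- S_INR, <- !mult_INR, <- plus_INR. apply le_INR. nia. }
    replace (s1 * (INR n + 2 + 2 * Rabs K)) with (s1 * INR n + s1 * (2 + 2 * Rabs K)) by ring.
    rewrite exp_plus. set (E := exp (s1 * (2 + 2 * Rabs K))) in *.
    assert (H2 : exp (s2 * INR n) = exp (s1 * INR n) * exp ((s2 - s1) * INR n)).
    { rewrite <- exp_plus. f_equal. ring. }
    pose proof (pos_INR n) as Pn. pose proof (pos_INR V0) as PV0.
    assert (PV : 1 <= INR V) by (change 1 with (INR 1); apply le_INR; unfold V; lia).
    assert (H3 : 1 <= exp (s1 * INR n)).
    { rewrite <- exp_0. apply exp_mono. nra. }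
    set (F := exp (s1 * INR n)) in *.
    assert (PE : 0 < E) by apply exp_pos.
    assert (H4 : F * ((INR V0 + INR V * E) * (INR n + 1)) <= INR V0 + (INR n + 1) * (INR V * INR (length B0))).
    { eapply Rle_trans; [|exact H1]. eapply Rle_trans; [|exact Hcount]. rewrite H2.
      apply Rmult_le_compat_l; [lra|exact HN0]. }
    assert (H5 : INR V0 <= F * (INR V0 * (INR n + 1))).
    { assert (INR V0 <= INR V0 * (INR n + 1)) by nra. nra. }
    assert (H6 : (INR n + 1) * (INR V * (F * E)) <= (INR n + 1) * (INR V * INR (length B0))) by lra.
    apply Rmult_le_reg_l in H6; [|lra]. apply Rmult_le_reg_l in H6; lra. }
  assert (HlB : 0 < INR (length B0)).
  { eapply Rlt_le_trans; [apply exp_pos|exact Hbig]. }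
  assert (HK0 : 0 <= K).
  { destruct B0 as [|g B0]; [simpl in HlB; lra|].
    destruct (Hwr g (proj1 (HB0 g (or_introl eq_refl)))) as (_ & r & s & Hr & _).
    pose proof (d_pos o (act r o)). lra. }
  assert (Hdist : forall a b, In a B0 -> In b B0 -> a <> b -> sep < d (act (wrap a) o) (act (wrap b) o)).
  { intros a b Ha Hb Hab. apply Rnot_le_lt. now apply Hsep. }
  exists (map wrap B0), (INR k + 1 + 2 * K), s1. repeat split.
  - apply NoDup_map_NoDup_ForallPairs; [|exact HND0]. intros a b Ha Hb Hab.
    apply NNPP; intros Hne. specialize (Hdist a b Ha Hb Hne). rewrite Hab, d_refl in Hdist. lra.
  - destruct B0; [simpl in HlB; lra|easy].
  - intros g Hg. apply in_map_iff in Hg. destruct Hg as (a & <- & Ha). now apply Hwr, HB0.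
  - apply in_map_iff in H. destruct H as (a & <- & Ha).
    destruct (HB0 a Ha) as [Hka Hla]. destruct (Hwr a Hka) as (_ & r & s & Hr & Hs' & Hw & _).
    rewrite Hw. pose proof (len_mul (o := o) (inv r) (mul r (mul a s))) as T1.
    rewrite mul_inv_cancel_l, (len_inv (inv := inv)) in T1.
    pose proof (len_mul (o := o) (mul a s) (inv s)) as T2.
    rewrite <- mul_assoc, mul_inv_r, mul_e_r, (len_inv (inv := inv)) in T2. lra.
  - apply in_map_iff in H. destruct H as (a & <- & Ha).
    destruct (HB0 a Ha) as [Hka Hla]. destruct (Hwr a Hka) as (_ & r & s & Hr & Hs' & Hw & _).
    rewrite Hw. pose proof (len_mul (o := o) r (mul a s)). pose proof (len_mul (o := o) a s). lra.
  - intros g g' Hg Hg' Hne. apply in_map_iff in Hg, Hg'.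
    destruct Hg as (a & <- & Ha), Hg' as (b & <- & Hb). apply Hdist; try assumption. congruence.
  - exact Hs1.
  - pose proof (pos_INR k). lra.
  - rewrite length_map. rewrite <- (ln_exp (s1 * (INR k + 1 + 2 * K))).
    apply Rle_trans with (ln (exp (s1 * (INR n + 2 + 2 * Rabs K)))).
    + rewrite !ln_exp. rewrite Rabs_pos_eq by exact HK0. assert (INR k <= INR n) by (apply le_INR; lia).
      apply Rmult_le_compat_l; lra.
    + apply ln_le; [apply exp_pos|exact Hbig].
Qed.

End Growth.

(** * Cantor sets of limit points *)

(** Sums over indices below [n], to match the product of the first [n] letters; [sum_f_R0] would
    include the index [n]. *)
Fixpoint partial_sum (l : nat -> R) (n : nat) : R :=
  match n with O => 0 | S m => partial_sum l m + l m end.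

Lemma first_disagreement {E : Type} (c c' : nat -> E) (n : nat) :
  ~ agree c c' n -> exists m, (m < n)%nat /\ agree c c' m /\ c m <> c' m.
Proof.
  induction n as [|n IH]; intros H; [exfalso; apply H; intros k Hk; lia|].
  destruct (classic (agree c c' n)) as [Ha|Ha].
  - exists n; split; [lia|split; [exact Ha|]]. intros He. apply H. intros k Hk.
    destruct (Nat.eq_dec k n) as [->|]; [exact He|apply Ha; lia].
  - destruct (IH Ha) as (m & Hm & Hr). exists m; split; [lia|exact Hr].
Qed.

Section LowerBound.

Context {X : Type} {d : X -> X -> R} {delta : R} {Hd : metric d} {Hh : hyperbolic d delta}.
Context (Hproper : proper_space d) (Hgeod : geodesic_space d).
Context {G : Type} {mul : G -> G -> G} {inv : G -> G} {e : G} {act : G -> X -> X}.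
Context {HG : proper_isometric_action d mul inv e act} {o : X}.
Context (rho : bpoint X d o -> bpoint X d o -> R) (eps : R) (Heps : 0 < eps)
  (Hrho : visual_metric X d o rho eps).

Local Notation bd := (bpoint X d o).
Local Notation "x ~> xi" := (conv_to_bd X d o x xi) (at level 70).
Local Notation len g := (d o (act g o)).
Local Notation pprod := (partial_prod mul e).

Context (tau K c0 : R) (Good : G -> Prop) (Htau : 0 <= tau) (HK : 0 <= K)
  (Hwrap : wrapping (mul := mul) (inv := inv) (o := o) (d := d) (delta := delta) (act := act) tau K c0 Good).

(* 4 K + 1 is the width of the length window in [good_alphabet]. *)
Definition separation : R := 2 * ((4 * K + 1) + tau + 4 * delta).

(** Branches that part at level [m] have endpoints at distance at least
    [exp (- eps * partial_sum l (S m)) / C], by [branches_diverge] and the visual estimate. With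
    these radii the mass condition of [mass_distribution] becomes, after taking logarithms, the
    assumed bound on [ln (mass A n)]. Alphabets may vary with the level and may be singletons. *)
Lemma cantor_lower_bound (A : nat -> list G) (l : nat -> R) (t C0 : R) (S0 : bd -> Prop) :
  (forall n, NoDup (A n)) -> (forall n, A n <> nil) -> (forall n g, In g (A n) -> Good g) ->
  (forall n g, In g (A n) -> l n - (4 * K + 1) <= len g <= l n) ->
  (forall n g g', In g (A n) -> In g' (A n) -> g <> g' -> separation < d (act g o) (act g' o)) ->
  0 < t -> (forall n, ln (mass A n) <= - (t * eps) * partial_sum l (S n) + C0) ->
  (forall c xi, (forall n, In (c n) (A n)) -> (fun n => act (pprod c n) o) ~> xi -> S0 xi) ->
  haus_measure bd rho t S0 <> Finite 0.
Proof.
  intros HND Hne Hgood Hwin Hsep Ht Hmass HS0. pose proof delta_nonneg as Hdl.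
  destruct (visual_estimate Hproper Hgeod rho eps Heps Hrho) as (C & HC & Hvis).
  assert (Hbr : forall c, (forall n, In (c n) (A n)) -> forall n, Good (c n)).
  { intros c Hc n. exact (Hgood n _ (Hc n)). }
  assert (Hl1 : forall n, 1 <= l n).
  { intros n. specialize (Hne n). destruct (A n) as [|g m] eqn:E; [easy|].
    assert (Hg : In g (A n)) by (rewrite E; now left).
    pose proof (proj1 (proj2 Hwrap) g (Hgood n g Hg)). pose proof (Hwin n g Hg). lra. }
  assert (HL : forall m n, (m <= n)%nat -> partial_sum l m <= partial_sum l n).
  { intros m n Hmn; induction Hmn as [|n Hmn IH]; [lra|]. simpl. specialize (Hl1 n). lra. }
  assert (HLn : forall n, INR n <= partial_sum l n).
  { induction n as [|n IH]; [simpl; lra|]. rewrite S_INR. simpl. specialize (Hl1 n). lra. }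
  assert (Hlen : forall c, (forall n, In (c n) (A n)) -> forall n, len (pprod c n) <= partial_sum l n).
  { intros c Hc. induction n as [|n IH]; simpl.
    - rewrite (act_e (e := e) (act := act)), d_refl. lra.
    - pose proof (len_mul (o := o) (pprod c n) (c n)). pose proof (Hwin n _ (Hc n)). lra. }
  assert (Hlim : forall c, (forall n, In (c n) (A n)) -> exists xi : bd, (fun n => act (pprod c n) o) ~> xi).
  { intros c Hc. exists (bpoint_of _ (branch_conv tau K c0 Good Htau Hwrap c (Hbr c Hc))). apply bpoint_of_conv. }
  assert (Hinh : inhabited bd).
  { assert (Hx : exists c, forall n, In (c n) (A n)).
    { apply (choice (fun n g => In g (A n))). intros n. specialize (Hne n). destruct (A n) as [|g m]; [easy|]. exists g; now left. }
    destruct Hx as [c Hc]. destruct (Hlim c Hc) as [xi _]. now constructor. }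
  set (Phi := fun c : nat -> G => epsilon Hinh (fun xi => (fun n => act (pprod c n) o) ~> xi)).
  assert (HPhi : forall c, (forall n, In (c n) (A n)) -> (fun n => act (pprod c n) o) ~> Phi c).
  { intros c Hc. apply (epsilon_spec Hinh (fun xi => (fun n => act (pprod c n) o) ~> xi)), Hlim, Hc. }
  (* The radii carry a factor [/ C], so the mass constant has to contain [C ^ t]. *)
  apply (mass_distribution rho A Phi S0 (fun n => / C * exp (- eps * partial_sum l n)) t (exp (C0 + t * ln C)));
    try assumption.
  - apply exp_pos.
  - apply Hrho.
  - intros n. apply Rmult_lt_0_compat; [apply Rinv_0_lt_compat; lra|apply exp_pos].
  - intros eta Heta. destruct (INR_unbounded (- ln eta / eps)) as [N HN]. exists N. intros n Hn.
    assert (H1 : - ln eta < eps * partial_sum l n).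
    { apply Rlt_le_trans with (eps * INR N).
      - apply (Rmult_lt_compat_l eps) in HN; [|exact Heps].
        replace (eps * (- ln eta / eps)) with (- ln eta) in HN by (field; lra). exact HN.
      - apply Rmult_le_compat_l; [lra|]. eapply Rle_trans; [|apply HLn]. now apply le_INR. }
    apply Rle_lt_trans with (1 * exp (- eps * partial_sum l n)).
    + apply Rmult_le_compat_r; [left; apply exp_pos|].
      rewrite <- Rinv_1. apply Rinv_le_contravar; lra.
    + rewrite Rmult_1_l, <- (exp_ln eta) at 1 by exact Heta. apply exp_increasing. lra.
  - intros c c' Hc Hc' n Hlt. apply NNPP; intros Hnag.
    destruct (first_disagreement c c' n Hnag) as (m & Hm & Hag & Hcm).
    destruct (Hvis (Phi c) (Phi c') _ _ (partial_sum l (S m)) (S m) (HPhi c Hc) (HPhi c' Hc')) as [_ Hlow].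
    assert (Hrho' : / C * exp (- eps * partial_sum l (S m)) <= rho (Phi c) (Phi c')).
    { apply Hlow. intros i j Hi Hj.
      eapply Rle_trans;
        [apply (branches_diverge tau K c0 Good Htau Hwrap c c' m (l m) (4 * K + 1)); try assumption;
          try (now apply Hbr); try (now apply Hwin); now apply Hsep with m|].
      simpl. pose proof (Hlen c Hc m). lra. }
    assert (Hmono : / C * exp (- eps * partial_sum l n) <= / C * exp (- eps * partial_sum l (S m))).
    { apply Rmult_le_compat_l; [left; apply Rinv_0_lt_compat; lra|]. apply exp_mono.
      pose proof (Rmult_le_compat_l eps _ _ ltac:(lra) (HL (S m) n Hm)). lra. }
    lra.
  - intros n. unfold Rpower. rewrite ln_mult by (apply exp_pos || apply Rinv_0_lt_compat; lra).
    rewrite ln_exp, ln_Rinv, <- exp_plus by lra.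
    rewrite <- (exp_ln (mass A n)) by (apply mass_pos; assumption). apply exp_mono.
    specialize (Hmass n). nra.
  - intros c Hc. apply (HS0 c); [exact Hc|]. now apply HPhi.
Qed.

Lemma mass_succ_ln (A : nat -> list G) (n : nat) : (forall n, A n <> nil) ->
  ln (mass A (S n)) = ln (mass A n) - ln (INR (length (A n))).
Proof.
  intros Hne. simpl. pose proof (mass_pos A Hne n). pose proof (INR_length_pos _ (Hne n)).
  unfold Rdiv. rewrite ln_mult, ln_Rinv by (try apply Rinv_0_lt_compat; lra). lra.
Qed.

Context (t : R) (Ht : 0 < t) (Hexp : Rbar_lt (t * eps) (critical_exponent X d o G act)).

Lemma separation_nonneg : 0 <= separation.
Proof. pose proof delta_nonneg as Hdl. unfold separation. lra. Qed.

Lemma uniformly_conical_lower_bound :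
  haus_measure bd rho t (uniformly_conical_limit_set X d o G act) <> Finite 0.
Proof.
  destruct (good_alphabet tau K c0 Good Hwrap separation (t * eps) separation_nonneg
    (Rmult_lt_0_compat _ _ Ht Heps) Hexp) as (B & l & s & B1 & B2 & B3 & B4 & B5 & Hs & Hl & Hcard).
  (* The constant [t * eps * l] covers the one letter by which [partial_sum l (S n)] is ahead of the
     mass at level [n]. *)
  apply (cantor_lower_bound (fun _ => B) (fun _ => l) t (t * eps * l)); try assumption; try easy.
  - intros n. assert (Hsum : partial_sum (fun _ => l) (S n) = INR n * l + l).
    { induction n as [|n IH]; [simpl; lra|]. rewrite S_INR. simpl in *. lra. }
    rewrite Hsum. assert (Hm : ln (mass (fun _ => B) n) <= - (INR n * (s * l))).
    { induction n as [|n IH]; [simpl; rewrite ln_1; lra|].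
      rewrite mass_succ_ln by easy. rewrite S_INR. simpl in IH.
      assert (Hsum' : partial_sum (fun _ => l) (S n) = INR n * l + l) by (rewrite S_INR in Hsum; simpl in *; lra).
      specialize (IH Hsum'). lra. }
    assert (INR n * (t * eps * l) <= INR n * (s * l)).
    { apply Rmult_le_compat_l; [apply pos_INR|]. apply Rmult_le_compat_r; lra. }
    lra.
  - intros c xi Hc Hxi. apply (branch_uniformly_conical Hproper Hgeod tau K c0 Good Htau Hwrap c) with l; [|exact Hxi|].
    + intros n. now apply B3.
    + intros n. now apply B4.
Qed.

(** [G] is a countable union of finite balls. The enumeration may repeat elements. *)
Lemma group_enumeration : exists w : nat -> G, forall g, exists n, w n = g.
Proof.
  destruct (choice (fun k L => forall g, len g <= INR k -> In g L)
    (fun k => ball_finite (o := o) (INR k))) as [L HL].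
  exists (fun n => nth (snd (Cantor.of_nat n)) (L (fst (Cantor.of_nat n))) e). intros g.
  destruct (INR_unbounded (len g)) as [k Hk].
  destruct (In_nth (L k) g e (HL k g ltac:(lra))) as (i & _ & Hi).
  exists (Cantor.to_nat (k, i)). now rewrite Cantor.cancel_of_to.
Qed.

(* The state (j, E) counts the words inserted so far and their total cost; the next word is inserted at
   the first level where the cost stays below theta times the level, hence does not affect the dimension. *)
Fixpoint insertion_state (theta : R) (cost : nat -> R) (n : nat) : nat * R :=
  match n with
  | O => (0%nat, 0)
  | S m => let (j, E) := insertion_state theta cost m in
      if Rle_dec (E + cost j) (theta * INR (S m)) then (S j, E + cost j) else (j, E)
  end.

Definition inserts (theta : R) (cost : nat -> R) (n : nat) : Prop :=
  snd (insertion_state theta cost n) + cost (fst (insertion_state theta cost n)) <= theta * INR (S n).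

Lemma insertion_state_succ (theta : R) (cost : nat -> R) (n : nat) :
  insertion_state theta cost (S n) =
  if Rle_dec (snd (insertion_state theta cost n) + cost (fst (insertion_state theta cost n))) (theta * INR (S n))
  then (S (fst (insertion_state theta cost n)),
    snd (insertion_state theta cost n) + cost (fst (insertion_state theta cost n)))
  else insertion_state theta cost n.
Proof. cbn [insertion_state]. destruct (insertion_state theta cost n) as [j E]. reflexivity. Qed.

Lemma insertion_cost_le (theta : R) (cost : nat -> R) (n : nat) :
  0 < theta -> snd (insertion_state theta cost n) <= theta * INR n.
Proof.
  intros Hth. induction n as [|n IH]; [simpl; lra|]. rewrite insertion_state_succ.
  destruct (Rle_dec _ _); simpl fst; simpl snd; [assumption|].
  rewrite S_INR. lra.
Qed.

(** While word [j] waits, the state is constant, whereas the allowance [theta * INR (S n)] grows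
    without bound. *)
Lemma every_word_inserted (theta : R) (cost : nat -> R) : 0 < theta -> forall j,
  exists n, fst (insertion_state theta cost n) = j /\ inserts theta cost n.
Proof.
  intros Hth.
  assert (Hstep : forall j n, fst (insertion_state theta cost n) = j ->
    exists n', fst (insertion_state theta cost n') = j /\ inserts theta cost n').
  { intros j n Hn. apply NNPP; intros Hno.
    assert (Hconst : forall i, insertion_state theta cost (i + n) = insertion_state theta cost n).
    { induction i as [|i IH]; [reflexivity|]. change (S i + n)%nat with (S (i + n)). rewrite insertion_state_succ.
      destruct (Rle_dec _ _) as [Hle|]; [|exact IH].
      exfalso. apply Hno. exists (i + n)%nat. split; [now rewrite IH|exact Hle]. }
    set (E := snd (insertion_state theta cost n)).
    destruct (INR_unbounded ((E + cost j) / theta)) as [N HN].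
    apply Hno. exists (N + n)%nat. rewrite Hconst. split; [exact Hn|].
    unfold inserts. rewrite Hconst, Hn. fold E.
    assert (INR N <= INR (S (N + n))) by (apply le_INR; lia).
    apply (Rmult_lt_compat_l theta) in HN; [|exact Hth].
    replace (theta * ((E + cost j) / theta)) with (E + cost j) in HN by (field; lra). nra. }
  induction j as [|j (n & Hn & Hi)]; [now apply (Hstep 0%nat 0%nat)|].
  apply (Hstep (S j) (S n)). rewrite insertion_state_succ.
  destruct (Rle_dec _ _) as [|Hnle]; [simpl; now rewrite Hn|]. now exfalso; apply Hnle.
Qed.

Lemma myrberg_lower_bound : haus_measure bd rho t (myrberg_limit_set X d o G act) <> Finite 0.
Proof.
  destruct (good_alphabet tau K c0 Good Hwrap separation (t * eps) separation_nonneg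
    (Rmult_lt_0_compat _ _ Ht Heps) Hexp) as (B & l & s & B1 & B2 & B3 & B4 & B5 & Hs & Hl & Hcard).
  pose proof (Rmult_lt_0_compat _ _ Ht Heps) as Hte.
  destruct group_enumeration as [w Hw].
  assert (Hg0 : exists g0, Good g0).
  { destruct B as [|g0 B']; [easy|]. exists g0. apply B3. now left. }
  destruct Hg0 as [g0 Hg0].
  destruct (choice (fun j g => Good g /\ (K <= len (w j) -> exists r s, g = mul r (mul (w j) s) /\
    len r + len (w j) + len s - c0 <= len g))) as [I HI].
  { intros j. destruct (Rle_dec K (len (w j))) as [Hj|Hj]; [|now exists g0].
    destruct (proj2 (proj2 Hwrap) (w j) Hj) as (r & s' & _ & _ & Hgd & Hlen).
    exists (mul r (mul (w j) s')). split; [exact Hgd|]. intros _. now exists r, s'. }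
  (* An insertion adds [len (I j)] to the length and uses up a free level, whose contribution
     [s * l] to the logarithm of the mass is lost; the cost dominates both. *)
  set (cost := fun j => len (I j) + l).
  (* Costs of [theta] per level weaken the mass estimate by [s * theta] and lengthen the product by
     [theta], worth [t * eps * theta]. This value makes the two together equal to the surplus
     [(s - t * eps) * l] per level. *)
  set (theta := (s - t * eps) * l / (s + t * eps)).
  assert (Hth : 0 < theta).
  { unfold theta. apply Rdiv_lt_0_compat; [|lra]. apply Rmult_lt_0_compat; lra. }
  assert (Hth2 : (s + t * eps) * theta = (s - t * eps) * l) by (unfold theta; field; lra).
  set (st := insertion_state theta cost).
  set (dec := fun n => excluded_middle_informative (inserts theta cost n)).
  set (A := fun n => if dec n then I (fst (st n)) :: nil else B).
  set (ls := fun n => if dec n then len (I (fst (st n))) else l).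
  assert (HA : forall n, A n <> nil) by (intros n; unfold A; destruct (dec n); easy).
  assert (Hst : forall n, snd (st (S n)) = if dec n then snd (st n) + cost (fst (st n)) else snd (st n)).
  { intros n. unfold st. rewrite insertion_state_succ. unfold dec, inserts.
    destruct (Rle_dec _ _), (excluded_middle_informative _); easy. }
  assert (Hsum : forall n, partial_sum ls n <= INR n * l + snd (st n)).
  { induction n as [|n IH]; [simpl; lra|]. rewrite Hst, S_INR. simpl partial_sum. unfold ls at 2.
    destruct (dec n); unfold cost; lra. }
  assert (Hmass : forall n, ln (mass A n) <= - (INR n * (s * l)) + s * snd (st n)).
  { induction n as [|n IH]; [simpl; rewrite ln_1; lra|].
    rewrite mass_succ_ln, Hst, S_INR by exact HA. unfold A at 2. destruct (dec n).
    - change (INR (length (I (fst (st n)) :: nil))) with 1. rewrite ln_1. unfold cost.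
      pose proof (d_pos o (act (I (fst (st n))) o)) as Hp.
      assert (0 <= s * len (I (fst (st n)))) by (apply Rmult_le_pos; lra). lra.
    - lra. }
  apply (cantor_lower_bound A ls t (t * eps * (l + theta))); try assumption.
  - intros n. unfold A. destruct (dec n); [|exact B1]. constructor; [easy|constructor].
  - intros n g. unfold A. destruct (dec n); [|apply B3]. intros [<-|[]]. apply HI.
  - intros n g. unfold A, ls. destruct (dec n); [|apply B4]. intros [<-|[]]. lra.
  - intros n g g'. unfold A. destruct (dec n); [|apply B5]. intros [<-|[]] [<-|[]] Hne. easy.
  - intros n. specialize (Hmass n). pose proof (Hsum (S n)) as Hsn. rewrite S_INR in Hsn.
    pose proof (insertion_cost_le theta cost n Hth) as C1. fold st in C1.
    pose proof (insertion_cost_le theta cost (S n) Hth) as C2. fold st in C2. rewrite S_INR in C2.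
    assert (H1 : s * snd (st n) <= s * (theta * INR n)) by (apply Rmult_le_compat_l; lra).
    assert (H2 : t * eps * partial_sum ls (S n) <= t * eps * ((INR n + 1) * l + theta * (INR n + 1))).
    { apply Rmult_le_compat_l; lra. }
    assert (H3 : INR n * ((s + t * eps) * theta) = INR n * ((s - t * eps) * l)) by now rewrite Hth2.
    lra.
  - intros c xi Hc Hxi.
    assert (Hgood : forall n, Good (c n)).
    { intros n. specialize (Hc n). unfold A in Hc. destruct (dec n); [|now apply B3].
      destruct Hc as [<-|[]]. apply HI. }
    apply (branch_myrberg tau K c0 Good Htau Hwrap c Hgood xi Hxi).
    intros v Hv. destruct (Hw v) as [j <-].
    destruct (every_word_inserted theta cost Hth j) as (n & Hn & Hi). fold st in Hn.
    destruct (proj2 (HI j) Hv) as (r & s' & E1 & E2).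
    assert (Hcn : c n = I j).
    { specialize (Hc n). unfold A in Hc. destruct (dec n) as [_|Hni]; [|easy].
      destruct Hc as [Hc|[]]. now rewrite <- Hc, Hn. }
    exists n, r, s'. now rewrite Hcn.
Qed.

End LowerBound.

(** * Covering by shadows *)

Lemma haus_measure_zero_subset {T : Type} (rho : T -> T -> R) (s : R) (A B : T -> Prop) :
  (forall x, A x -> B x) -> haus_measure T rho s B = Finite 0 -> haus_measure T rho s A = Finite 0.
Proof.
  intros HAB HB. apply haus_measure_zero_intro. intros eta eps He Hp.
  destruct (haus_measure_zero_elim rho s B HB eta eps He Hp) as (U & H1 & H2).
  exists U; split; [|exact H2]. intros x Hx. now apply H1, HAB.
Qed.

Lemma diam_pow_empty {T : Type} (rho : T -> T -> R) (s : R) (U : T -> Prop) :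
  (forall x, ~ U x) -> diam_pow T rho s U = 0.
Proof.
  intros HU. unfold diam_pow.
  assert (H : Rbar_le (diam T rho U) m_infty).
  { apply (proj2 (Rbar_lub_spec _)). intros v (x & _ & Hx & _). now apply HU in Hx. }
  destruct (diam T rho U); simpl in H; easy.
Qed.

Lemma exp_small (b y : R) : 0 < b -> 0 < y ->
  exists N, forall n, (N <= n)%nat -> exp (- b * INR n) < y.
Proof.
  intros Hb Hy. destruct (INR_unbounded (- ln y / b)) as [N HN]. exists N. intros n Hn.
  assert (H1 : - ln y < b * INR n).
  { apply Rlt_le_trans with (b * INR N).
    - apply (Rmult_lt_compat_l b) in HN; [|exact Hb].
      replace (b * (- ln y / b)) with (- ln y) in HN by (field; lra). exact HN.
    - apply Rmult_le_compat_l; [lra|]. now apply le_INR. }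
  rewrite <- (exp_ln y) by exact Hy. apply exp_increasing. lra.
Qed.

Lemma sum_ind_length (P : nat -> Prop) (N : nat) :
  sum_f_R0 (fun i => indicator (P i) 1) N = INR (length (keep P (List.seq 0 (S N)))).
Proof.
  assert (Hone : forall i, indicator (P i) 1 = INR (length (keep P (i :: nil)))).
  { intros i. unfold indicator, keep. simpl. destruct (excluded_middle_informative (P i)); reflexivity. }
  induction N as [|N IH]; [apply Hone|].
  rewrite seq_S. unfold keep. rewrite filter_app, length_app, plus_INR.
  fold (keep P (List.seq 0 (S N))). rewrite <- IH. simpl sum_f_R0. f_equal. apply Hone.
Qed.

Section UpperBound.

Context {X : Type} {d : X -> X -> R} {delta : R} {Hd : metric d} {Hh : hyperbolic d delta}.
Context (Hproper : proper_space d) (Hgeod : geodesic_space d).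
Context {G : Type} {mul : G -> G -> G} {inv : G -> G} {e : G} {act : G -> X -> X}.
Context {HG : proper_isometric_action d mul inv e act} {o : X}.
Context (rho : bpoint X d o -> bpoint X d o -> R) (eps : R) (Heps : 0 < eps)
  (Hrho : visual_metric X d o rho eps).

Local Notation gp := (gromov_product d).
Local Notation bd := (bpoint X d o).
Local Notation "x ~> xi" := (conv_to_bd X d o x xi) (at level 70).
Local Notation len g := (d o (act g o)).
Local Notation count n := (card (fun g => len g <= INR n)).

(** A tail of the Poincare series, grouped by the integer part [k] of the length: group [k] lies in
    the ball of radius [k + 1], so the groups are dominated by a geometric series of ratio
    [exp (- (s2 - s1))], and the bound on [S0] telescopes. Restricting to first occurrences in [w]
    counts each element once. *)
Lemma poincare_tail (w : nat -> G) (fl : G -> nat) (s1 s2 : R) (N0 T N : nat) :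
  s1 < s2 -> (forall g, INR (fl g) <= len g < INR (fl g) + 1) ->
  (forall n, (N0 <= n)%nat -> INR (count n) <= exp (s1 * INR n)) -> (N0 <= T)%nat ->
  sum_f_R0 (fun i => indicator ((forall m, (m < i)%nat -> w m <> w i) /\ (T <= fl (w i))%nat)
    (exp (- s2 * INR (fl (w i))))) N
  <= exp s1 / (1 - exp (- (s2 - s1))) * exp (- (s2 - s1) * INR T).
Proof.
  intros Hs Hfl Hcount HT.
  set (q := exp (- (s2 - s1))). set (P := fun i => forall m, (m < i)%nat -> w m <> w i).
  assert (Hq : 0 < q < 1).
  { unfold q. split; [apply exp_pos|]. rewrite <- exp_0. apply exp_increasing. lra. }
  assert (Hcnt : forall k, (N0 <= k)%nat ->
    sum_f_R0 (fun i => indicator (P i /\ fl (w i) = k) 1) N <= exp (s1 * INR (S k))).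
  { intros k Hk. rewrite sum_ind_length. eapply Rle_trans; [|apply Hcount; lia].
    apply le_INR. destruct (ball_card (mul := mul) (inv := inv) (e := e) (act := act) (o := o) (S k)) as (L & _ & HL & <-).
    rewrite <- (length_map w). apply NoDup_incl_length.
    - apply NoDup_map_NoDup_ForallPairs; [|apply keep_NoDup, seq_NoDup].
      intros i j Hi Hj Hij. apply keep_In in Hi, Hj. destruct Hi as (_ & Pi & _), Hj as (_ & Pj & _).
      destruct (Nat.lt_trichotomy i j) as [Hlt|[->|Hlt]]; [|reflexivity|].
      + exfalso; exact (Pj i Hlt Hij).
      + exfalso; exact (Pi j Hlt (eq_sym Hij)).
    - intros g Hg. apply in_map_iff in Hg. destruct Hg as (i & <- & Hi). apply keep_In in Hi.
      destruct Hi as (_ & _ & Hk'). apply HL. specialize (Hfl (w i)). rewrite S_INR, <- Hk'. lra. }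
  set (S0 := fun J => sum_f_R0 (fun i => indicator (P i /\ (T <= fl (w i) < T + J)%nat) (exp (- s2 * INR (fl (w i))))) N).
  assert (HS : forall J, S0 J <= exp s1 / (1 - q) * (exp (- (s2 - s1) * INR T) - exp (- (s2 - s1) * INR (T + J)))).
  { induction J as [|J IH].
    - rewrite Nat.add_0_r, Rminus_diag, Rmult_0_r. unfold S0. rewrite (sum_eq _ (fun _ => 0)).
      + rewrite sum_cte. lra.
      + intros i _. unfold indicator. destruct (excluded_middle_informative _); [lia|reflexivity].
    - assert (Hstep : S0 (S J) <= S0 J + exp (- s2 * INR (T + J)) * exp (s1 * INR (S (T + J)))).
      { eapply Rle_trans; [|apply Rplus_le_compat_l, Rmult_le_compat_l;
          [left; apply exp_pos|apply Hcnt; lia]].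
        rewrite scal_sum. unfold S0. rewrite <- plus_sum. apply sum_Rle. intros i _.
        pose proof (exp_pos (- s2 * INR (fl (w i)))) as Hp.
        pose proof (exp_pos (- s2 * INR (T + J))) as Hp'. unfold indicator.
        destruct (excluded_middle_informative (P i /\ (T <= fl (w i) < T + S J)%nat)) as [H1|H1];
        destruct (excluded_middle_informative (P i /\ (T <= fl (w i) < T + J)%nat)) as [H2|H2];
        destruct (excluded_middle_informative (P i /\ fl (w i) = (T + J)%nat)) as [H3|H3]; try lra.
        - destruct H3 as [_ ->]. lra.
        - exfalso. destruct H1 as [HP H1].
          assert (~ (T <= fl (w i) < T + J)%nat) by tauto. assert (fl (w i) <> (T + J)%nat) by tauto. lia. }
      assert (E1 : exp (- s2 * INR (T + J)) * exp (s1 * INR (S (T + J))) = exp s1 * exp (- (s2 - s1) * INR (T + J))).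
      { rewrite <- !exp_plus. f_equal. rewrite S_INR. ring. }
      assert (E2 : exp (- (s2 - s1) * INR (T + S J)) = q * exp (- (s2 - s1) * INR (T + J))).
      { unfold q. rewrite <- exp_plus. f_equal. replace (T + S J)%nat with (S (T + J)) by lia. rewrite S_INR. ring. }
      rewrite E1 in Hstep. rewrite E2. eapply Rle_trans; [exact Hstep|].
      eapply Rle_trans; [apply Rplus_le_compat_r, IH|]. apply Req_le. field. lra. }
  assert (HJ : exists J, forall i, (i <= N)%nat -> (fl (w i) < T + J)%nat).
  { clear. induction N as [|N (J & HJ)].
    - exists (S (fl (w 0%nat))). intros i Hi. replace i with 0%nat by lia. lia.
    - exists (J + S (fl (w (S N))))%nat. intros i Hi.
      destruct (Nat.eq_dec i (S N)) as [->|]; [lia|]. specialize (HJ i ltac:(lia)). lia. }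
  destruct HJ as [J HJ].
  eapply Rle_trans; [apply (sum_Rle _ (fun i => indicator (P i /\ (T <= fl (w i) < T + J)%nat) (exp (- s2 * INR (fl (w i))))))|].
  - intros i Hi. apply ind_le; [left; apply exp_pos|]. intros [H1 H2]. split; [exact H1|].
    split; [exact H2|now apply HJ].
  - eapply Rle_trans; [apply HS|]. apply Rmult_le_compat_l.
    + apply Rlt_le, Rdiv_lt_0_compat; [apply exp_pos|lra].
    + pose proof (exp_pos (- (s2 - s1) * INR (T + J))). lra.
Qed.

(* Shadow of radius kappa * len g: slowly growing radii absorb the constant R of a conical point, so a
   single countable cover handles all R at once. *)
Definition shadow (kappa : R) (g : G) (xi : bd) : Prop :=
  exists x M, x ~> xi /\ forall j, (M <= j)%nat -> (1 - kappa) * len g <= gp o (act g o) (x j).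

Lemma conical_in_shadows (kappa : R) (xi : bd) (T : R) : 0 < kappa ->
  conical_limit_set X d o G act xi -> exists g, T <= len g /\ shadow kappa g xi.
Proof.
  intros Hk (_ & gs & Rr & g & HR & Hgs & (G0 & G1 & G2) & Hnear).
  destruct (conv_far _ (to_bd_conv _ _ Hgs) (Rmax T (Rr / kappa))) as [n Hn].
  specialize (Hn n (le_n n)). cbv beta in Hn.
  pose proof (Rmax_l T (Rr / kappa)). pose proof (Rmax_r T (Rr / kappa)) as Hr.
  exists (gs n). split; [lra|].
  destruct (Hnear n) as (t & Ht & Hdt). destruct (INR_unbounded t) as [M HM].
  exists (fun j => g (INR j)), M. split; [exact G2|]. intros j Hj.
  assert (Htj : t <= INR j). { assert (INR M <= INR j) by now apply le_INR. lra. }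
  set (p := act (gs n) o) in *.
  assert (Hkl : Rr <= kappa * d o p).
  { assert (Hr' : Rr / kappa <= d o p) by lra. apply (Rmult_le_compat_l kappa) in Hr'; [|lra].
    replace (kappa * (Rr / kappa)) with Rr in Hr' by (field; lra). exact Hr'. }
  pose proof (G1 0 (INR j) ltac:(lra) ltac:(lra)) as D1. pose proof (G1 0 t ltac:(lra) ltac:(lra)) as D2.
  pose proof (G1 t (INR j) ltac:(lra) ltac:(lra)) as D3.
  rewrite G0, Rabs_left1 in D1, D2 by lra. rewrite Rabs_left1 in D3 by lra.
  pose proof (d_tri p (g t) (g (INR j))). pose proof (d_tri o (g t) p) as T2. rewrite (d_sym (g t) p) in T2.
  unfold gromov_product. lra.
Qed.

Lemma conical_upper_bound (s : R) : 0 < s ->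
  Rbar_lt (critical_exponent X d o G act) (s * eps) ->
  haus_measure bd rho s (conical_limit_set X d o G act) = Finite 0.
Proof.
  intros Hs Hlt. pose proof delta_nonneg as Hdl. pose proof (Rmult_lt_0_compat _ _ Hs Heps) as Hse.
  assert (Hs1 : exists s1, 0 < s1 /\ s1 < s * eps /\ Rbar_lt (critical_exponent X d o G act) s1).
  { destruct (critical_exponent X d o G act) as [q| |]; simpl in *; [|easy|exists (s * eps / 2); lra].
    exists ((Rmax 0 q + s * eps) / 2). pose proof (Rmax_l 0 q). pose proof (Rmax_r 0 q).
    assert (Rmax 0 q < s * eps) by (apply Rmax_lub_lt; lra). lra. }
  destruct Hs1 as (s1 & H1 & H2 & H3).
  destruct (critical_exponent_lt (mul := mul) (inv := inv) (e := e) s1 H3) as [N0 HN0].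
  (* Both [s1] and [s2] lie strictly between the critical exponent and [s * eps], with [s1 < s2].
     The value of [kappa] is such that the [s]-th power of the diameter of a shadow is of order at
     most [exp (- s2 * len g)], so the enlarged shadows remain summable. *)
  set (s2 := (s1 + s * eps) / 2). set (kappa := 1 - s2 / (s * eps)).
  assert (Hk1 : 0 < kappa).
  { unfold kappa. assert (s2 / (s * eps) < 1).
    { apply (Rmult_lt_reg_r (s * eps)); [exact Hse|]. unfold Rdiv. rewrite Rmult_assoc, Rinv_l by lra. unfold s2; lra. }
    lra. }
  assert (Hk2 : s * eps * (1 - kappa) = s2) by (unfold kappa; field; lra).
  assert (Hk3 : 0 < 1 - kappa).
  { unfold kappa. assert (0 < s2 / (s * eps)) by (apply Rdiv_lt_0_compat; unfold s2; lra). lra. }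
  destruct (visual_estimate Hproper Hgeod rho eps Heps Hrho) as (C & HC & Hvis).
  destruct (group_enumeration (mul := mul) (inv := inv) (e := e) (act := act) (o := o)) as [w Hw].
  assert (Hfl : exists fl : G -> nat, forall g, INR (fl g) <= len g < INR (fl g) + 1).
  { apply (choice (fun g k => INR k <= len g < INR k + 1)). intros g.
    destruct (nfloor_ex (len g) (d_pos _ _)) as [k Hk]. now exists k. }
  destruct Hfl as [fl Hfl].
  set (C' := C * exp (eps * delta)).
  assert (HC' : 0 < C') by (apply Rmult_lt_0_compat; [lra|apply exp_pos]).
  assert (Hsh : forall g xi eta, shadow kappa g xi -> shadow kappa g eta ->
    rho xi eta <= C' * exp (- (eps * (1 - kappa)) * INR (fl g))).
  { intros g xi eta (x & M & Hx & HM) (y & M' & Hy & HM').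
    destruct (Hvis xi eta x y ((1 - kappa) * len g - delta) (Nat.max M M') Hx Hy) as [Hup _].
    eapply Rle_trans; [apply Hup|].
    - intros i j Hi Hj. specialize (HM i ltac:(lia)). specialize (HM' j ltac:(lia)). rewrite gp_sym in HM.
      now apply (gp_hyp o (x i) (act g o) (y j)).
    - unfold C'. rewrite Rmult_assoc, <- exp_plus. apply Rmult_le_compat_l; [lra|]. apply exp_mono.
      specialize (Hfl g).
      assert (eps * (1 - kappa) * INR (fl g) <= eps * (1 - kappa) * len g).
      { apply Rmult_le_compat_l; [|lra]. apply Rmult_le_pos; lra. }
      lra. }
  apply haus_measure_zero_intro. intros eta mu Heta Hmu.
  set (q := exp s1 / (1 - exp (- (s2 - s1)))).
  assert (Hs12 : s1 < s2) by (unfold s2; lra).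
  assert (Hq : 0 < q).
  { apply Rdiv_lt_0_compat; [apply exp_pos|].
    assert (exp (- (s2 - s1)) < exp 0) by (apply exp_increasing; lra). rewrite exp_0 in *. lra. }
  set (Cs := Rpower C' s). assert (HCs : 0 < Cs) by apply exp_pos.
  destruct (exp_small (eps * (1 - kappa)) (eta / C')) as [T1 HT1].
  { apply Rmult_lt_0_compat; lra. }
  { now apply Rdiv_lt_0_compat. }
  destruct (exp_small (s2 - s1) (mu / (Cs * q))) as [T2 HT2].
  { lra. }
  { apply Rdiv_lt_0_compat; [exact Hmu|]. now apply Rmult_lt_0_compat. }
  (* [N0] makes the counting bound valid, [T1] the diameters at most [eta], [T2] the tail of the
     series at most [mu]. *)
  set (T := Nat.max N0 (Nat.max T1 T2)).
  exists (fun i xi => ((forall m, (m < i)%nat -> w m <> w i) /\ (T <= fl (w i))%nat) /\ shadow kappa (w i) xi).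
  split; [|split].
  - intros xi Hxi. destruct (conical_in_shadows kappa xi (INR T + 1) Hk1 Hxi) as (g & Hg & Hsg).
    assert (Hfirst : exists i, w i = g /\ forall m, (m < i)%nat -> w m <> g).
    { destruct (Hw g) as [n Hn]. revert Hn. induction n as [n IH] using (well_founded_ind lt_wf). intros Hn.
      destruct (classic (exists m, (m < n)%nat /\ w m = g)) as [(m & Hm & Hmg)|Hno].
      - now apply (IH m Hm).
      - exists n; split; [exact Hn|]. intros m Hm Hmg. apply Hno. now exists m. }
    destruct Hfirst as (i & <- & Hi). exists i. split; [split; [exact Hi|]|exact Hsg].
    specialize (Hfl (w i)). apply INR_le. lra.
  - intros i xi zeta ((_ & HTi) & Hx) (_ & Hy). eapply Rle_trans; [now apply (Hsh (w i))|].
    specialize (HT1 (fl (w i)) ltac:(lia)). apply (Rmult_lt_compat_l C') in HT1; [|exact HC'].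
    replace (C' * (eta / C')) with eta in HT1 by (field; lra). lra.
  - intros N.
    apply Rle_trans with (sum_f_R0 (fun i => Cs * indicator ((forall m, (m < i)%nat -> w m <> w i) /\ (T <= fl (w i))%nat)
      (exp (- s2 * INR (fl (w i))))) N).
    + apply sum_Rle. intros i _. unfold indicator. destruct (excluded_middle_informative _) as [Hi|Hi].
      * eapply Rle_trans; [apply diam_pow_le with (r := C' * exp (- (eps * (1 - kappa)) * INR (fl (w i))))|].
        -- exact Hs.
        -- apply Rmult_lt_0_compat; [exact HC'|apply exp_pos].
        -- intros xi zeta (_ & Hx) (_ & Hy). now apply Hsh.
        -- rewrite <- Rpower_mult_distr by (exact HC' || apply exp_pos). fold Cs.
           apply Req_le. f_equal. unfold Rpower. rewrite ln_exp. f_equal. rewrite <- Hk2. ring.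
      * rewrite diam_pow_empty; [lra|]. intros xi [H _]. now apply Hi.
    + rewrite (sum_eq _ (fun i => indicator ((forall m, (m < i)%nat -> w m <> w i) /\ (T <= fl (w i))%nat)
        (exp (- s2 * INR (fl (w i)))) * Cs)) by (intros; ring).
      rewrite <- scal_sum.
      assert (Hp := poincare_tail w fl s1 s2 N0 T N Hs12 Hfl HN0 ltac:(lia)). fold q in Hp.
      apply (Rmult_le_compat_l Cs) in Hp; [|lra].
      eapply Rle_trans; [exact Hp|]. specialize (HT2 T ltac:(lia)).
      apply (Rmult_lt_compat_l (Cs * q)) in HT2; [|now apply Rmult_lt_0_compat].
      replace (Cs * q * (mu / (Cs * q))) with mu in HT2 by (field; lra). lra.
Qed.

(** Every ball contains [e]. The Hausdorff dimension is an infimum over positive exponents, so the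
    formula could not hold with a negative value. *)
Lemma critical_exponent_nonneg : Rbar_le 0 (critical_exponent X d o G act).
Proof.
  apply Rbar_not_lt_le. intros Hlt.
  assert (Hs : exists s, s < 0 /\ Rbar_lt (critical_exponent X d o G act) s).
  { destruct (critical_exponent X d o G act) as [q| |]; simpl in *; [|easy|exists (-1); lra].
    exists (q / 2); lra. }
  destruct Hs as (s & Hs & Hs'). destruct (critical_exponent_lt (mul := mul) (inv := inv) (e := e) s Hs') as [N HN].
  specialize (HN (S N) ltac:(lia)).
  pose proof (count_pos (mul := mul) (inv := inv) (e := e) (act := act) (o := o) (S N)) as Hc.
  apply le_INR in Hc. change (INR 1) with 1 in Hc.
  assert (exp (s * INR (S N)) < exp 0).
  { apply exp_increasing. pose proof (lt_0_INR (S N) ltac:(lia)). nra. }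
  rewrite exp_0 in *. lra.
Qed.

(** One upper bound, for the conical set, serves all its subsets. For an infinite exponent it is
    vacuous, and the lower bound then runs over all positive [t]. *)
Lemma dimension_eq (A : bd -> Prop) :
  (forall xi, A xi -> conical_limit_set X d o G act xi) ->
  (forall t, 0 < t -> Rbar_lt (t * eps) (critical_exponent X d o G act) -> haus_measure bd rho t A <> Finite 0) ->
  hausdorff_dim bd rho A = Rbar_mult (critical_exponent X d o G act) (Finite (/ eps)).
Proof.
  intros Hsub Hlow. pose proof critical_exponent_nonneg as Hnn.
  assert (Hinv : 0 < / eps) by now apply Rinv_0_lt_compat.
  apply Rbar_le_antisym.
  - pose proof conical_upper_bound as Hup.
    destruct (critical_exponent X d o G act) as [q| |]; [| |easy].
    + simpl in *. apply (hausdorff_dim_le rho (q * / eps)); [apply Rmult_le_pos; lra|].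
      intros s Hs. apply (haus_measure_zero_subset rho s _ _ Hsub). apply Hup.
      * assert (0 <= q * / eps) by (apply Rmult_le_pos; lra). lra.
      * apply (Rmult_lt_compat_r eps) in Hs; [|exact Heps].
        rewrite Rmult_assoc, Rinv_l, Rmult_1_r in Hs by lra. exact Hs.
    + rewrite Rbar_mult_comm. simpl. destruct (Rle_dec 0 (/ eps)) as [H|H]; [|lra].
      destruct (Rle_lt_or_eq_dec 0 (/ eps) H); [|lra].
      now destruct (hausdorff_dim bd rho A).
  - apply hausdorff_dim_ge. intros s Hs Hlt. apply Hlow; [exact Hs|].
    destruct (critical_exponent X d o G act) as [q| |]; [|easy|easy].
    simpl in *. apply (Rmult_lt_compat_r eps) in Hlt; [|exact Heps].
    rewrite Rmult_assoc, Rinv_l, Rmult_1_r in Hlt by lra. exact Hlt.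
Qed.

End UpperBound.

Theorem theorem7p1
  (X : Type) (d : X -> X -> R) (o : X)
  (G : Type) (mul : G -> G -> G) (inv : G -> G) (e : G) (act : G -> X -> X)
  (Hmetric : is_metric d) (Hproper : proper_space d) (Hgeod : geodesic_space d)
  (Hhyp : gromov_hyperbolic d)
  (Hgroup : is_group G mul inv e)
  (Hisom : isometric_action X d G mul e act)
  (Hpact : proper_action X d G act)
  (Hnonel : non_elementary X d o G act)
  (eps : R) (Heps : 0 < eps)
  (rho : bpoint X d o -> bpoint X d o -> R)
  (Hrho : visual_metric X d o rho eps) :
  hausdorff_dim (bpoint X d o) rho (conical_limit_set X d o G act)
    = Rbar_mult (critical_exponent X d o G act) (Finite (/ eps)) /\
  hausdorff_dim (bpoint X d o) rho (uniformly_conical_limit_set X d o G act)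
    = Rbar_mult (critical_exponent X d o G act) (Finite (/ eps)) /\
  hausdorff_dim (bpoint X d o) rho (myrberg_limit_set X d o G act)
    = Rbar_mult (critical_exponent X d o G act) (Finite (/ eps)).
Proof.
  destruct Hhyp as (delta & Hdelta & Hhyp0).
  pose proof (Build_hyperbolic _ d delta Hdelta Hhyp0) as Hh.
  pose proof (Hmetric : metric d) as Hd.
  pose proof (Build_proper_isometric_action _ d _ mul inv e act Hgroup Hisom Hpact) as HG.
  destruct (wrapping_exists (o := o) Hproper Hgeod Hnonel) as (tau & K & c & Good & Htau & HK & Hwrap).
  assert (Hu : forall t, 0 < t -> Rbar_lt (t * eps) (critical_exponent X d o G act) ->
    haus_measure _ rho t (uniformly_conical_limit_set X d o G act) <> Finite 0).
  { intros t Ht. exact (uniformly_conical_lower_bound Hproper Hgeod rho eps Heps Hrho tau K c Good Htau HK Hwrap t Ht). }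
  assert (Hsub : forall xi, uniformly_conical_limit_set X d o G act xi -> conical_limit_set X d o G act xi).
  { intros xi (H1 & gs & Rr & g & H2 & H3 & H4 & H5 & _). split; [exact H1|]. now exists gs, Rr, g. }
  split; [|split]; apply (dimension_eq (mul := mul) (inv := inv) (e := e) Hproper Hgeod rho eps Heps Hrho).
  - easy.
  - intros t Ht Hlt H0. now apply (Hu t Ht Hlt), (haus_measure_zero_subset rho t _ _ Hsub).
  - exact Hsub.
  - exact Hu.
  - intros xi. now apply (myrberg_conical (mul := mul) (inv := inv) (e := e) Hproper Hgeod).
  - intros t Ht. exact (myrberg_lower_bound Hproper Hgeod rho eps Heps Hrho tau K c Good Htau HK Hwrap t Ht).
Qed.
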